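(* Assume that, for almost every realization of $\mathcal N$, the clan of ancestors $\mathcal A^\varphi$ is finite for every point $\varphi=(\gamma,t,s)$. Let $\nu$ be an invariant measure for the loss network dynamics with generator $\mathcal L f(\eta)=\sum_{\gamma\in\Gamma}w(\gamma)\mathbf 1\{\gamma\sim\eta\}[f(\eta+\delta_\gamma)-f(\eta)]+\sum_{\gamma\in\Gamma}[f(\eta-\delta_\gamma)-f(\eta)]$ that is supported on finite-cycle configurations. Then $\nu=\mu$, where $\mu$ is the law of the stationary process $\eta_t$ at any fixed time $t$.
   Context: Fix $\alpha>0$ and a strictly convex potential $V:\mathbb{Z}^d\to\mathbb{R}^+\cup\{+\infty\}$ with $V(\vec0)=0$. $\Gamma$ is the set of finite cycles of $\mathbb{Z}^d$ (a cycle of length $n\ge2$ on distinct sites $x_1,\dots,x_n$ maps $x_i\mapsto x_{i+1}$ mod $n$ and fixes other sites; support $\{\gamma\}$); configurations $\eta\in\{0,1\}^\Gamma$ with pairwise disjoint supports of present cycles are identified with finite-cycle permutations. $w(\gamma)=\exp\{-\alpha\sum_{x\in\{\gamma\}}V(\gamma(x)-x)\}$; $\gamma\not\sim\gamma'$ if supports intersect; $\gamma\sim\eta$ if $\gamma$ is compatible with all $\gamma'$ with $\eta(\gamma')=1$; $\delta_\gamma(\gamma')=\mathbf1\{\gamma'=\gamma\}$. $\mathcal N$ is a Poisson point process on $\Gamma\times\mathbb{R}\times\mathbb{R}^+$ with intensity $w(\gamma)\,dt\,e^{-s}ds$. For $\varphi=(\gamma,t,s)$: $\mathcal A_1^\varphi=\{(\gamma',t',s')\in\mathcal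 N:\gamma'\not\sim\gamma,\ t'<t<t'+s'\}$, $\mathcal A^\varphi_{n+1}=\bigcup_{\varphi'\in\mathcal A^\varphi_n}\mathcal A_1^{\varphi'}$, $\mathcal A^\varphi=\bigcup_{n\ge1}\mathcal A_n^\varphi$; $\mathcal D_0=\emptyset$, $\mathcal K_n=\{\varphi\in\mathcal N:\mathcal A_1^\varphi\setminus\mathcal D_{n-1}=\emptyset\}$, $\mathcal D_n=\{\varphi\in\mathcal N:\mathcal A_1^\varphi\cap\mathcal K_n\neq\emptyset\}$, $\mathcal K=\bigcup_n\mathcal K_n$; the stationary loss network is $\eta_t(\gamma)=\#\{(\gamma,t',s')\in\mathcal K:t'\le t<t'+s'\}$. *)

(* Defs.v *)
From HB Require Import structures.
From mathcomp Require Import all_boot all_order all_algebra.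
From mathcomp Require Import all_classical all_reals all_analysis.
Set Implicit Arguments. Unset Strict Implicit. Unset Printing Implicit Defensive.
Import Order.TTheory GRing.Theory Num.Theory.
Local Open Scope classical_set_scope.
Local Open Scope ring_scope.

Definition site (d : nat) := 'rV[int]_d.

(* A finite cycle of length n >= 2 on distinct sites x_1,...,x_n
   (x_i |-> x_{i+1} mod n, other sites fixed) is represented canonically
   by the duplicate-free list [:: x_1; ...; x_n] rotated so that its head
   is the element with the least code (pickle); this gives exactly one
   representative per cycle. *)
Definition is_cyc (d : nat) (c : seq (site d)) : bool :=
  [&& uniq c, (1 < size c)%N &
      if c is x :: _ then all (fun y => pickle x <= pickle y)%N c else false].

Definition cyc (d : nat) := {c : seq (site d) | is_cyc c}.

Definition cyc_map (d : nat) (g : cyc d) (x : site d) : site d := next (val g) x.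

Definition supp (d : nat) (g : cyc d) : set (site d) := [set x | x \in val g].

Definition incompat (d : nat) (g g' : cyc d) : Prop := supp g `&` supp g' !=set0.

Definition embed (R : realType) (d : nat) (z : site d) : 'rV[R]_d :=
  map_mx (fun k : int => k%:~R) z.

Definition strictly_convex_pot (R : realType) (d : nat) (V : site d -> \bar R) : Prop :=
  exists W : 'rV[R]_d -> \bar R,
    (forall z : site d, W (embed R z) = V z) /\
    (forall (x y : 'rV[R]_d) (l : R), x != y -> 0 < l < 1 ->
       (W x < +oo)%E -> (W y < +oo)%E ->
       (W ((l *: x + (1 - l) *: y)%R) < l%:E * W x + (1 - l)%:E * W y)%E).

(* w(gamma) = exp{- alpha sum_{x in {gamma}} V(gamma(x) - x)}, with exp(-oo)=0 *)
Definition weight (R : realType) (d : nat) (alpha : R) (V : site d -> \bar R)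
  (g : cyc d) : R :=
  if all (fun x => V (cyc_map g x - x) != +oo%E) (val g)
  then expR (- (alpha * \sum_(x <- val g) fine (V (cyc_map g x - x))))
  else 0.

Definition cyc_conf (d : nat) := cyc d -> bool.

Definition coord_events (d : nat) : set (set (cyc_conf d)) :=
  [set A | exists (g : cyc d) (b : bool), A = [set eta | eta g = b]].
Arguments coord_events d : clear implicits.

Definition config (d : nat) := g_sigma_algebraType (coord_events d).

Definition compat_conf (d : nat) (g : cyc d) (eta : cyc_conf d) : bool :=
  `[< forall g', eta g' -> ~ incompat g g' >].

Definition conf_add (d : nat) (eta : cyc_conf d) (g : cyc d) : cyc_conf d :=
  fun g' => if g' == g then true else eta g'.
Definition conf_rem (d : nat) (eta : cyc_conf d) (g : cyc d) : cyc_conf d :=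
  fun g' => if g' == g then false else eta g'.

(* configurations whose present cycles have pairwise disjoint supports
   (= finite-cycle permutations) *)
Definition finite_cycle_confs (d : nat) : set (config d) :=
  [set eta | forall g g' : cyc d, eta g -> eta g' -> g != g' -> ~ incompat g g'].
Arguments finite_cycle_confs d : clear implicits.

Definition local_fun (R : realType) (d : nat) (f : cyc_conf d -> R) : Prop :=
  exists S : seq (cyc d), forall eta eta' : cyc_conf d,
    (forall g, g \in S -> eta g = eta' g) -> f eta = f eta'.

Definition loss_generator (R : realType) (d : nat) (alpha : R) (V : site d -> \bar R)
  (f : cyc_conf d -> R) (eta : cyc_conf d) : R :=
  \sum_(g \in [set: cyc d])
     (weight alpha V g * (compat_conf g eta)%:R * (f (conf_add eta g) - f eta)
      + (eta g)%:R * (f (conf_rem eta g) - f eta)).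

Definition L_invariant (R : realType) (d : nat) (alpha : R) (V : site d -> \bar R)
  (nu : probability (config d) R) : Prop :=
  forall f : cyc_conf d -> R, local_fun f ->
    (\int[nu]_eta (loss_generator alpha V f eta)%:E = 0)%E.

(* points phi = (gamma, t, s) *)
Definition pt (R : realType) (d : nat) := (cyc d * R * R)%type.

Definition has_card (T : eqType) (S : set T) (k : nat) : Prop :=
  exists s : seq T, [/\ uniq s, size s = k & S = [set x | x \in s]].

Definition intensity (R : realType) (d : nat) (alpha : R) (V : site d -> \bar R)
  (g : cyc d) (A : set (R * R)) : \bar R :=
  ((weight alpha V g)%:E *
   \int[(@lebesgue_measure R \x @lebesgue_measure R)%E]_(p in A `&` [set p | (0 <= p.2)%R])
      (expR (- p.2))%:E)%E.

(* N : Omega -> set (pt R d) is a Poisson point process with intensity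
   w(gamma) dt e^{-s} ds: for any finitely many pairwise disjoint measurable
   sets {g i} x A i of finite intensity, the numbers of points of N in them
   are independent Poisson variables with the corresponding means. *)
Definition is_PPP (R : realType) (d : nat) (alpha : R) (V : site d -> \bar R)
  (dO : measure_display) (Omega : measurableType dO) (P : probability Omega R)
  (N : Omega -> set (pt R d)) : Prop :=
  forall (n : nat) (g : nat -> cyc d) (A : nat -> set (R * R)) (k : nat -> nat),
    (forall i, (i < n)%N -> measurable (A i) /\ (intensity alpha V (g i) (A i) < +oo)%E) ->
    (forall i j, (i < n)%N -> (j < n)%N -> i != j -> g i != g j \/ A i `&` A j = set0) ->
    let E := [set om | forall i, (i < n)%N ->
                 has_card [set p : R * R | N om (g i, p.1, p.2) /\ A i p] (k i)] in
    measurable E /\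
    P E = (\prod_(i < n)
             (let l := fine (intensity alpha V (g i) (A i)) in
              expR (- l) * l ^+ k i / (k i)`!%:R))%:E.

Section LossNetwork.
Variables (R : realType) (d : nat) (N : set (pt R d)).

Definition anc1 (phi : pt R d) : set (pt R d) :=
  [set phi' | N phi' /\ incompat phi'.1.1 phi.1.1 /\
              phi'.1.2 < phi.1.2 < phi'.1.2 + phi'.2].

(* A_n^phi, n >= 1 (ancn 0 = A_1) *)
Fixpoint ancn (n : nat) (phi : pt R d) : set (pt R d) :=
  match n with
  | 0 => anc1 phi
  | n.+1 => \bigcup_(phi' in ancn n phi) anc1 phi'
  end.

Definition clan (phi : pt R d) : set (pt R d) := \bigcup_(n in [set: nat]) ancn n phi.

Definition Kof (D : set (pt R d)) : set (pt R d) :=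
  [set phi | N phi /\ anc1 phi `\` D = set0].

Fixpoint Dn (n : nat) : set (pt R d) :=
  match n with
  | 0 => set0
  | n.+1 => [set phi | N phi /\ anc1 phi `&` Kof (Dn n) !=set0]
  end.

(* K = \bigcup_{n >= 1} K_n, with K_{n+1} = Kof (Dn n) *)
Definition Kept : set (pt R d) := \bigcup_(n in [set: nat]) Kof (Dn n).

Definition eta_at (t : R) : config d :=
  fun g => `[< exists t' s', Kept (g, t', s') /\ t' <= t < t' + s' >].

End LossNetwork.

(* Main.v *)
(** Since [nu] is only infinitesimally invariant, no trajectory of the dynamics
    starting from [nu] is at hand. Fix a local event [A], finite lists of cycles
    [L] and [gs] with [L] contained in [gs], and a time step [h]. Let [u_n eta]
    be the probability that, in a discrete-time loss network on [gs] run for [n]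
    steps from [eta], an adversary who may reject at will the births of cycles
    outside [L] can bring the final configuration into [A]. Lifetimes are
    memoryless, so with [q = 1 - exp(- h)]

      u_n + q * generator(u_n) <= u_{n+1} + O(h^2) + q * C * 1_blocked,

    where [blocked] means that some cycle of [L] meets a present cycle outside
    [gs]. Integrating against [nu] kills the generator term, and [blocked] has
    small [nu]-probability when [gs] is large because the present cycles are
    disjoint; hence [nu A = \int u_0 <= \int u_n + small].

    On the other side, the randomness of the discrete network is read off exactly
    from the Poisson process. If the clan of ancestors of the cycles on which [A]
    depends stays in [L] and in a recent time window, and no two relevant births
    or deaths fall in one time cell, then the adversary and the initial condition
    have no influence and the outcome is the configuration [eta_t]. Finiteness of
    the clan makes this likely, so [nu A <= P (eta_t \in A) + small]; the same
    bound for the complement of [A] gives equality. The approximation by discrete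
    outcomes also shows that [eta_t] is measurable up to a null set. *)
Require Import Defs.
From HB Require Import structures.
From mathcomp Require Import all_boot all_order all_algebra.
From mathcomp Require Import all_classical all_reals all_analysis.
From mathcomp Require Import measurable_realfun.
From mathcomp Require Import ring lra zify.
Import Order.TTheory GRing.Theory Num.Theory.
Import numFieldNormedType.Exports.
Local Open Scope classical_set_scope.
Local Open Scope ring_scope.
Set Implicit Arguments. Unset Strict Implicit. Unset Printing Implicit Defensive.

(** * Finitely supported distributions *)

(** The test functions of [L_invariant] must be local, so the generator can only be applied to
    functions of the cycles in [gs], while a birth may be blocked by a present cycle that [gs]
    misses. Handing the births outside [L] to the adversary turns this ignorance into an inequality
    in the right direction; only births in [L] leave an error. The constants must then be chosen in
    an order that avoids circularity. The window [m] fixes [L]. The initial cycles touching [L]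
    number at most the sites of [L], a bound free of [gs], so the extra time [K] needed for them to
    die depends on [L] alone. Over the horizon [m + K] the blocking errors add up to the probability
    of [blocked] times a constant fixed by [L] and the horizon, and [gs] is enlarged until this is
    small. The mesh comes last: the [O(h^2)] errors have constants depending on [gs], but they add
    up to [O(h)] over the horizon. *)

Section FiniteDistributions.
Variable R : realType.

Definition expect (T : Type) (m : seq (R * T)) (f : T -> R) : R :=
  \sum_(p <- m) p.1 * f p.2.

Definition is_dist (T : Type) (m : seq (R * T)) : Prop :=
  all (fun p => 0 <= p.1) m /\ \sum_(p <- m) p.1 = 1.

Definition mix (T : Type) (x : R) (m0 m1 : seq (R * T)) : seq (R * T) :=
  [seq ((1 - x) * p.1, p.2) | p <- m0] ++ [seq (x * p.1, p.2) | p <- m1].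

Definition dirac_dist (T : Type) (v : T) : seq (R * T) := [:: (1, v)].

Definition map_dist (T T' : Type) (f : T -> T') (m : seq (R * T)) : seq (R * T') :=
  [seq (p.1, f p.2) | p <- m].

Lemma expect_mix (T : Type) (x : R) (m0 m1 : seq (R * T)) f :
  expect (mix x m0 m1) f = (1 - x) * expect m0 f + x * expect m1 f.
Proof.
rewrite /expect big_cat !big_map /= !mulr_sumr.
by congr (_ + _); apply: eq_bigr => p _; rewrite mulrA.
Qed.

Lemma expect_dirac (T : Type) (v : T) f : expect (dirac_dist v) f = f v.
Proof. by rewrite /expect big_seq1 mul1r. Qed.

Lemma expect_map (T T' : Type) (f : T -> T') m g :
  expect (map_dist f m) g = expect m (g \o f).
Proof. by rewrite /expect big_map. Qed.

Lemma is_dist_mix (T : Type) (x : R) (m0 m1 : seq (R * T)) :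
  0 <= x <= 1 -> is_dist m0 -> is_dist m1 -> is_dist (mix x m0 m1).
Proof.
move=> /andP[x0 x1] [p0 s0] [p1 s1]; split.
  rewrite all_cat !all_map; apply/andP; split.
    by apply: sub_all p0 => p /= hp; rewrite mulr_ge0// subr_ge0.
  by apply: sub_all p1 => p /= hp; rewrite mulr_ge0.
rewrite big_cat !big_map /= -!mulr_sumr s0 s1; ring.
Qed.

Lemma is_dist_dirac (T : Type) (v : T) : is_dist (dirac_dist v).
Proof. by split; rewrite /= ?big_seq1// ler01. Qed.

Lemma is_dist_map (T T' : Type) (f : T -> T') m :
  is_dist m -> is_dist (map_dist f m).
Proof. by move=> [p0 s]; split; rewrite ?all_map ?big_map. Qed.

Lemma expect_le (T : Type) (m : seq (R * T)) (Q : T -> bool) f g : is_dist m ->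
  all (fun p => Q p.2) m -> (forall v, Q v -> f v <= g v) -> expect m f <= expect m g.
Proof.
move=> [p0 _] qm fg; rewrite /expect.
elim: m p0 qm => [|p m IH]; first by rewrite !big_nil.
move=> /= /andP[p0 pm] /andP[qp qm]; rewrite !big_cons lerD ?IH//.
by rewrite ler_wpM2l// fg.
Qed.

Lemma expect_ge0 (T : Type) (m : seq (R * T)) f : is_dist m ->
  (forall v, 0 <= f v) -> 0 <= expect m f.
Proof.
move=> [p0 _] f0; rewrite /expect.
elim: m p0 => [|p m IH]; first by rewrite !big_nil.
by move=> /= /andP[p0 pm]; rewrite !big_cons addr_ge0 ?IH// mulr_ge0.
Qed.

Lemma expect_cst (T : Type) (m : seq (R * T)) c : is_dist m -> expect m (fun=> c) = c.
Proof. by move=> [_ s]; rewrite /expect -mulr_suml s mul1r. Qed.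

Lemma expectD (T : Type) (m : seq (R * T)) f g :
  expect m (fun v => f v + g v) = expect m f + expect m g.
Proof. by rewrite /expect -big_split; apply: eq_bigr => p _; rewrite mulrDr. Qed.

Lemma expectZ (T : Type) (m : seq (R * T)) c f :
  expect m (fun v => c * f v) = c * expect m f.
Proof. by rewrite /expect mulr_sumr; apply: eq_bigr => p _; rewrite mulrCA. Qed.

Lemma expect_sum (T : Type) (m : seq (R * T)) I (s : seq I) (f : I -> T -> R) :
  expect m (fun v => \sum_(i <- s) f i v) = \sum_(i <- s) expect m (f i).
Proof.
by rewrite /expect exchange_big; apply: eq_bigr => p _; rewrite mulr_sumr.
Qed.

Variable G : eqType.

Definition upd (T : Type) (D : G -> T) (g : G) (v : T) : G -> T :=
  fun g' => if g' == g then v else D g'.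

Lemma upd_upd (T : Type) (D : G -> T) g v v' :
  upd (upd D g v) g v' = upd D g v'.
Proof. by apply/funext => g'; rewrite /upd; case: eqP. Qed.

Lemma updC (T : Type) (D : G -> T) g g' v v' : g != g' ->
  upd (upd D g v) g' v' = upd (upd D g' v') g v.
Proof.
move=> gg'; apply/funext => x; rewrite /upd; case: eqP => // ->.
by rewrite eq_sym (negbTE gg').
Qed.

(** Expectation under the product of the laws [mu g], as iterated finite sums. Coordinates outside
    [gs] keep the default [b]. *)
Fixpoint pexpect (T : Type) (gs : seq G) (mu : G -> seq (R * T)) (b : T)
    (F : (G -> T) -> R) : R :=
  if gs is g :: gs' then expect (mu g) (fun v => pexpect gs' mu b (fun D => F (upd D g v)))
  else F (fun=> b).

Section Ep.
Variables (T : Type) (b : T) (mu : G -> seq (R * T)).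
Hypothesis mu_dist : forall g, is_dist (mu g).

Lemma pexpect_ge0 gs F : (forall D, 0 <= F D) -> 0 <= pexpect gs mu b F.
Proof. by elim: gs F => [|g gs IH] F F0 //=; apply: expect_ge0 => // v; exact: IH. Qed.

Lemma pexpect_le gs (Q : G -> T -> bool) F F' :
  (forall g, all (fun p => Q g p.2) (mu g)) ->
  (forall D, (forall g, g \in gs -> Q g (D g)) -> F D <= F' D) ->
  pexpect gs mu b F <= pexpect gs mu b F'.
Proof.
move=> Qmu; elim: gs F F' => [|g gs IH] F F' FF' /=; first exact: FF'.
apply: (expect_le (mu_dist g) (Qmu g)) => v Qv; apply: IH => D QD; apply: FF' => g'.
by rewrite inE /upd; case: eqP => [->//|_ /= /QD].
Qed.

Lemma pexpect_mono gs F F' : (forall D, F D <= F' D) ->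
  pexpect gs mu b F <= pexpect gs mu b F'.
Proof.
by move=> FF'; apply: (@pexpect_le _ (fun _ _ => true)) => // g; exact: all_predT.
Qed.

Lemma pexpect_cst gs c : pexpect gs mu b (fun=> c) = c.
Proof.
elim: gs => [|g gs IH] //=; rewrite (_ : (fun=> _) = fun=> c) ?expect_cst//.
by apply/funext.
Qed.

Lemma pexpectD gs F F' :
  pexpect gs mu b (fun D => F D + F' D) = pexpect gs mu b F + pexpect gs mu b F'.
Proof.
elim: gs F F' => [|g gs IH] F F' //=; rewrite -expectD; congr expect.
by apply/funext => v; rewrite IH.
Qed.

Lemma pexpectZ gs c F : pexpect gs mu b (fun D => c * F D) = c * pexpect gs mu b F.
Proof.
elim: gs F => [|g gs IH] F //=; rewrite -expectZ; congr expect.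
by apply/funext => v; rewrite IH.
Qed.

Lemma pexpect_sum gs (I : Type) (s : seq I) (F : I -> (G -> T) -> R) :
  pexpect gs mu b (fun D => \sum_(i <- s) F i D) = \sum_(i <- s) pexpect gs mu b (F i).
Proof.
elim: s => [|i s IH].
  by rewrite big_nil -[RHS](pexpect_cst gs); congr pexpect; apply/funext => D; rewrite big_nil.
rewrite big_cons -IH -pexpectD; congr pexpect; apply/funext => D; by rewrite big_cons.
Qed.

Lemma pexpect_marginal gs g f : uniq gs -> g \in gs ->
  pexpect gs mu b (fun D => f (D g)) = expect (mu g) f.
Proof.
elim: gs => [//|g' gs IH] /= /andP[g'gs ugs]; rewrite inE.
case: (eqVneq g g') => [-> _|gg' /= ggs].
  by congr expect; apply/funext => v; rewrite /upd eqxx pexpect_cst.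
rewrite -(IH ugs ggs) -[RHS](expect_cst _ (mu_dist g')); congr expect; apply/funext => v.
by congr pexpect; apply/funext => D; rewrite /upd (negbTE gg').
Qed.

Lemma pexpect_expect gs (T' : Type) (m : seq (R * T')) (F : (G -> T) -> T' -> R) :
  pexpect gs mu b (fun D => expect m (F D)) = expect m (fun v => pexpect gs mu b (F^~ v)).
Proof.
rewrite /expect (pexpect_sum gs m (fun p D => p.1 * F D p.2)).
by apply: eq_bigr => p _; rewrite pexpectZ.
Qed.

(** A product law is unchanged when one coordinate is redrawn from its own law. This lets the fresh
    label of a newborn cycle replace the label already drawn for that cycle. *)
Lemma pexpect_resample gs g F : uniq gs -> g \in gs ->
  pexpect gs mu b (fun D => expect (mu g) (fun v => F (upd D g v))) = pexpect gs mu b F.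
Proof.
elim: gs F => [//|g' gs IH] F /= /andP[g'gs ugs]; rewrite inE.
case: (eqVneq g g') => [-> _|gg' /= ggs].
  rewrite -[in RHS]pexpect_expect -[RHS](expect_cst _ (mu_dist g')); congr expect; apply/funext => v.
  congr pexpect; apply/funext => D; congr expect; apply/funext => v'.
  by rewrite upd_upd.
congr expect; apply/funext => v; rewrite -[RHS](IH _ ugs ggs).
congr pexpect; apply/funext => D; congr expect; apply/funext => v'.
by rewrite updC// eq_sym.
Qed.

End Ep.

(* Only the outcomes with at most one coordinate drawn from [m1] are kept. *)
Lemma pexpect_mix_ge (T : Type) (b : T) gs (x : G -> R) (m0 m1 : G -> seq (R * T)) (F : (G -> T) -> R) :
  uniq gs -> (forall g, 0 <= x g <= 1) ->
  (forall g, is_dist (m0 g)) -> (forall g, is_dist (m1 g)) ->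
  (forall D, 0 <= F D) ->
  let sx := \sum_(g <- gs) x g in
  sx <= 1 ->
  (1 - sx) * pexpect gs m0 b F + \sum_(g <- gs) x g * (1 - sx) *
     pexpect gs m0 b (fun D => expect (m1 g) (fun v => F (upd D g v)))
  <= pexpect gs (fun g => mix (x g) (m0 g) (m1 g)) b F.
Proof.
move=> + x01 d0 d1; elim: gs F => [|g gs IH] F /=.
  by move=> _ _ _; rewrite !big_nil subr0 mul1r addr0.
move=> /andP[ggs ugs] F0 sx1.
have x0 g' : 0 <= x g' by case/andP: (x01 g').
rewrite big_cons in sx1 *; set s := \sum_(j <- gs) x j in sx1 *.
have s0 : 0 <= s by apply: sumr_ge0.
have s1 : s <= 1 by apply: le_trans sx1; rewrite lerDr.
have dm g' : is_dist (mix (x g') (m0 g') (m1 g')) by exact: is_dist_mix.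
rewrite expect_mix big_cons.
set E0 := expect (m0 g) (fun v => pexpect gs m0 b (fun D => F (upd D g v))).
set Y := expect (m0 g) (fun v => pexpect gs (fun g' => mix (x g') (m0 g') (m1 g')) b _).
set Z := expect (m1 g) (fun v => pexpect gs (fun g' => mix (x g') (m0 g') (m1 g')) b _).
set T1 := expect (m0 g) (fun v => pexpect gs m0 b (fun D => expect (m1 g) _)).
set S := \sum_(j <- gs) _.
have hY : (1 - s) * E0 + \sum_(j <- gs) x j * (1 - s) *
     pexpect (g :: gs) m0 b (fun D => expect (m1 j) (fun v => F (upd D j v))) <= Y.
  rewrite /Y /E0 /= -expectZ.
  under eq_bigr do rewrite -expectZ.
  rewrite -expect_sum -expectD.
  apply: (@expect_le _ _ predT) => //; first exact: all_predT.
  move=> v _; apply: le_trans (IH _ ugs _ s1) => //.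
  rewrite lerD2l le_eqVlt; apply/orP; left; apply/eqP; rewrite -/s 2!big_seq; apply: eq_bigr => j jgs.
  congr (_ * _).  congr pexpect; apply/funext => D; congr expect; apply/funext => v'.
  rewrite updC//; by apply: contraNneq ggs => ->.
(* The draw of [g] from [m0 g] is overwritten by the one from [m1 g], so it integrates out. *)
have hT : T1 = expect (m1 g) (fun v => pexpect gs m0 b (fun D => F (upd D g v))).
  rewrite -(pexpect_expect b d0 gs (m1 g) (fun D v => F (upd D g v))) -[RHS](expect_cst _ (d0 g)).
  rewrite /T1; congr expect; apply/funext => v; congr pexpect; apply/funext => D; congr expect.
  by apply/funext => v'; rewrite upd_upd.
have hZ : (1 - s) * T1 <= Z.
  rewrite hT /Z -expectZ; apply: (@expect_le _ _ predT) => //; first exact: all_predT.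
  move=> v _; apply: le_trans (IH _ ugs _ s1) => //.
  rewrite lerDl; apply: sumr_ge0 => j _.
  rewrite mulr_ge0 ?mulr_ge0 ?subr_ge0//.
  by apply: pexpect_ge0 => // D; apply: expect_ge0.
have E00 : 0 <= E0 by apply: expect_ge0 => // v; apply: pexpect_ge0.
have T0 : 0 <= T1 by apply: expect_ge0 => // v; apply: pexpect_ge0 => // D; apply: expect_ge0.
have xg1 : x g <= 1 by case/andP: (x01 g).
have hS : S = (1 - (x g + s)) * (\sum_(j <- gs) x j *
     pexpect (g :: gs) m0 b (fun D => expect (m1 j) (fun v => F (upd D j v)))).
  by rewrite mulr_sumr; apply: eq_bigr => j _; rewrite [RHS]mulrCA [RHS]mulrA.
have hS' : \sum_(j <- gs) x j * (1 - s) *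
     pexpect (g :: gs) m0 b (fun D => expect (m1 j) (fun v => F (upd D j v))) =
   (1 - s) * (\sum_(j <- gs) x j *
     pexpect (g :: gs) m0 b (fun D => expect (m1 j) (fun v => F (upd D j v)))).
  by rewrite mulr_sumr; apply: eq_bigr => j _; rewrite [RHS]mulrCA [RHS]mulrA.
rewrite hS' in hY; rewrite hS.
set V := \sum_(j <- gs) _ in hY *.
have V0 : 0 <= V.
  apply: sumr_ge0 => j _; rewrite mulr_ge0//; apply: pexpect_ge0 => // D; exact: expect_ge0.
have := x0 g; move: (x g) xg1 sx1 {hS hS' IH hT} => y y1 sy y0.
have h1 : (1 - y) * ((1 - s) * E0 + (1 - s) * V) <= (1 - y) * Y by rewrite ler_wpM2l// subr_ge0.
have h2 : y * ((1 - s) * T1) <= y * Z by rewrite ler_wpM2l.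
have h3 : 0 <= y * s * (E0 + V) by rewrite mulr_ge0 ?addr_ge0 ?mulr_ge0.
have h4 : 0 <= y * y * T1 by rewrite mulr_ge0 ?mulr_ge0.
apply: le_trans (lerD h1 h2).
(* The slack consists of terms of second order in the weights, all nonnegative. *)
rewrite -subr_ge0 (_ : _ - _ = y * s * (E0 + V) + y * y * T1); last by ring.
exact: addr_ge0.
Qed.

End FiniteDistributions.

(** * The adversarial discrete dynamics *)

Section DiscreteDynamics.
Variables (R : realType) (G : eqType) (inc : G -> G -> Prop).

(* Cells are numbered backwards from the observation time. The label of a point
   born in cell [n] is [j.+1] if it dies in cell [j] and [0] if it survives. *)
Fixpoint lab (q : R) (n : nat) : seq (R * nat) :=
  if n is n'.+1 then mix q (lab q n') (dirac_dist R n) else dirac_dist R 0%N.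

(** The label is drawn as for a point known to outlive its birth cell [n], so it is at most [n];
    points dying in their birth cell are left to the error terms. *)
Definition birth (q a : R) (n : nat) : seq (R * option nat) :=
  mix a (dirac_dist R None) (map_dist (@Some nat) (lab q n)).

Definition layer := G -> option nat.

(** Label [c.+1] means death in cell [c]. Within a cell, deaths are carried out before births. *)
Definition kill (c : nat) (sigma : layer) : layer :=
  fun g => if sigma g is Some j then if (j <= c)%N then Some j else None else None.

(** Only the survivors of the deaths in cell [c] can block; two births in the same cell do not see
    each other. *)
Definition free_at (c : nat) (sigma : layer) (g : G) : Prop :=
  forall g', inc g g' -> kill c sigma g' = None.

(* The births of [x] outside [L] may be rejected at will: this adversary stands
   for the cycles that the finite system does not see. *)
Definition adv_step (L : seq G) (c : nat) (sigma x sigma' : layer) : Prop :=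
  forall g, match kill c sigma g with
    | Some j => sigma' g = Some j
    | None => (sigma' g = None /\ (g \in L -> x g <> None -> ~ free_at c sigma g)) \/
              (sigma' g = x g /\ free_at c sigma g)
    end.

(** The existential quantifier makes the adversary favour [A]. A lower bound on the chance of
    success thus needs a single legal run, while an upper bound must control all runs. *)
Fixpoint outcome (L : seq G) (n : nat) (s : nat -> layer) (sigma : layer)
    (A : (G -> bool) -> Prop) : Prop :=
  if n is c.+1 then
    exists sigma', adv_step L c sigma (s c) sigma' /\ outcome L c s sigma' A
  else A (fun g => sigma g == Some 0%N).

Fixpoint history_expect (gs : seq G) (q : R) (a : G -> R) (n : nat) (F : (nat -> layer) -> R) : R :=
  if n is c.+1 then
    pexpect gs (fun g => birth q (a g) c) None
      (fun x => history_expect gs q a c (fun s => F (upd s c x)))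
  else F (fun=> fun=> None).

Definition start (gs : seq G) (eta : G -> bool) (D : G -> nat) : layer :=
  fun g => if (g \in gs) && eta g then Some (D g) else None.

Definition adv_prob (gs L : seq G) (q : R) (a : G -> R) (A : (G -> bool) -> Prop)
    (n : nat) (sigma : layer) : R :=
  history_expect gs q a n (fun s => (`[< outcome L n s sigma A >])%:R).

(** The function [u_n] of the overview. By memorylessness, fresh labels may be drawn for the initial
    cycles, whatever their age. *)
Definition adv_fun (gs L : seq G) (q : R) (a : G -> R) (A : (G -> bool) -> Prop)
    (n : nat) (eta : G -> bool) : R :=
  pexpect gs (fun=> lab q n) 0%N (fun D => adv_prob gs L q a A n (start gs eta D)).

Lemma is_dist_lab q n : 0 <= q <= 1 -> is_dist (lab q n).
Proof.
move=> q01; elim: n => [|n IH] /=; first exact: is_dist_dirac.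
by apply: is_dist_mix => //; exact: is_dist_dirac.
Qed.

Lemma is_dist_birth q a n : 0 <= q <= 1 -> 0 <= a <= 1 -> is_dist (birth q a n).
Proof.
move=> q01 a01; apply: is_dist_mix => //; first exact: is_dist_dirac.
by apply: is_dist_map; exact: is_dist_lab.
Qed.

Lemma lab_le q n : all (fun p => (p.2 <= n)%N) (lab q n).
Proof.
elim: n => //= n IH; rewrite all_cat all_map /= leqnn !andbT.
by apply: sub_all IH => p /= /leqW.
Qed.

(** A label below [m] requires surviving each of the cells [m], ..., [n - 1], with probability
    [1 - q] each. *)
Lemma lab_lt q n m : (m <= n)%N -> 0 <= q <= 1 ->
  expect (lab q n) (fun j => (j < m)%:R) <= (1 - q) ^+ (n - m).
Proof.
move=> + q01; elim: n => [|n IH].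
  by rewrite leqn0 => /eqP -> /=; rewrite expect_dirac expr0 ler01.
rewrite leq_eqVlt => /predU1P[-> | mn].
  rewrite subnn expr0 -[leRHS](expect_cst 1 (is_dist_lab n.+1 q01)).
  apply: (@expect_le _ _ _ predT); [exact: is_dist_lab|exact: all_predT|].
  by move=> v _; rewrite lern1 leq_b1.
rewrite ltnS in mn.
rewrite [lab _ _]/= expect_mix expect_dirac ltnNge (leqW mn) /= mulr0 addr0 subSn// exprS.
by rewrite ler_wpM2l ?IH// subr_ge0; case/andP: q01.
Qed.

Lemma outcome_ext L n s s' sigma A : (forall c, (c < n)%N -> s c = s' c) ->
  outcome L n s sigma A -> outcome L n s' sigma A.
Proof.
elim: n sigma => [//|n IH] sigma ss' /= [sigma' [st o]]; exists sigma'.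
by rewrite -ss'//; split => //; apply: IH o => c cn; apply: ss'; apply: ltnW.
Qed.

Lemma outcome_upd L n s x sigma A :
  outcome L n s sigma A -> outcome L n (upd s n x) sigma A.
Proof.
by apply: outcome_ext => c cn; rewrite /upd (ltn_eqF cn).
Qed.

(** A legal run always exists: accept every free birth. It ends in [A] or in its complement. *)
Lemma outcome_total L n s sigma A :
  outcome L n s sigma A \/ outcome L n s sigma (fun eta => ~ A eta).
Proof.
elim: n sigma => [|n IH] sigma /=; first exact: EM.
pose sigma' : layer := fun g => if kill n sigma g is Some j then Some j
  else if `[< free_at n sigma g >] then s n g else None.
have st : adv_step L n sigma (s n) sigma'.
  move=> g; rewrite /sigma'; case: (kill n sigma g) => // .
  by case: asboolP => f; [right|left; split].
by case: (IH sigma') => o; [left|right]; exists sigma'.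
Qed.

Section Expectations.
Variables (gs L : seq G) (q : R) (a : G -> R).
Hypotheses (q01 : 0 <= q <= 1) (a01 : forall g, 0 <= a g <= 1).

Lemma history_expect_mono n F F' : (forall s, F s <= F' s) ->
  history_expect gs q a n F <= history_expect gs q a n F'.
Proof.
elim: n F F' => [|n IH] F F' FF' //=; apply: pexpect_mono => [g|x].
  exact: is_dist_birth.
by apply: IH.
Qed.

Lemma history_expect_cst n c : history_expect gs q a n (fun=> c) = c.
Proof.
elim: n => [//|n IH] /=; rewrite (_ : (fun=> _) = fun=> c) ?pexpect_cst// => [g|].
  exact: is_dist_birth.
by apply/funext.
Qed.

Lemma history_expect_ge0 n F : (forall s, 0 <= F s) -> 0 <= history_expect gs q a n F.
Proof. by move=> F0; rewrite -(history_expect_cst n 0); exact: history_expect_mono. Qed.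

Lemma adv_prob01 A n sigma : 0 <= adv_prob gs L q a A n sigma <= 1.
Proof.
apply/andP; split; first by apply: history_expect_ge0.
by rewrite -(history_expect_cst n 1); apply: history_expect_mono => s; rewrite lern1 leq_b1.
Qed.

Lemma adv_fun01 A n eta : 0 <= adv_fun gs L q a A n eta <= 1.
Proof.
have dl : forall _ : G, is_dist (lab q n) by move=> _; exact: is_dist_lab.
apply/andP; split.
  by apply: pexpect_ge0 => // D; case/andP: (adv_prob01 A n (start gs eta D)).
rewrite -(pexpect_cst 0%N dl gs 1); apply: pexpect_mono => // D.
by case/andP: (adv_prob01 A n (start gs eta D)).
Qed.

Lemma adv_fun_ext A n eta eta' : (forall g, g \in gs -> eta g = eta' g) ->
  adv_fun gs L q a A n eta = adv_fun gs L q a A n eta'.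
Proof.
move=> ee; rewrite /adv_fun; congr pexpect; apply/funext => D; congr adv_prob.
apply/funext => g; rewrite /start.
by case ggs: (g \in gs) => //=; rewrite ee.
Qed.

End Expectations.

(** * The one-step inequality between the generator and the discrete dynamics *)

Section OneStep.
Variables (gs L : seq G) (q : R) (a w : G -> R) (A : (G -> bool) -> Prop) (n : nat).
Variables (eta : G -> bool) (cp : G -> bool) (bd : bool).
Hypotheses (ugs : uniq gs) (q01 : 0 <= q <= 1).
Hypotheses (a0 : forall g, 0 <= a g) (aw : forall g, a g <= q * w g).
Hypotheses (inc_refl : forall g, inc g g).
Hypothesis (cpP : forall g, cp g -> forall g', eta g' -> ~ inc g g').
Hypothesis (cpN : forall g, g \in L -> ~~ cp g -> ~~ bd ->
  exists g', [/\ g' \in gs, eta g' & inc g g']).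
Let k : R := (size gs)%:R.
Let al : R := \sum_(g <- gs) a g.
Hypotheses (kq1 : k * q <= 1) (al1 : al <= 1) (a01 : forall g, 0 <= a g <= 1).

Let none : layer := fun=> None.
Let V := adv_prob gs L q a A n.
Let u := adv_fun gs L q a A n.
Let H (D : G -> nat) (x : layer) : R :=
  history_expect gs q a n (fun s => (`[< outcome L n.+1 (upd s n x) (start gs eta D) A >])%:R).

(** Any one legal move bounds from below what the adversary can achieve. *)
Let V_le_H sigma' D x : adv_step L n (start gs eta D) x sigma' -> V sigma' <= H D x.
Proof.
move=> st; apply: history_expect_mono => // s; rewrite ler_nat; case: asboolP => // o.
rewrite lt0b; apply/asboolP => /=; exists sigma'.
by rewrite {1}/upd eqxx; split => //; exact: outcome_upd.
Qed.

Let kill_start D : (forall g, g \in gs -> (D g <= n)%N) ->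
  kill n (start gs eta D) = start gs eta D.
Proof.
move=> Dn; apply/funext => g; rewrite /kill /start.
by case: ifPn => // /andP[ggs _]; rewrite Dn.
Qed.

Let V_none D : (forall g, g \in gs -> (D g <= n)%N) ->
  V (start gs eta D) <= H D none.
Proof.
move=> Dn; apply: V_le_H => g; rewrite kill_start//.
by case: (start gs eta D g) => //; left; split.
Qed.

Let V_death D g : (forall g, g \in gs -> (D g <= n)%N) ->
  V (start gs (upd eta g false) D) <= H (upd D g n.+1) none.
Proof.
move=> Dn; apply: V_le_H => g'; rewrite /kill /start /upd.
case: (eqVneq g' g) => [->|gg'].
  by rewrite andbF; case: ifP => _; rewrite ?ltnn; left.
by case: ifPn => [/andP[ggs _]|_]; [rewrite Dn|left].
Qed.

Let V_accept D g j : (forall g, g \in gs -> (D g <= n)%N) -> cp g -> g \in gs ->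
  V (start gs (upd eta g true) (upd D g j)) <= H D (upd none g (Some j)).
Proof.
move=> Dn cg ggs; apply: V_le_H => g'; rewrite kill_start//.
have fr : free_at n (start gs eta D) g.
  move=> g1 ig1; rewrite kill_start// /start.
  by case: ifP => // /andP[_ /(cpP cg)].
have := fr g (inc_refl g); rewrite kill_start// => sg.
case: (eqVneq g' g) => [->|gg].
  by rewrite sg; right; rewrite /start /upd eqxx ggs.
have -> : start gs (upd eta g true) (upd D g j) g' = start gs eta D g'.
  by rewrite /start /upd (negbTE gg).
by case: (start gs eta D g') => //; left; split => //; rewrite /upd (negbTE gg).
Qed.

(** For births incompatible with [eta]. Outside [L] the adversary simply refuses them, even if the
    blocking cycle is invisible; inside [L] a blocker in [gs] must be exhibited. *)
Let V_reject D g j : (forall g, g \in gs -> (D g <= n)%N) ->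
  (g \in L -> exists g', [/\ g' \in gs, eta g' & inc g g']) ->
  V (start gs eta D) <= H D (upd none g (Some j)).
Proof.
move=> Dn gL; apply: V_le_H => g'; rewrite kill_start//.
case E : (start gs eta D g') => //; left; split => //.
rewrite /upd; case: eqP => // -> /gL[g1 [g1s eg1 ig1]] _ /(_ g1 ig1).
by rewrite kill_start// /start g1s eg1.
Qed.

Let F (D : G -> nat) : R := pexpect gs (fun g => birth q (a g) n) None (H D).

Let H_ge0 D x : 0 <= H D x. Proof. exact: history_expect_ge0. Qed.

Let F_ge D : (1 - al) * H D none + \sum_(g <- gs) a g * (1 - al) *
   expect (lab q n) (fun j => H D (upd none g (Some j))) <= F D.
Proof.
have e0 K : pexpect gs (fun=> dirac_dist R (@None nat)) None K = K none.
  elim: gs K => [//|g gs' IH] K /=; rewrite expect_dirac IH.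
  by congr K; apply/funext => g'; rewrite /upd if_same.
apply: le_trans (pexpect_mix_ge _ ugs a01 _ _ (H_ge0 D) al1); first last.
- by move=> g; apply: is_dist_map; exact: is_dist_lab.
- by move=> g; exact: is_dist_dirac.
rewrite e0 lerD2l; apply: ler_sum => g _.
by rewrite e0 expect_map.
Qed.

Let dlab m : forall _ : G, is_dist (lab q m).
Proof. by move=> _; exact: is_dist_lab. Qed.

Let lab_ep_le (F1 F2 : (G -> nat) -> R) :
  (forall D, (forall g, g \in gs -> (D g <= n)%N) -> F1 D <= F2 D) ->
  pexpect gs (fun=> lab q n) 0%N F1 <= pexpect gs (fun=> lab q n) 0%N F2.
Proof.
apply: (@pexpect_le _ _ _ _ _ (dlab n) _ (fun _ j => (j <= n)%N)) => g.
exact: lab_le.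
Qed.

Let F_ge0 D : 0 <= F D.
Proof. by apply: pexpect_ge0 => // g; exact: is_dist_birth. Qed.

(** An incompatible cycle of [L] may have its only blockers outside [gs], and then refusal need not
    be legal. This happens only under [bd], where the trivial bound [V <= 1] is used. *)
Let acc_or_rej g D : (forall g, g \in gs -> (D g <= n)%N) -> g \in gs ->
  expect (lab q n) (fun j => (if cp g then V (start gs (upd eta g true) (upd D g j))
    else V (start gs eta D)))
  - (bd && (g \in L))%:R <= expect (lab q n) (fun j => H D (upd none g (Some j))).
Proof.
move=> Dn ggs.
have [cg|cg] := boolP (cp g).
  rewrite lerBlDr; apply: le_trans (_ : _ <= expect (lab q n) (fun j : nat => H D (upd none g (Some j)))) _.
    apply: (@expect_le _ _ _ predT) => //; [exact: is_dist_lab|exact: all_predT|].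
    by move=> j _; exact: V_accept.
  by rewrite lerDl.
have [/andP[bd1 gL]|bdL] := boolP (bd && (g \in L)).
  rewrite expect_cst; last exact: is_dist_lab.
  apply: (@le_trans _ _ 0); last by apply: expect_ge0 => //; exact: is_dist_lab.
  by rewrite subr_le0; case/andP: (adv_prob01 gs L q01 a01 A n (start gs eta D)).
rewrite subr0.
apply: (@expect_le _ _ _ predT) => //; [exact: is_dist_lab|exact: all_predT|].
move=> j _; apply: V_reject => // gL; apply: cpN => //.
by move: bdL; rewrite gL andbT.
Qed.

(** Condition on the oldest cell and keep only the cases with at most one birth or death in it: no
    event gives [u eta], one event gives a jump of the generator. Since [u] lies between 0 and 1,
    the loss is quadratic in the total rate [k * q + al]. *)
Lemma adv_fun_step :
  u eta + q * \sum_(g <- gs) (w g * (cp g)%:R * (u (upd eta g true) - u eta)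
                           + (eta g)%:R * (u (upd eta g false) - u eta))
  <= adv_fun gs L q a A n.+1 eta + \sum_(g <- gs) (q * w g - a g)
     + (k * q + al) ^+ 2 + bd%:R * (q * \sum_(g <- gs | g \in L) w g).
Proof.
have q0 : 0 <= q by case/andP: q01.
have al0 : 0 <= al by apply: sumr_ge0.
have k0 : 0 <= k by [].
have V01 eta' D : 0 <= V (start gs eta' D) <= 1 by exact: adv_prob01.
have u01 eta' : 0 <= u eta' <= 1 by exact: adv_fun01.
have u0 eta' : 0 <= u eta' by case/andP: (u01 eta').
have u1 eta' : u eta' <= 1 by case/andP: (u01 eta').
pose X g := if cp g then u (upd eta g true) else u eta.
pose Y g := u (upd eta g false).
pose bL g : R := (bd && (g \in L))%:R.
have X01 g : 0 <= X g <= 1 by rewrite /X; case: ifP.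
have EX g : g \in gs -> X g - bL g <=
    pexpect gs (fun=> lab q n) 0%N
      (fun D => expect (lab q n) (fun j => H D (upd none g (Some j)))).
  move=> ggs; apply: le_trans (lab_ep_le (fun D Dn => acc_or_rej Dn ggs)).
  rewrite (pexpectD 0%N (fun=> lab q n) gs _ (fun=> - bL g)) (pexpect_cst 0%N (dlab n)) lerD2r.
  rewrite le_eqVlt; apply/orP; left; apply/eqP.
  rewrite /X; case: (cp g).
    by rewrite (pexpect_resample 0%N (dlab n) (fun D => V (start gs (upd eta g true) D)) ugs ggs).
  by congr pexpect; apply/funext => D; rewrite expect_cst//; exact: is_dist_lab.
have EF : (1 - al) * (u eta + \sum_(g <- gs) a g * (X g - bL g)) <=
    pexpect gs (fun=> lab q n) 0%N F.
  apply: le_trans (pexpect_mono 0%N (dlab n) gs F_ge).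
  rewrite pexpectD pexpectZ pexpect_sum; last exact: dlab.
  rewrite mulrDr lerD//.
    by rewrite ler_wpM2l ?subr_ge0//; apply: lab_ep_le => D Dn; exact: V_none.
  rewrite mulr_sumr big_seq [leRHS]big_seq; apply: ler_sum => g ggs.
  rewrite pexpectZ mulrCA mulrA ler_wpM2l ?mulr_ge0 ?subr_ge0//; exact: EX.
have EY g : g \in gs -> (1 - al) * Y g <=
    pexpect gs (fun=> lab q n) 0%N (fun D => expect (dirac_dist R n.+1) (fun j => F (upd D g j))).
  move=> ggs; rewrite /Y /u /adv_fun -pexpectZ; apply: lab_ep_le => D Dn.
  rewrite expect_dirac; apply: le_trans (F_ge _).
  apply: le_trans (_ : (1 - al) * H (upd D g n.+1) none <= _).
    by rewrite ler_wpM2l ?subr_ge0//; exact: V_death.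
  rewrite lerDl; apply: sumr_ge0 => g' _; rewrite !mulr_ge0 ?subr_ge0//.
  by apply: expect_ge0 => //; exact: is_dist_lab.
have sq : \sum_(g <- gs) q = k * q by rewrite big_const_seq count_predT iter_addr_0 mulr_natl.
have main : (1 - k * q) * (1 - al) * (u eta + \sum_(g <- gs) a g * (X g - bL g)
    + q * \sum_(g <- gs) Y g) <= adv_fun gs L q a A n.+1 eta.
  (* By definition [lab q n.+1] mixes [lab q n] with immediate death, at weight [q]; so this keeps
     the label draws with at most one death. *)
  have := @pexpect_mix_ge R G nat 0%N gs (fun=> q) (fun=> lab q n)
    (fun=> dirac_dist R n.+1) F ugs (fun=> q01) (dlab n)
    (fun=> is_dist_dirac R n.+1) F_ge0.
  rewrite /= sq => /(_ kq1); apply: le_trans.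
  rewrite mulrDr lerD//.
    by rewrite -mulrA ler_wpM2l ?subr_ge0.
  rewrite mulrA mulr_sumr [leLHS]big_seq [leRHS]big_seq; apply: ler_sum => g ggs.
  rewrite [leLHS](_ : _ = q * (1 - k * q) * ((1 - al) * Y g)); last by ring.
  by rewrite ler_wpM2l ?mulr_ge0 ?subr_ge0//; exact: EY.
(* An impossible birth or the death of an absent cycle leaves [u eta] unchanged. With [X] and [Y] so
   defined, the indicators disappear and every cycle of [gs] contributes at the same rates. *)
have lhsE : u eta + q * \sum_(g <- gs) (w g * (cp g)%:R * (u (upd eta g true) - u eta)
      + (eta g)%:R * (u (upd eta g false) - u eta)) =
    (1 - al - k * q) * u eta + \sum_(g <- gs) a g * X g
    + \sum_(g <- gs) (q * w g - a g) * (X g - u eta) + q * \sum_(g <- gs) Y g.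
  have -> : \sum_(g <- gs) a g * X g =
      \sum_(g <- gs) a g * (X g - u eta) + al * u eta.
    by rewrite /al mulr_suml -big_split; apply: eq_bigr => g _ /=; ring.
  have -> : q * \sum_(g <- gs) Y g =
      \sum_(g <- gs) q * (Y g - u eta) + k * q * u eta.
    by rewrite -sq mulr_suml mulr_sumr -big_split; apply: eq_bigr => g _ /=; ring.
  rewrite mulr_sumr (_ : \sum_(i <- gs) _ = \sum_(g <- gs) a g * (X g - u eta) +
    \sum_(g <- gs) (q * w g - a g) * (X g - u eta) + \sum_(g <- gs) q * (Y g - u eta)).
    ring.
  rewrite -!big_split; apply: eq_bigr => g _ /=.
  have -> : (eta g)%:R * (u (upd eta g false) - u eta) = Y g - u eta.
    rewrite /Y; case eg : (eta g); rewrite ?mul1r// mul0r.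
    suff -> : upd eta g false = eta by rewrite subrr.
    by apply/funext => g'; rewrite /upd; case: eqP => // ->.
  have -> : w g * (cp g)%:R * (u (upd eta g true) - u eta) = w g * (X g - u eta).
    by rewrite /X; case: (cp g); rewrite ?mulr1// mulr0 subrr mul0r mulr0.
  ring.
rewrite lhsE.
have hdrift : \sum_(g <- gs) (q * w g - a g) * (X g - u eta) <=
    \sum_(g <- gs) (q * w g - a g).
  apply: ler_sum => g _; rewrite ler_piMr ?subr_ge0//.
  by have /andP[_ X1] := X01 g; rewrite lerBlDr (le_trans X1)// lerDl.
have hb : \sum_(g <- gs) a g * bL g <= bd%:R * (q * \sum_(g <- gs | g \in L) w g).
  rewrite mulr_sumr mulr_sumr [leRHS]big_mkcond; apply: ler_sum => g _ /=.
  rewrite /bL; case: bd => /=; last by rewrite mulr0; case: ifP; rewrite ?mul0r.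
  by case: ifP => _; rewrite ?mulr0// mulr1 mul1r.
have hb0 : 0 <= \sum_(g <- gs) a g * bL g.
  by apply: sumr_ge0 => g _; rewrite mulr_ge0// /bL.
have SX : 0 <= \sum_(g <- gs) a g * X g <= al.
  apply/andP; split; first by apply: sumr_ge0 => g _; rewrite mulr_ge0//; case/andP: (X01 g).
  by apply: ler_sum => g _; rewrite ler_piMr//; case/andP: (X01 g).
have SY : 0 <= q * \sum_(g <- gs) Y g <= k * q.
  rewrite mulr_ge0/=; last 2 first; [by []|by apply: sumr_ge0 => g _; exact: u0|].
  by rewrite -sq mulr_sumr; apply: ler_sum => g _; rewrite ler_piMr// /Y.
have eXb : \sum_(g <- gs) a g * (X g - bL g) =
    \sum_(g <- gs) a g * X g - \sum_(g <- gs) a g * bL g.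
  by rewrite -sumrB; apply: eq_bigr => g _; rewrite mulrBr.
rewrite eXb in main.
have kq0 : 0 <= k * q by rewrite mulr_ge0.
move: (u01 eta) SX SY hb hb0 hdrift main kq1 al1 kq0 al0.
move: (\sum_(g <- gs) a g * X g) (q * \sum_(g <- gs) Y g)
  (\sum_(g <- gs) a g * bL g) (bd%:R * _) (\sum_(g <- gs) (q * w g - a g) * (X g - u eta))
  (\sum_(g <- gs) (q * w g - a g)) (u eta) (adv_fun _ _ _ _ _ _ _) (k * q) al.
move=> SX SY SB BD DR QW U U' K AL /andP[U0 U1] /andP[SX0 SX1] /andP[SY0 SY1].
move=> hb hb0 hd main K1 AL1 K0 AL0.
have h1 : 0 <= K * AL * (U + SX + SY) by rewrite mulr_ge0 ?mulr_ge0 ?addr_ge0.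
have h2 : (1 - K) * (1 - AL) * SB <= SB.
  rewrite ler_piMl//; nra.
have h3 : (K + AL) * (SX + SY) <= (K + AL) ^+ 2.
  by rewrite expr2 ler_wpM2l ?addr_ge0// addrC lerD.
nra.
Qed.

End OneStep.
End DiscreteDynamics.

(** * Kept points *)

Section KeptPoints.
Variables (R : realType) (d : nat) (N : set (pt R d)).
Implicit Types phi : pt R d.

Lemma incompat_refl (g : cyc d) : incompat g g.
Proof.
case: g => c cc; have := cc; rewrite /is_cyc => /and3P[_ sc _].
case: c cc sc => [//|x c] cc _; exists x; split; exact: mem_head.
Qed.

Lemma incompat_sym (g g' : cyc d) : incompat g g' -> incompat g' g.
Proof. by rewrite /incompat setIC. Qed.

Lemma DnS n : Dn N n `<=` Dn N n.+1.
Proof.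
elim: n => [//|n IH] phi [Nphi [phi' [a [Nphi' K]]]]; split => //.
exists phi'; split => //; split => //; rewrite -subset0 => x [ax nD].
by rewrite -K; split => // /IH.
Qed.

Lemma Dn_le n m : (n <= m)%N -> Dn N n `<=` Dn N m.
Proof.
elim: m => [|m IH]; first by rewrite leqn0 => /eqP ->.
rewrite leq_eqVlt => /predU1P[-> //|/IH nm].
by apply: subset_trans nm _; exact: DnS.
Qed.

(** A point of [Dn m.+1] has an ancestor kept with respect to [Dn m]; if the point is also kept with
    respect to [Dn n], that ancestor lies in [Dn n]. The same conflict recurs with a smaller sum of
    indices, and [Dn 0] is empty. *)
Lemma kept_not_deleted n m phi : Kof N (Dn N n) phi -> ~ Dn N m phi.
Proof.
have [k] := ubnP (n + m)%N; elim: k n m phi => // k IH n [|m] phi nmk; first by move=> _ [].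
move=> [Nphi K] [_ [phi' [a K']]].
have mnk : (m + n < k)%N by lia.
apply: (IH m n phi' mnk K').
by apply: contrapT => nD; have : set0 phi' by rewrite -K.
Qed.

Lemma clan1 phi phi' : anc1 N phi phi' -> clan N phi phi'.
Proof. by move=> a; exists 0%N. Qed.

Lemma clan_trans phi phi' : anc1 N phi phi' -> clan N phi' `<=` clan N phi.
Proof.
move=> a psi [n _ an]; exists n.+1 => //; elim: n psi an => [|n IH] psi /=.
  by move=> b; exists phi'.
by move=> [chi /IH h b]; exists chi.
Qed.

Lemma clan_before phi psi : clan N phi psi -> psi.1.2 < phi.1.2.
Proof.
move=> [n _]; elim: n psi => [|n IH] psi /=.
  by move=> [_ [_ /andP[]]].
by move=> [chi /IH lt1 [_ [_ /andP[lt2 _]]]]; exact: lt_trans lt1.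
Qed.

(** Induction on the size of a list containing the clan: the clan of an ancestor is contained in
    that of [phi] and misses the ancestor itself, being strictly earlier. *)
Lemma kept_or_deleted phi : finite_set (clan N phi) -> N phi ->
  Kept N phi \/ exists n, Dn N n phi.
Proof.
move=> /finite_seqP[s es]; have {es}: clan N phi `<=` [set` s] by rewrite es.
have [k] := ubnP (size s); elim: k phi s => // k IH phi s.
rewrite ltnS => sk cs Nphi.
have fin : finite_set (clan N phi) by apply: sub_finite_set cs _; exact: finite_seq.
have anc phi' : anc1 N phi phi' -> Kept N phi' \/ exists n, Dn N n phi'.
  move=> a; have [Nphi' _] := a.
  apply: (IH phi' [seq psi <- s | psi != phi']) => //; last first.
    move=> psi cpsi; have /= psis := cs _ (clan_trans a cpsi).
    rewrite /= mem_filter psis andbT; apply/eqP => e.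
    by move: (clan_before cpsi); rewrite e ltxx.
  apply: leq_trans sk; rewrite size_filter -[ltnRHS](count_predC (fun psi => psi != phi')).
  rewrite -[ltnLHS]addn0 ltn_add2l -has_count; apply/hasP; exists phi'.
    exact: cs (clan1 a).
  by rewrite /= eqxx.
have [[phi' [a [n _ K]]]|noK] := pselect (anc1 N phi `&` Kept N !=set0).
  by right; exists n.+1; split => //; exists phi'.
left; have nD phi' : anc1 N phi phi' -> exists n, Dn N n phi'.
  move=> a; case: (anc _ a) => // K; exfalso; apply: noK; by exists phi'.
have /finite_seqP[l el] : finite_set (anc1 N phi).
  by apply: sub_finite_set fin => x; exact: clan1.
(* Each ancestor is deleted at some stage; as they are finitely many, one stage serves them all. *)
have [n hn] : exists n, forall x, x \in l -> Dn N n x.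
  have : forall x, x \in l -> anc1 N phi x by move=> x xs; rewrite el.
  elim: l {el} => [|x l IHs] h; first by exists 0%N.
  have [|n hn] := IHs; first by move=> y ys; apply: h; rewrite inE ys orbT.
  have [m hm] := nD x (h x (mem_head _ _)).
  exists (maxn n m) => y; rewrite inE => /predU1P[->|/hn].
    by apply: Dn_le hm; exact: leq_maxr.
  by apply: Dn_le; exact: leq_maxl.
exists n => //; split => //; rewrite -subset0 el => x [/= /hn].
by move=> ? [].
Qed.

(** This is the local acceptance rule of the loss network, the form in which it is compared with
    [free_at]. *)
Lemma keptP phi : finite_set (clan N phi) -> N phi ->
  Kept N phi <-> (forall phi', anc1 N phi phi' -> ~ Kept N phi').
Proof.
move=> fin Nphi; split.
  move=> [n _ [_ K]] phi' a [m _ K'].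
  apply: (@kept_not_deleted m n phi' K').
  by apply: contrapT => nD; have : set0 phi' by rewrite -K.
move=> h; case: (kept_or_deleted fin Nphi) => // -[[//|n]] /= [_ [phi' [a K]]].
by exfalso; apply: (h _ a); exists n.
Qed.

End KeptPoints.

(** * Discretization of the graphical construction *)

Section Discretization.
Variables (R : realType) (d : nat) (t0 h : R).
Hypothesis h0 : 0 < h.

Definition cell (c : nat) : set R := `]t0 - c.+1%:R * h, t0 - c%:R * h].

Definition bcol (c : nat) : set (R * R) := [set p | cell c p.1].

Definition reg (c j : nat) : set (R * R) :=
  [set p | cell c p.1 /\ if j is j'.+1 then cell j' (p.1 + p.2) else t0 < p.1 + p.2].

Lemma cellP c t : cell c t <-> t0 - c.+1%:R * h < t <= t0 - c%:R * h.
Proof. by rewrite /cell /= in_itv. Qed.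

Lemma cell_exists t : t <= t0 -> exists c, cell c t.
Proof.
move=> tt0; exists (Num.truncn ((t0 - t) / h)); apply/cellP.
have x0 : 0 <= (t0 - t) / h by rewrite divr_ge0// ?subr_ge0// ltW.
have /andP[] := truncn_itv x0.
rewrite ler_pdivlMr// ltr_pdivrMr// => h1 h2.
by apply/andP; split; lra.
Qed.

Lemma cell_lt c c' t t' : cell c t -> cell c' t' -> (c < c')%N -> t' < t.
Proof.
move=> /cellP/andP[h1 _] /cellP/andP[_ h2] cc'; apply: le_lt_trans h2 _.
apply: le_lt_trans h1; rewrite lerD2l lerN2 ler_wpM2r ?ler_nat//; exact: ltW.
Qed.

Lemma cell_inj c c' t : cell c t -> cell c' t -> c = c'.
Proof.
move=> ct c't; case: (ltngtP c c') => // cc'.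
  by have := cell_lt ct c't cc'; rewrite ltxx.
by have := cell_lt c't ct cc'; rewrite ltxx.
Qed.

Lemma cell_lt_bound c (m : nat) t : cell c t -> t0 - m%:R * h < t -> (c < m)%N.
Proof.
move=> /cellP/andP[_ h1] h2; rewrite ltnNge; apply/negP => mc.
have := lt_le_trans h2 h1; apply/negP; rewrite -leNgt lerD2l lerN2.
by rewrite ler_wpM2r ?ler_nat// ltW.
Qed.

Lemma cell_le0 c t : cell c t -> t <= t0.
Proof.
move=> /cellP/andP[_ h1]; apply: le_trans h1 _.
by rewrite gerBl mulr_ge0// ltW.
Qed.

Lemma reg_label c j j' p : reg c j p -> reg c j' p -> j = j'.
Proof.
move=> [_ h1] [_ h2]; case: j j' h1 h2 => [|j] [|j'] //= h1 h2.
- by have := cell_le0 h2; rewrite leNgt h1.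
- by have := cell_le0 h1; rewrite leNgt h2.
- by rewrite (cell_inj h1 h2).
Qed.

Lemma reg_gt c j p : reg c j p -> t0 - j%:R * h < p.1 + p.2.
Proof.
move=> [_]; case: j => [|j]; first by rewrite mul0r subr0.
by move=> /cellP/andP[].
Qed.

Lemma reg_le c j p : reg c j.+1 p -> p.1 + p.2 <= t0 - j%:R * h.
Proof. by move=> [_ /cellP/andP[]]. Qed.

Variable N : set (pt R d).

Definition fiber (g : cyc d) (A : set (R * R)) : set (R * R) :=
  [set p | N (g, p.1, p.2) /\ A p].

(** Written with counts in two disjoint regions, so that the Poisson law gives its probability as a
    product. *)
Definition single (g : cyc d) (c j : nat) : Prop :=
  has_card (fiber g (reg c j)) 1 /\ has_card (fiber g (bcol c `\` reg c j)) 0.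

Lemma has_card0 (T : eqType) (A : set T) : has_card A 0 <-> A = set0.
Proof.
split => [[s [_ /size0nil -> ->]]|->]; first by rewrite -subset0 => x.
by exists [::]; split => //; apply/esym; rewrite -subset0 => y.
Qed.

Lemma has_card1 (T : eqType) (A : set T) : has_card A 1 <-> exists x, A = [set x].
Proof.
split => [[[|x [|y s]] [_ ss ->]]|[x ->]] //.
  by exists x; apply/seteqP; split => y /=; rewrite inE => /eqP.
by exists [:: x]; split => //; apply/seteqP; split => y /=; rewrite inE => /eqP.
Qed.

Lemma single_pt g c j : single g c j ->
  exists p, [/\ N (g, p.1, p.2), reg c j p &
    forall p', N (g, p'.1, p'.2) -> cell c p'.1 -> p' = p].
Proof.
move=> [/has_card1[p ep] /has_card0 e0].
have [Np rp] : fiber g (reg c j) p by rewrite ep.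
exists p; split => // p' Np' cp'; have [rp'|nrp'] := pselect (reg c j p').
  by have : fiber g (reg c j) p' by []; rewrite ep.
by exfalso; have : fiber g (bcol c `\` reg c j) p' by []; rewrite e0.
Qed.

Lemma single_inj g c j j' : single g c j -> single g c j' -> j = j'.
Proof.
move=> /single_pt[p [Np rp up]] /single_pt[p' [Np' rp' _]].
have e : p' = p by apply: up => //; case: rp'.
by rewrite e in rp'; exact: reg_label rp rp'.
Qed.

(* [None] also when the column is not encoded faithfully: several points, or one
   point dying in its birth cell. *)
Definition record (g : cyc d) (c : nat) : option nat :=
  if pselect (exists j, (j <= c)%N /\ single g c j) is left e
  then Some (projT1 (cid e)) else None.

Lemma recordP g c j : record g c = Some j <-> (j <= c)%N /\ single g c j.
Proof.
rewrite /record; case: pselect => [e|ne]; last first.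
  by split => // ejc; exfalso; apply: ne; exists j.
case: (cid e) => /= j' [jc' sj']; split => [[<-//]|[jc sj]].
by rewrite (single_inj sj sj').
Qed.

(** Generation by generation, the points that can influence the state at [t0] of the cycles in
    [S]. *)
Fixpoint reachn (S : seq (cyc d)) (n : nat) : set (pt R d) :=
  match n with
  | 0 => [set phi | [/\ N phi, phi.1.1 \in S & phi.1.2 <= t0 < phi.1.2 + phi.2]]
  | n'.+1 => \bigcup_(phi' in reachn S n') anc1 N phi'
  end.

Definition reach (S : seq (cyc d)) : set (pt R d) := \bigcup_n reachn S n.

Lemma reach_anc S phi phi' : reach S phi -> anc1 N phi phi' -> reach S phi'.
Proof. by move=> [n _ r] a; exists n.+1 => //; exists phi. Qed.

Lemma reach_sub S phi : reach S phi -> N phi.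
Proof. by move=> [[|n] _] /=; [case|move=> [phi' _ []]]. Qed.

Lemma reach_time S phi : reach S phi -> phi.1.2 <= t0.
Proof.
move=> [n _]; elim: n phi => [|n IH] phi /=; first by case => _ _ /andP[].
move=> [phi' /IH le0 [_ [_ /andP[lt1 _]]]]; exact: le_trans (ltW lt1) le0.
Qed.

(** * On a good realization, every adversarial run reproduces the kept points *)

Section Agreement.
Variables (S L gs : seq (cyc d)) (n0 n : nat).
Hypotheses (SL : {subset S <= L}) (Lgs : {subset L <= gs}) (n00 : (0 < n0)%N)
  (n0n : (n0 <= n)%N).
Hypothesis reachL : forall phi, reach S phi ->
  [/\ phi.1.1 \in L, t0 - n0%:R * h < phi.1.2 & finite_set (clan N phi)].
Hypothesis rec_ok : forall g c p, g \in L -> (c < n0)%N ->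
  N (g, p.1, p.2) -> cell c p.1 -> exists j, (j <= c)%N /\ single g c j.
Hypothesis birth_ok : forall g g' c p p', g \in L -> g' \in L -> (c < n0)%N ->
  g != g' -> N (g, p.1, p.2) -> N (g', p'.1, p'.2) -> cell c p.1 -> cell c p'.1 -> False.
Hypothesis death_ok : forall g g' c c' p p', g \in L -> g' \in L ->
  (c < c')%N -> (c' < n0)%N ->
  N (g, p.1, p.2) -> N (g', p'.1, p'.2) -> cell c p.1 -> reg c' c.+1 p' -> False.

Let x (c : nat) : layer (cyc d) := fun g => if g \in gs then record g c else None.

(** With [m] cells left, [pv g] is the birth cell of the current occupant [g], or [n] if it was
    present initially. The first clause concerns relevant points only. The second says that every
    other occupant is a genuine point, or an initial cycle whose label, if it touches [L], makes it
    disappear before the births of the last [n0] cells. *)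
Let invariant (m : nat) (sigma : layer (cyc d)) : Prop :=
  exists pv : cyc d -> nat,
    (forall g p c j, reach S (g, p.1, p.2) -> (m <= c)%N -> reg c j p -> (j <= m)%N ->
       Kept N (g, p.1, p.2) <-> sigma g = Some j /\ pv g = c) /\
    (forall g j, sigma g = Some j ->
       [/\ (pv g < n)%N, (m <= pv g)%N, (j <= pv g)%N & single g (pv g) j] \/
       (pv g = n /\ forall g', g' \in L -> incompat g g' -> (n0 <= j)%N)).

Let reach_cell g p : reach S (g, p.1, p.2) -> exists c j,
  [/\ (c < n0)%N, reg c j p, (j <= c)%N, single g c j & record g c = Some j].
Proof.
move=> r; have [gL tl _] := reachL r; have [c ct] := cell_exists (reach_time r).
have cn0 := cell_lt_bound ct tl.
have [j [jc sj]] := rec_ok gL cn0 (reach_sub r) ct.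
exists c, j; split => //; last by apply/recordP.
have [p' [Np' rp' up']] := single_pt sj.
by rewrite (up' p) //; exact: reach_sub r.
Qed.

Let inv_step c sigma sigma' : (c < n)%N -> invariant c.+1 sigma ->
  adv_step (@incompat d) L c sigma (x c) sigma' -> invariant c sigma'.
Proof.
move=> cn [pv [ha hb]] st.
pose pv' g := if kill c sigma g is Some _ then pv g else c.
have killE g j : kill c sigma g = Some j <-> sigma g = Some j /\ (j <= c)%N.
  rewrite /kill; case: (sigma g) => [i|]; last by split=> // -[].
  case: ifPn => ic; split => //; first by move=> [<-].
    by move=> [[<-]].
  by move=> [[<-] ic']; rewrite ic' in ic.
have pvc g j : sigma g = Some j -> (c < pv g)%N.
  by move=> /hb[[]//|[-> _]].
have free_kept g p : reach S (g, p.1, p.2) -> cell c p.1 ->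
    Kept N (g, p.1, p.2) <-> free_at (@incompat d) c sigma g.
  move=> r ct; have [gL tl fin] := reachL r.
  have cn0 := cell_lt_bound ct tl.
  rewrite (keptP fin (reach_sub r)); split => [hk g' ig'|fr [[g' t'] s'] a].
    case e : (kill c sigma g') => [j'|//]; exfalso.
    have [sg' jc'] := (killE g' j').1 e.
    case: (hb _ _ sg') => [[pn pc jp sj']|[_ hn]]; last first.
      by have := hn g gL (incompat_sym ig'); lia.
    have [p' [Np' rp' _]] := single_pt sj'.
    (* A blocker in [sigma] was born in an earlier cell and outlives cell [c], so it is an ancestor,
       hence itself relevant. *)
    have a : anc1 N (g, p.1, p.2) (g', p'.1, p'.2).
      split => //; split => /=; first exact: incompat_sym.
      apply/andP; split; first by apply: cell_lt ct _ pc; case: rp'.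
      apply: le_lt_trans (reg_gt rp'); move/cellP: ct => /andP[_ ct].
      by apply: le_trans ct _; rewrite lerD2l lerN2 ler_wpM2r ?ler_nat// ltW.
    apply: (hk _ a); apply/(ha _ _ _ _ (reach_anc r a) pc rp' (leqW jc')).
    by split.
  have r' := reach_anc r a; have [Np' [/= ig /andP[lt1 lt2]]] := a => K'.
  have [c' [j' [cn0' rp' jc' sj' _]]] := @reach_cell g' (t', s') r'.
  have ct' : cell c' t' by case: rp'.
  have [gL' _ _] := reachL r'; rewrite /= in gL'.
  have cc' : (c <= c')%N.
    rewrite leqNgt; apply/negP => /(cell_lt ct' ct) /=.
    by rewrite ltNge (ltW lt1).
  (* The discrete dynamics does not order two births in one cell. Distinct cycles are excluded by
     [birth_ok], equal ones because the column holds a single point. *)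
  have [ecc|ncc] := eqVneq c c'.
    have [egg|ngg] := eqVneq g g'.
      have [p1 [_ _ u]] := single_pt sj'.
      have e1 : (t', s') = p1 by apply: u.
      have e2 : p = p1 by apply: u; rewrite -?egg -?ecc//; exact: reach_sub r.
      by move: lt1; rewrite e2 -e1 ltxx.
    rewrite -ecc in ct'.
    exact: (@birth_ok g g' c p (t', s') gL gL' cn0 ngg (reach_sub r) Np' ct ct').
  have {ncc}cc' : (c < c')%N by rewrite ltn_neqAle ncc.
  have jc : (j' <= c.+1)%N.
    case: j' {sj'} jc' rp' => [//|j'] jc' rp'; rewrite ltnS leqNgt; apply/negP => cj.
    have := le_lt_trans (reg_le rp'); move/cellP: ct => /andP[ct _] /=.
    move=> le2; have := lt_le_trans lt2 (reg_le rp').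
    apply/negP; rewrite -leNgt; apply: ltW; apply: le_lt_trans ct.
    by rewrite lerD2l lerN2 ler_wpM2r ?ler_nat// ltW.
  (* With label [c.+1], the ancestor dies in the birth cell of [g]: it blocks [g] in continuous
     time, but the discrete dynamics removes it first. This is what [death_ok] excludes. *)
  have {}jc : (j' <= c)%N.
    move: jc; rewrite leq_eqVlt => /predU1P[ej|//]; exfalso.
    apply: (@death_ok g g' c c' p (t', s')) => //; first exact: reach_sub r.
    by rewrite -ej.
  have [sg' _] := (ha g' (t', s') c' j' r' cc' rp' (leqW jc)).1 K'.
  by have := fr g' (incompat_sym ig); rewrite ((killE g' j').2 (conj sg' jc)).
exists pv'; split; last first.
  move=> g j; have := st g; rewrite /pv'; case e : (kill c sigma g) => [i|].
    have [sg ic] := (killE g i).1 e.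
    move=> -> [<-]; case: (hb _ _ sg) => [[pn pc jp sj]|]; last by right.
    by left; split => //; exact: ltnW.
  move=> [[-> //]|[-> _]]; rewrite /x; case: ifP => // _ /recordP[jc sj].
  by left; split.
move=> g p c0 j r cc0 rp jc.
have [gL tl fin] := reachL r.
have := st g; rewrite /pv'; case: (ltngtP c c0) cc0 => // [cc0 _|ec _].
  rewrite (ha _ _ _ _ r cc0 rp (leqW jc)); case e : (kill c sigma g) => [i|].
    have [sg ic] := (killE g i).1 e; move=> ->.
    by rewrite sg.
  move=> _; split=> [[sg _]|[_ ec]]; last by move: cc0; rewrite ec ltnn.
  by move: e; rewrite ((killE g j).2 _).
rewrite -ec in rp; have ct : cell c p.1 by case: rp.
have [c1 [j1 [cn0 rp1 jc1 sj1 rec1]]] := reach_cell r.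
have e1 : c1 = c by apply: cell_inj ct; case: rp1.
rewrite e1 in cn0 rp1 jc1 sj1 rec1; have ej := reg_label rp1 rp.
rewrite {}ej in rp1 jc1 sj1 rec1.
have xg : x c g = Some j by rewrite /x Lgs.
rewrite (free_kept _ _ r ct) -ec; case e : (kill c sigma g) => [i|].
  have [sg ic] := (killE g i).1 e; move=> _; split => [fr|[_ ec']].
    by move: e; rewrite fr//; exact: incompat_refl.
  by have := pvc _ _ sg; rewrite ec' ltnn.
rewrite xg; move=> [[s1 s2]|[s1 s2]]; split => //.
- by move=> fr; exfalso; exact: s2.
- by rewrite s1 => -[].
Qed.

Let inv_final sigma : invariant 0 sigma ->
  forall g, g \in S -> (sigma g == Some 0%N) = eta_at N t0 g.
Proof.
move=> [pv [ha hb]] g gS; apply/eqP/asboolP => [sg|[t' [s' [K tt0]]]].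
  case: (hb _ _ sg) => [[pn _ _ sj]|[_ hn]]; last first.
    by have := hn g (SL gS) (incompat_refl g); lia.
  have [[t' s'] [Np rp _]] := single_pt sj; rewrite /= in Np.
  exists t', s'.
  have al : t' <= t0 < t' + s'.
    by apply/andP; split; [case: rp => /cell_le0|case: rp].
  have r : reach S (g, t', s') by exists 0%N.
  by split => //; apply/(ha g (t', s') (pv g) 0%N r).
have r : reach S (g, t', s').
  by exists 0%N => //; split => //; case: K => k _ [].
have [c [j [cn0 rp jc sj _]]] := @reach_cell g (t', s') r.
have j0 : j = 0%N.
  case: j rp {jc sj} => // j [_ /cell_le0] /=; case/andP: tt0 => _.
  by rewrite ltNge => /negbTE ->.
rewrite j0 in rp jc.
by have [] := (ha g (t', s') c 0%N r (leq0n _) rp (leqnn _)).1 K.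
Qed.

(** The adversary is powerless: relevant points have their cycles in [L], and an accepted birth
    outside [L] that blocked a relevant point would be an ancestor of it, hence relevant too. *)
Lemma outcome_eta_at sigma (A : (cyc d -> bool) -> Prop) :
  (forall eta eta', (forall g, g \in S -> eta g = eta' g) -> A eta -> A eta') ->
  (forall g j, sigma g = Some j ->
     forall g', g' \in L -> incompat g g' -> (n0 <= j)%N) ->
  outcome (@incompat d) L n x sigma A -> A (eta_at N t0).
Proof.
move=> Aloc start_ok.
have : invariant n sigma.
  exists (fun=> n); split.
    move=> g p c j r nc rp _; have [_ tl _] := reachL r.
    by have := cell_lt_bound rp.1 tl; lia.
  by move=> g j sg; right; split => //; exact: start_ok sg.
have gen m sg : (m <= n)%N -> invariant m sg ->
    outcome (@incompat d) L m x sg A -> A (eta_at N t0).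
  elim: m sg => [|m IH] sg mn inv /=.
    by apply: Aloc => g gS; exact: inv_final.
  move=> [sg' [st o]]; apply: (IH sg') => //; first exact: ltnW.
  exact: inv_step st.
by move=> inv; exact: gen.
Qed.

End Agreement.
End Discretization.

(** * Intensities *)

Section Intensity.
Variable R : realType.
Local Notation leb := (@lebesgue_measure R).

Lemma continuous_expRN : continuous (fun s : R => expR (- s)).
Proof.
move=> z; apply: continuous_comp; last exact: continuous_expR.
exact: continuousN.
Qed.

Lemma continuous_expRB (y : R) : continuous (fun s : R => expR (s - y)).
Proof.
move=> z; apply: continuous_comp; last exact: continuous_expR.
by apply: continuousB => //; exact: cst_continuous.
Qed.

Lemma measurable_expRN : measurable_fun setT (fun s : R => (expR (- s))%:E).
Proof.
by apply/measurable_EFinP; apply: continuous_measurable_fun; exact: continuous_expRN.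
Qed.

Lemma integral_expRN_tail (z : R) :
  (\int[leb]_(s in `]z, +oo[) (expR (- s))%:E = (expR (- z))%:E)%E.
Proof.
rewrite integral_itv_obnd_cbnd; last first.
  by apply: measurable_funTS; exact: measurable_expRN.
rewrite (@ge0_continuous_FTC2y _ _ (fun s => - expR (- s)) _ 0).
- by rewrite EFinN oppeK add0e.
- by move=> x _; exact: expR_ge0.
- by apply: continuous_subspaceT; exact: continuous_expRN.
- by rewrite -oppr0; apply: cvgN; exact: cvgr_expR.
- by move=> x _; exact: ex_derive.
- by apply: cvgN; apply/cvg_at_right_filter; exact: continuous_expRN.
- move=> x _; rewrite derive1E derive_val; ring.
Qed.

Lemma integral_expRB_seg (a b y : R) : a < b ->
  (\int[leb]_(t in `]a, b]) (expR (t - y))%:E = (expR (b - y) - expR (a - y))%:E)%E.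
Proof.
move=> ab; rewrite integral_itv_obnd_cbnd; last first.
  apply: measurable_funTS; apply/measurable_EFinP.
  by apply: continuous_measurable_fun; exact: continuous_expRB.
rewrite (@continuous_FTC2 _ _ (fun s => expR (s - y))) ?EFinB//.
- by apply: continuous_subspaceT; exact: continuous_expRB.
- split.
  + by move=> z _; exact: ex_derive.
  + by apply/cvg_at_right_filter; exact: continuous_expRB.
  + by apply/cvg_at_left_filter; exact: continuous_expRB.
- move=> x _; rewrite derive1E derive_val; ring.
Qed.

Definition half_plane : set (R * R) := [set p | 0 <= p.2].

Lemma measurable_half_plane : measurable half_plane.
Proof.
rewrite (_ : half_plane = snd @^-1` `[0, +oo[); last first.
  by apply/seteqP; split => p /=; rewrite in_itv/= andbT.
by rewrite -[_ @^-1` _]setTI; exact: measurable_snd.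
Qed.

Lemma measurable_birth (D : set R) : measurable D ->
  measurable [set p : R * R | D p.1].
Proof.
by move=> mD; rewrite -[X in measurable X]setTI; exact: measurable_fst.
Qed.

Lemma measurable_death (D : set R) : measurable D ->
  measurable [set p : R * R | D (p.1 + p.2)].
Proof.
move=> mD; rewrite -[X in measurable X]setTI.
have : measurable_fun setT (fun p : R * R => p.1 + p.2).
  by apply: measurable_funD; [exact: measurable_fst|exact: measurable_snd].
exact.
Qed.

Lemma measurable_death_gt (y : R) : measurable [set p : R * R | y < p.1 + p.2].
Proof.
rewrite (_ : [set p | _] = [set p | `]y, +oo[%classic (p.1 + p.2)]).
  exact: measurable_death.
by apply/seteqP; split => p /=; rewrite in_itv/= andbT.
Qed.

(** The intensity of a region for a cycle of weight 1. *)
Definition mass (B : set (R * R)) : \bar R :=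
  (\int[leb \x leb]_(p in B `&` half_plane) (expR (- p.2))%:E)%E.

Lemma measurable_expRN_snd :
  measurable_fun setT (fun p : R * R => (expR (- p.2))%:E).
Proof.
apply/measurable_EFinP.
have : measurable_fun setT ((fun s : R => expR (- s)) \o snd (A := R)).
  apply: measurableT_comp; last exact: measurable_snd.
  by apply: continuous_measurable_fun; exact: continuous_expRN.
exact.
Qed.

Lemma mass_fubini (B : set (R * R)) : measurable B ->
  (mass B = \int[leb]_t \int[leb]_(s in [set s | B (t, s)] `&` `[0%R, +oo[)
     (expR (- s))%:E)%E.
Proof.
move=> mB; rewrite /mass integral_mkcond fubini_tonelli1.
- apply: eq_integral => t _; rewrite /fubini_F [RHS]integral_mkcond.
  apply: eq_integral => s _; rewrite /patch.
  congr (if _ then _ else _); apply/idP/idP => /set_mem [/= h1 h2]; apply/mem_set; split => //.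
    by rewrite /= in_itv/= andbT.
  by move: h2; rewrite /= in_itv/= andbT.
- apply/(measurable_restrictT _ (measurableI _ _ mB measurable_half_plane)).
  by apply: measurable_funTS; exact: measurable_expRN_snd.
- by move=> p; rewrite /patch; case: ifP => // _; rewrite lee_fin expR_ge0.
Qed.

(** A point born at [t] must live longer than [y - t], which is nonnegative because [b <= y]; this
    has weight [expR (t - y)]. *)
Lemma mass_tail (a b y : R) : a < b -> b <= y ->
  mass [set p | `]a, b]%classic p.1 /\ y < p.1 + p.2] = (expR (b - y) - expR (a - y))%:E.
Proof.
move=> ab byy; rewrite mass_fubini; last first.
  apply: measurableI; first exact: measurable_birth.
  exact: measurable_death_gt.
rewrite -integral_expRB_seg// [RHS]integral_mkcond; apply: eq_integral => t _.
rewrite /patch; case: ifPn => /=.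
  move=> /set_mem /=; rewrite in_itv/= => /andP[at_ tb].
  rewrite (_ : _ `&` _ = `]y - t, +oo[%classic).
    by rewrite integral_expRN_tail opprB.
  apply/seteqP; split => s /=; rewrite !in_itv/= !andbT.
    by move=> [[_]]; lra.
  by move=> yts; split; [split; [apply/andP; split|lra]|lra].
move=> /negP nt; rewrite (_ : _ `&` _ = set0) ?integral_set0//.
rewrite -subset0 => s [[/= h _] _]; apply: nt; exact/mem_set.
Qed.

Lemma mass_col (a b : R) : a <= b ->
  mass [set p | `]a, b]%classic p.1] = (b - a)%:E.
Proof.
move=> ab; rewrite mass_fubini; last exact: measurable_birth.
transitivity (\int[leb]_(t in `]a, b]) (1 : \bar R))%E; last first.
  rewrite integral_cst// mul1e [RHS](_ : _ = leb `]a, b]%classic)//.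
  rewrite lebesgue_measure_itv/= lte_fin.
  by case: ltP => // ba; rewrite (@le_anti _ _ a b) ?subrr// ab.
rewrite [RHS]integral_mkcond; apply: eq_integral => t _.
rewrite /patch; case: ifPn => /=.
  move=> /set_mem h; rewrite (_ : _ `&` _ = `[0, +oo[%classic).
    rewrite -integral_itv_obnd_cbnd ?integral_expRN_tail ?oppr0 ?expR0//.
    by apply: measurable_funTS; exact: measurable_expRN.
  by apply/seteqP; split => s /=; [case|split].
move=> /negP nt; rewrite (_ : _ `&` _ = set0) ?integral_set0//.
rewrite -subset0 => s [/= h _]; apply: nt; exact/mem_set.
Qed.

Lemma mass_setU (B1 B2 : set (R * R)) : measurable B1 -> measurable B2 ->
  B1 `&` B2 = set0 -> (mass (B1 `|` B2) = mass B1 + mass B2)%E.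
Proof.
move=> m1 m2 d; rewrite /mass setIUl ge0_integral_setU//.
- exact: measurableI _ measurable_half_plane.
- exact: measurableI _ measurable_half_plane.
- by apply: measurable_funTS; exact: measurable_expRN_snd.
- by apply/eqP; rewrite setIACA d set0I.
Qed.

Lemma mass_ge0 (B : set (R * R)) : (0 <= mass B)%E.
Proof. by apply: integral_ge0 => p _; rewrite lee_fin expR_ge0. Qed.

Lemma mass_le (B1 B2 : set (R * R)) : measurable B1 -> measurable B2 ->
  B1 `<=` B2 -> (mass B1 <= mass B2)%E.
Proof.
move=> m1 m2 s; rewrite -(setDUK s) mass_setU//.
- by rewrite leeDl// mass_ge0.
- exact: measurableD.
- by rewrite -subset0 => x [B1x []].
Qed.

End Intensity.

(** * Poisson point processes *)

Section PoissonProcess.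
Variables (R : realType) (d : nat) (alpha : R) (V : site d -> \bar R).
Variables (dO : measure_display) (Omega : measurableType dO) (P : probability Omega R).
Variable N : Omega -> set (pt R d).
Hypothesis ppp : is_PPP alpha V P N.

Let w := weight alpha V.

Lemma weight_ge0 g : 0 <= w g.
Proof. by rewrite /w /weight; case: ifP => // _; exact: expR_ge0. Qed.

Definition mean (g : cyc d) (B : set (R * R)) : R := w g * fine (mass B).

Definition pois (l : R) (k : nat) : R := expR (- l) * l ^+ k / k`!%:R.

Definition finite_mass (B : set (R * R)) : Prop :=
  measurable B /\ (mass B < +oo)%E.

Lemma finite_mass_fin B : finite_mass B -> mass B \is a fin_num.
Proof. by move=> [_ fB]; rewrite ge0_fin_numE// mass_ge0. Qed.

Lemma mean_ge0 g B : 0 <= mean g B.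
Proof. by rewrite mulr_ge0 ?weight_ge0// fine_ge0// mass_ge0. Qed.

Lemma intensityE g B : finite_mass B -> intensity alpha V g B = (mean g B)%:E.
Proof.
move=> /finite_mass_fin fB; rewrite /mean EFinM fineK//.
Qed.

Definition entry := (cyc d * set (R * R) * nat)%type.

Definition indep (e e' : entry) : bool :=
  `[< e.1.1 != e'.1.1 \/ e.1.2 `&` e'.1.2 = set0 >].

Definition count_is (e : entry) : set Omega :=
  [set om | has_card (fiber (N om) e.1.1 e.1.2) e.2].

Fixpoint counts (l : seq entry) : set Omega :=
  if l is e :: l' then count_is e `&` counts l' else setT.

Lemma countsE e0 l om :
  counts l om <-> forall i, (i < size l)%N -> count_is (nth e0 l i) om.
Proof.
elim: l => [|e l IH] /=; first by split.
rewrite /setI /= IH; split => [[h1 h2] [|i] //|h]; first exact: h2.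
by split => [|i il]; [exact: (h 0%N)|exact: (h i.+1)].
Qed.

Lemma counts_ppp l : pairwise indep l ->
  (forall i e0, (i < size l)%N -> finite_mass (nth e0 l i).1.2) ->
  measurable (counts l) /\
  P (counts l) = (\prod_(e <- l) pois (mean e.1.1 e.1.2) e.2)%:E.
Proof.
case: l => [|e0 l0]; first by split; rewrite /= ?big_nil ?probability_setT.
set l := e0 :: l0 => pl fl.
have fl0 i : (i < size l)%N -> finite_mass (nth e0 l i).1.2 by exact: fl.
have [||mE PE] := ppp (n := size l) (g := fun i => (nth e0 l i).1.1)
    (A := fun i => (nth e0 l i).1.2) (fun i => (nth e0 l i).2).
- by move=> i il; split; [case: (fl0 i il)|rewrite intensityE ?ltry//; exact: fl0].
- move=> i j il jl ij.
  wlog ltij : i j il jl {ij} / (i < j)%N.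
    move=> W; case: (ltngtP i j) => [/W|/W|eij]; [exact| |by rewrite eij eqxx in ij].
    move=> /(_ jl il) [h|h]; [left|right]; first by rewrite eq_sym.
    by rewrite setIC.
  have /pairwiseP -/(_ e0) := pl; move=> /(_ i j il jl ltij) /asboolP.
  exact.
have eE : counts l = [set om | forall i, (i < size l)%N ->
    has_card [set p | N om ((nth e0 l i).1.1, p.1, p.2) /\ (nth e0 l i).1.2 p] (nth e0 l i).2].
  by apply/seteqP; split => om; rewrite (countsE e0).
rewrite eE; split => //; rewrite PE; congr (_%:E).
rewrite (big_nth e0) big_mkord; apply: eq_bigr => i _.
by rewrite /= intensityE//; exact: fl0.
Qed.

Lemma measurable_count g B k : finite_mass B -> measurable (count_is (g, B, k)).
Proof.
move=> fB; have [||m _] := @counts_ppp [:: (g, B, k)] => //.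
  by move=> [|//] e0 _.
by move: m; rewrite /= setIT.
Qed.

Definition hit g B : set Omega := [set om | fiber (N om) g B !=set0].

Lemma hitE g B : hit g B = ~` count_is (g, B, 0%N).
Proof.
apply/seteqP; split => om; rewrite /hit /count_is /= => h.
  by move=> /has_card0 e; case: h => p; rewrite e.
by apply/set0P/eqP => e; apply: h; apply/has_card0.
Qed.

Lemma finite_massS B C : finite_mass B -> measurable C -> C `<=` B -> finite_mass C.
Proof. by move=> [mB fB] mC CB; split => //; apply: le_lt_trans fB; exact: mass_le. Qed.

Lemma measurable_hit_fin g B : finite_mass B -> measurable (hit g B).
Proof. by move=> fB; rewrite hitE; apply: measurableC; exact: measurable_count. Qed.

Lemma finite_mass_col (a b : R) : finite_mass [set p | `]a, b]%classic p.1].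
Proof.
split; first exact: measurable_birth.
have [ab|ba] := leP a b; first by rewrite mass_col// ltry.
rewrite (_ : [set p | _] = set0); first by rewrite /mass set0I integral_set0 ltry.
by rewrite -subset0 => p /=; rewrite in_itv/= => /andP[]; lra.
Qed.

(** The Poisson property speaks only of regions of finite intensity, so [B] is exhausted by strips
    of bounded birth time. *)
Lemma measurable_hit g B : measurable B -> measurable (hit g B).
Proof.
move=> mB; pose Bk (k : nat) := B `&` [set p : R * R | `]- k%:R, k%:R]%classic p.1].
rewrite (_ : hit g B = \bigcup_k hit g (Bk k)); last first.
  apply/seteqP; split => om.
    move=> [p [Np Bp]]; exists (Num.truncn `|p.1|).+1 => //; exists p; split => //.
    split => //=; rewrite in_itv/=.
    have := truncnS_gt `|p.1|; rewrite ltr_norml => /andP[-> /ltW ->]//.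
  by move=> [k _ [p [Np [Bp _]]]]; exists p.
apply: bigcup_measurable => k _; apply: measurable_hit_fin.
apply: (finite_massS (finite_mass_col (- k%:R) k%:R)); last by move=> p [].
by apply: measurableI => //; exact: measurable_birth.
Qed.

Lemma P_void g B : finite_mass B ->
  P (count_is (g, B, 0%N)) = (expR (- mean g B))%:E.
Proof.
move=> fB; have [||_] := @counts_ppp [:: (g, B, 0%N)] => //.
  by move=> [|//] e0 _.
by rewrite /= setIT big_seq1 /pois expr0 mulr1 fact0 divr1.
Qed.

Lemma P_hit_le g B : finite_mass B -> (P (hit g B) <= (mean g B)%:E)%E.
Proof.
move=> fB; rewrite hitE probability_setC; last exact: measurable_count.
rewrite P_void// -EFinB lee_fin lerBlDl.
by have := expR_ge1Dx (- mean g B); lra.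
Qed.

(** Inclusion-exclusion on the void probabilities gives [(1 - expR (- x)) * (1 - expR (- y))], where
    [x] and [y] are the two means. *)
Lemma P_hit2_le g g' B B' : finite_mass B -> finite_mass B' ->
  g != g' \/ B `&` B' = set0 ->
  (P (hit g B `&` hit g' B') <= (mean g B * mean g' B')%:E)%E.
Proof.
move=> fB fB' ind.
set X := count_is (g, B, 0%N); set X' := count_is (g', B', 0%N).
have mX : measurable X by exact: measurable_count.
have mX' : measurable X' by exact: measurable_count.
have [||_] := @counts_ppp [:: (g, B, 0%N); (g', B', 0%N)] => /=.
- by rewrite andbT andbT; apply/asboolP.
- by move=> [|[|//]] e0 _.
rewrite setIT big_cons big_seq1 /pois !expr0 !mulr1 fact0 !divr1 -/X -/X' => PXX.
rewrite !hitE -/X -/X' -setCU probability_setC; last exact: measurableU.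
have PXU : P (X `|` X') = (expR (- mean g B) + expR (- mean g' B')
    - expR (- mean g B) * expR (- mean g' B'))%:E.
  transitivity (P X + P X' - P (X `&` X'))%E.
    by apply: measureUfinl => //; rewrite (le_lt_trans (probability_le1 _ mX)) ?ltry.
  by rewrite PXX /X /X' !P_void// EFinB EFinD.
rewrite PXU -EFinB lee_fin.
have := expR_ge1Dx (- mean g B); have := expR_ge1Dx (- mean g' B').
have : expR (- mean g B) <= 1 by rewrite -expR0 ler_expR oppr_le0 mean_ge0.
have : expR (- mean g' B') <= 1 by rewrite -expR0 ler_expR oppr_le0 mean_ge0.
have := mean_ge0 g B; have := mean_ge0 g' B'.
move: (mean g B) (mean g' B') (expR (- mean g B)) (expR (- mean g' B')).
move=> x y ex ey y0 x0 ey1 ex1 hy hx.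
have : (1 - ex) * (1 - ey) <= x * y by apply: ler_pM; lra.
lra.
Qed.

Definition multi g B : set Omega :=
  ~` (count_is (g, B, 0%N) `|` count_is (g, B, 1%N)).

Lemma measurable_multi g B : finite_mass B -> measurable (multi g B).
Proof.
by move=> fB; apply: measurableC; apply: measurableU; exact: measurable_count.
Qed.

(** With mean [x], the probability is [1 - (1 + x) * expR (- x)], and [expR (- x) >= 1 - x]. *)
Lemma P_multi_le g B : finite_mass B -> (P (multi g B) <= (mean g B ^+ 2)%:E)%E.
Proof.
move=> fB; set X := count_is (g, B, 0%N); set X1 := count_is (g, B, 1%N).
have mX : measurable X by exact: measurable_count.
have mX1 : measurable X1 by exact: measurable_count.
rewrite probability_setC; last exact: measurableU.
rewrite -/X -/X1 measureU//; last first.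
  rewrite -subset0 => om [/has_card0 e /has_card1[p]]; rewrite /= in e *.
  by rewrite e => /seteqP[_ /(_ p erefl)].
have [||_] := @counts_ppp [:: (g, B, 1%N)] => //.
  by move=> [|//] e0 _.
rewrite /= setIT big_seq1 /pois expr1 factS fact0 muln1 divr1 /= -/X1 => ->.
rewrite /X P_void// -!EFinD lee_fin.
have := expR_ge1Dx (- mean g B); have := mean_ge0 g B.
move: (mean g B) (expR _) => x e x0 he; rewrite expr2.
have : (1 + x) * (1 - x) <= (1 + x) * e by rewrite ler_wpM2l; lra.
lra.
Qed.

(** The Poisson weights sum to 1, so almost surely the fiber has some finite cardinality. *)
Lemma finite_fiber_ae g B : finite_mass B ->
  P.-negligible [set om | ~ finite_set (fiber (N om) g B)].
Proof.
move=> fB; pose X k := count_is (g, B, k).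
have mX k : measurable (X k) by exact: measurable_count.
have mU : measurable (\bigcup_k X k) by exact: bigcup_measurable.
have PX k : P (X k) = (pois (mean g B) k)%:E.
  have [||_] := @counts_ppp [:: (g, B, k)] => //; first by move=> [|//] e0 _.
  by rewrite /= setIT big_seq1.
exists (~` \bigcup_k X k); split; first exact: measurableC.
  suff PU : P (\bigcup_k X k) = 1%E.
    by rewrite probability_setC// [X in (1 - X)%E]PU subee.
  have tX : trivIset setT X.
    apply/trivIsetP => i j _ _ ij; rewrite -subset0 => om [[s [us /= si e]] [s' [us' /= sj e']]].
    rewrite -si -sj in ij.
    move/eqP: ij; apply; apply: perm_size; apply: uniq_perm => // p.
    have : fiber (N om) g B p <-> fiber (N om) g B p by [].
    by rewrite [in X in X <-> _]e [in X in _ <-> X]e' /= => h; apply/idP/idP => /h.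
  rewrite measure_bigcup//.
  rewrite (eq_eseriesr (g := fun k => (pois (mean g B) k)%:E)); last by move=> k _; exact: PX.
  have cv : series (pois (mean g B)) n @[n --> \oo] --> (1 : R).
    have -> : (1 : R) = expR (- mean g B) * expR (mean g B) by rewrite -expRD addNr expR0.
    have -> : series (pois (mean g B)) = (fun n => expR (- mean g B) * series (exp_coeff (mean g B)) n).
      apply/funext => n; rewrite /series/= mulr_sumr; apply: eq_bigr => k _.
      by rewrite /pois /exp_coeff/= mulrA.
    by apply: cvgMr; exact: is_cvg_series_exp_coeff.
  apply/cvg_lim => //.
  rewrite (_ : (fun n => _) = EFin \o series (pois (mean g B))).
    by apply: cvg_EFin => //; exact: nearW.
  apply/funext => n /=; rewrite /series/= sumEFin; congr EFin.
  by apply: eq_bigl => i; rewrite in_setT.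
move=> om /= nf [k _ [s [_ _ e]]]; apply: nf; rewrite e; exact: finite_seq.
Qed.

End PoissonProcess.

(** * The law of the recorded births *)

Section RecordLaw.
Variables (R : realType) (d : nat) (alpha : R) (V : site d -> \bar R).
Variables (dO : measure_display) (Omega : measurableType dO) (P : probability Omega R).
Variable N : Omega -> set (pt R d).
Hypothesis ppp : is_PPP alpha V P N.
Variables (t0 h : R).
Hypothesis h0 : 0 < h.

Local Notation w := (weight alpha V).
Local Notation mean := (mean alpha V).
Let q : R := 1 - expR (- h).

(* The probability that the column of [g] over one cell contains exactly one
   point and that this point outlives the cell. *)
Definition birth_rate (g : cyc d) : R := q * w g * expR (- (w g * h)).

Definition labw (c j : nat) : R :=
  if j is 0%N then (1 - q) ^+ c else q * (1 - q) ^+ (c - j).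

Lemma expect_lab n f : expect (lab q n) f = \sum_(j < n.+1) labw n j * f j.
Proof.
elim: n => [|n IH].
  by rewrite /= expect_dirac big_ord1 /labw expr0 mul1r.
rewrite [lab _ _]/= expect_mix expect_dirac IH [RHS]big_ord_recr [in RHS]/=; congr (_ + _).
  rewrite mulr_sumr; apply: eq_bigr => -[j jn] _ /=; rewrite mulrA; congr (_ * _).
  case: j jn => [|j] jn; first by rewrite /labw exprS.
  by rewrite /labw subSn// exprS mulrCA.
by rewrite /labw subnn expr0 mulr1.
Qed.

Lemma expRN_pow (k : nat) : expR (- (k%:R * h)) = (1 - q) ^+ k.
Proof. by rewrite /q subKr -mulrN expRM_natl. Qed.

Let tail (c m : nat) : set (R * R) :=
  [set p | cell t0 h c p.1 /\ t0 - m%:R * h < p.1 + p.2].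

Lemma finite_massC c : finite_mass (bcol t0 h c).
Proof. exact: finite_mass_col. Qed.

Lemma measurable_reg c j : measurable (reg t0 h c j).
Proof.
apply: measurableI; first by apply: measurable_birth; exact: measurable_itv.
case: j => [|j]; first exact: measurable_death_gt.
by apply: measurable_death; exact: measurable_itv.
Qed.

Lemma finite_mass_reg c j : finite_mass (reg t0 h c j).
Proof.
by apply: (finite_massS (finite_massC c)); [exact: measurable_reg|move=> p []].
Qed.

Lemma finite_mass_rest c j : finite_mass (bcol t0 h c `\` reg t0 h c j).
Proof.
apply: (finite_massS (finite_massC c)); last by move=> p [].
by apply: measurableD; [case: (finite_massC c)|exact: measurable_reg].
Qed.

Let mass_tailE c m : (m <= c)%N -> mass (tail c m) = (q * (1 - q) ^+ (c - m))%:E.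
Proof.
move=> mc; rewrite [LHS](mass_tail (a := t0 - c.+1%:R * h) (b := t0 - c%:R * h)).
- have -> : t0 - c%:R * h - (t0 - m%:R * h) = - ((c - m)%:R * h).
    by rewrite natrB//; ring.
  have -> : t0 - c.+1%:R * h - (t0 - m%:R * h) = - ((c - m).+1%:R * h).
    by rewrite -subSn// natrB ?leqW//; ring.
  by rewrite !expRN_pow exprS; congr EFin; ring.
- by rewrite ltrD2l ltrN2 ltr_pM2r// ltr_nat.
- by rewrite lerD2l lerN2 ler_pM2r// ler_nat.
Qed.

(** The region is a difference of two consecutive sets [tail], whose masses are geometric. The
    factor [q] is the mass of the points that outlive their birth cell. *)
Lemma mass_reg c j : (j <= c)%N -> mass (reg t0 h c j) = (q * labw c j)%:E.
Proof.
move=> jc; case: j jc => [|j] jc.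
  rewrite (_ : reg _ _ _ _ = tail c 0); first by rewrite mass_tailE// subn0.
  by rewrite /tail mul0r subr0.
have e : tail c j.+1 = reg t0 h c j.+1 `|` tail c j.
  apply/seteqP; split => p /=.
    move=> [cp tp]; have [tp'|tp'] := ltP (t0 - j%:R * h) (p.1 + p.2); first by right.
    by left; split => //; apply/cellP; rewrite tp tp'.
  move=> [[cp /cellP/andP[tp _]]|[cp tp]]; split => //.
  apply: le_lt_trans tp; rewrite lerD2l lerN2 ler_pM2r// ler_nat//.
have mt : measurable (tail c j).
  apply: measurableI; last exact: measurable_death_gt.
  by apply: measurable_birth; exact: measurable_itv.
have : mass (tail c j.+1) = (mass (reg t0 h c j.+1) + mass (tail c j))%E.
  rewrite e mass_setU//; first exact: measurable_reg.
  rewrite -subset0 => p [[_ /cellP/andP[_ h1]] [_ h2]].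
  by have := lt_le_trans h2 h1; rewrite ltxx.
rewrite !mass_tailE//; last exact: ltnW.
have /finite_mass_fin/fineK <- := finite_mass_reg c j.+1.
rewrite -EFinD => -[] e2; congr EFin.
apply: (addIr (q * (1 - q) ^+ (c - j))); rewrite -e2 /labw.
by rewrite -(subnSK jc) exprS; ring.
Qed.

Lemma mass_colE c : mass (bcol t0 h c) = h%:E.
Proof.
rewrite [LHS](mass_col (a := t0 - c.+1%:R * h) (b := t0 - c%:R * h)).
  by congr EFin; rewrite -natr1; ring.
by rewrite lerD2l lerN2 ler_pM2r// ler_nat.
Qed.

Lemma mean_reg g c j : (j <= c)%N -> mean g (reg t0 h c j) = q * w g * labw c j.
Proof. by move=> jc; rewrite /mean mass_reg//=; ring. Qed.

Lemma mean_col g c : mean g (bcol t0 h c) = w g * h.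
Proof. by rewrite /mean mass_colE. Qed.

Lemma mean_rest g c j :
  mean g (reg t0 h c j) + mean g (bcol t0 h c `\` reg t0 h c j) = w g * h.
Proof.
rewrite /mean -mulrDr -fineD; try exact: finite_mass_fin (finite_mass_reg _ _);
  try exact: finite_mass_fin (finite_mass_rest _ _).
rewrite -mass_setU.
- by rewrite setDUK ?mass_colE// => p [].
- exact: measurable_reg.
- by case: (finite_mass_rest c j).
- by rewrite -subset0 => p [? []].
Qed.

Definition col_entries (x : cyc d * nat * nat) : seq (entry R d) :=
  [:: (x.1.1, reg t0 h x.1.2 x.2, 1%N);
      (x.1.1, bcol t0 h x.1.2 `\` reg t0 h x.1.2 x.2, 0%N)].

Definition flat (l : seq (cyc d * nat * nat)) := flatten (map col_entries l).

Lemma all_indep_flat e c l : e.1.2 `<=` bcol t0 h c ->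
  (e.1.1, c) \notin map fst l -> all (@indep R d e) (flat l).
Proof.
move=> ec; elim: l => [//|[[g c'] j] l IH] /=.
rewrite inE negb_or => /andP[ne /IH ->].
have H B : B `<=` bcol t0 h c' -> forall k, indep e (g, B, k).
  move=> Bc k; apply/asboolP => /=.
  have [eg|ng] := eqVneq e.1.1 g; last by left.
  right; rewrite -subset0 => p [/ec pc /Bc pc'].
  by move/negP: ne; apply; rewrite eg (cell_inj h0 pc pc').
by rewrite !H// => p [].
Qed.

Lemma pairwise_flat l : uniq (map fst l) -> pairwise (@indep R d) (flat l).
Proof.
elim: l => [//|[[g c] j] l IH] /= /andP[gl /IH ->].
rewrite !andbT; apply/andP; split; last by apply: (@all_indep_flat _ c) => // p [].
apply/andP; split; last by apply: (@all_indep_flat _ c) => // p [].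
by apply/asboolP; right; rewrite -subset0 => p [? []].
Qed.

Lemma counts_flat l : counts N (flat l) =
  [set om | forall x, x \in l -> single t0 h (N om) x.1.1 x.1.2 x.2].
Proof.
elim: l => [|x l IH]; first by apply/seteqP; split => om.
rewrite /= IH; apply/seteqP; split => om.
  by move=> [h1 [h2 h3]] y; rewrite inE => /predU1P[->|/h3].
move=> H; have [h1 h2] := H x (mem_head _ _); split => //; split => // y yl.
by apply: H; rewrite inE yl orbT.
Qed.

(** One point in the region and none in the rest of the column: the two exponentials combine to
    [expR (- (w g * h))], which explains the form of [birth_rate]. *)
Lemma single_law l : uniq (map fst l) -> all (fun x => (x.2 <= x.1.2)%N) l ->
  measurable [set om | forall x, x \in l -> single t0 h (N om) x.1.1 x.1.2 x.2] /\
  P [set om | forall x, x \in l -> single t0 h (N om) x.1.1 x.1.2 x.2] =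
    (\prod_(x <- l) (birth_rate x.1.1 * labw x.1.2 x.2))%:E.
Proof.
move=> ul vl; rewrite -counts_flat.
have [|mc ->] := counts_ppp ppp (pairwise_flat ul).
  move=> i e0; elim: l i {ul vl} => [//|x l IH] /= [|[|i]] /=.
  - by move=> _; exact: finite_mass_reg.
  - by move=> _; exact: finite_mass_rest.
  - by rewrite !ltnS; exact: IH.
split => //; congr EFin; elim: l vl {ul mc} => [|[[g c] j] l IH] /=.
  by rewrite !big_nil.
move=> /andP[/= jc vl]; rewrite !big_cons -IH// mulrA; congr (_ * _).
rewrite /pois /= expr1 expr0 !mulr1 fact0 factS fact0 muln1 !divr1.
rewrite mulrAC -expRD -opprD mean_rest mean_reg// /birth_rate; ring.
Qed.

Lemma partition_law (f : Omega -> option nat) n (X : set Omega) :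
  (forall om j, f om = Some j -> (j < n)%N) ->
  measurable (X `&` [set om | f om = None]) ->
  (forall j, (j < n)%N -> measurable (X `&` [set om | f om = Some j])) ->
  measurable X /\
  P X = (P (X `&` [set om | f om = None%R]) +
         \sum_(j < n) P (X `&` [set om | f om = Some (j : nat)]))%E.
Proof.
move=> fn mN mS.
pose S (j : nat) := X `&` [set om | f om = Some j].
have XE : X = (X `&` [set om | f om = None]) `|` \big[setU/set0]_(j < n) S j.
  rewrite -bigcup_mkord; apply/seteqP; split => om.
    move=> Xom; case e : (f om) => [j|]; last by left.
    by right; exists j => //=; exact: fn e.
  by move=> [[]//|[j _ []]].
have mU : measurable (\big[setU/set0]_(j < n) S j).
  by apply: bigsetU_measurable => j _; exact: mS.
split; first by rewrite XE; exact: measurableU.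
rewrite [in LHS]XE measureU//; last first.
  rewrite -bigcup_mkord -subset0 => om [[_ /= e] [j _ [_ /=]]].
  by rewrite e.
rewrite measure_semi_additive_ord_I//.
by move=> i j _ _ [om [[_ /= ei] [_ /=]]]; rewrite ei => -[].
Qed.

Lemma record_lt g c om j : record t0 h (N om) g c = Some j -> (j < c.+1)%N.
Proof. by rewrite ltnS => /(recordP _ h0)[]. Qed.

Definition column_value := ((cyc d * nat) * option nat)%type.

Definition recorded (l : seq column_value) : set Omega :=
  [set om | forall x, x \in l -> record t0 h (N om) x.1.1 x.1.2 = x.2].

Definition value_weight (x : column_value) : R :=
  if x.2 is Some j then birth_rate x.1.1 * labw x.1.2 j else 1 - birth_rate x.1.1.

Definition value_valid (x : column_value) : bool :=
  if x.2 is Some j then (j <= x.1.2)%N else true.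

Lemma recorded_cons x l : recorded (x :: l) =
  recorded l `&` [set om | record t0 h (N om) x.1.1 x.1.2 = x.2].
Proof.
apply/seteqP; split => om.
  by move=> H; split; [move=> y yl; apply: H; rewrite inE yl orbT|exact: H (mem_head _ _)].
by move=> [H1 H2] y; rewrite inE => /predU1P[->//|/H1].
Qed.

Lemma q01 : 0 <= q <= 1.
Proof.
rewrite /q subr_ge0 gerBl expR_ge0 andbT -expR0 ler_expR oppr_le0.
exact: ltW.
Qed.

Lemma sum_labw c : \sum_(j < c.+1) labw c j = 1.
Proof.
have := expect_cst 1 (is_dist_lab c q01); rewrite expect_lab => <-.
by apply: eq_bigr => j _; rewrite mulr1.
Qed.

(** Only records [Some j] are direct count events. A record [None] is the complement of these, so
    induct on the number of [None] entries and subtract, using that the label weights sum to 1. *)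
Lemma record_law l : uniq (map fst l) -> all value_valid l ->
  measurable (recorded l) /\ P (recorded l) = (\prod_(x <- l) value_weight x)%:E.
Proof.
have [k] := ubnP (count (fun x : column_value => x.2 == None) l).
elim: k l => // k IH l; rewrite ltnS => ck ul vl.
have [/hasP[[[g c] o] xl /= /eqP eo]|/hasPn noN] :=
    boolP (has (fun x : column_value => x.2 == None) l); last first.
  pose l' := [seq (x.1, odflt 0%N x.2) | x <- l].
  have ul' : uniq (map fst l') by rewrite -map_comp (eq_map (g := fst)).
  have vl' : all (fun x => (x.2 <= x.1.2)%N) l'.
    rewrite all_map; apply: sub_all vl => -[[g c] [j|]] //=.
  have -> : recorded l = [set om | forall x, x \in l' -> single t0 h (N om) x.1.1 x.1.2 x.2].
    apply/seteqP; split => om H.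
      move=> _ /mapP[[[g c] o] xl ->] /=; have := H _ xl; have := noN _ xl.
      by case: o xl => [j|//] _ _ /= /(recordP _ h0)[].
    move=> [[g c] o] xl /=; have := noN _ xl; have /allP/(_ _ xl) := vl.
    case: o xl => [j|//] xl /= jc _; apply/(recordP _ h0); split => //.
    by apply: (H (g, c, j)); apply/mapP; exists (g, c, Some j).
  have [m ->] := single_law ul' vl'; split => //; congr EFin.
  rewrite big_map big_seq [RHS]big_seq; apply: eq_bigr => -[[g c] [j|]] //= xl.
  by have := noN _ xl.
rewrite {}eo in xl; pose l0 := rem (g, c, None) l.
have pl : perm_eq l ((g, c, None) :: l0) by exact: perm_to_rem.
have rE : recorded l = recorded ((g, c, None) :: l0).
  apply/seteqP; split => om H x xl'; apply: H; first by rewrite (perm_mem pl).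
  by rewrite -(perm_mem pl).
rewrite rE (perm_big _ pl) /= big_cons recorded_cons /=.
have cl0 : (count (fun x : column_value => x.2 == None) l0 < k)%N.
  by apply: leq_trans ck; have /permP -> := pl.
have ul0 : uniq (map fst ((g, c, None) :: l0 : seq column_value)).
  by rewrite -(perm_uniq (perm_map fst pl)).
have vl0 : all value_valid ((g, c, None) :: l0) by rewrite -(perm_all _ pl).
move: vl0 => /= vl0.
have ul0' : uniq (map fst l0) by move: ul0 => /= /andP[].
have [m0 P0] := IH _ cl0 ul0' vl0.
have S j : (j < c.+1)%N ->
    measurable (recorded l0 `&` [set om | record t0 h (N om) g c = Some j]) /\
    P (recorded l0 `&` [set om | record t0 h (N om) g c = Some j]) =
      (birth_rate g * labw c j * \prod_(x <- l0) value_weight x)%:E.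
  move=> jc; have [||] := IH ((g, c, Some j) :: l0) cl0.
  - by [].
  - by rewrite /= vl0 andbT.
  - by rewrite recorded_cons big_cons.
have mN : measurable (recorded l0 `&` [set om | record t0 h (N om) g c = None]).
  pose T (j : nat) := recorded l0 `&` [set om | record t0 h (N om) g c = Some j].
  rewrite (_ : _ `&` _ = recorded l0 `\` \big[setU/set0]_(j < c.+1) T j).
    apply: measurableD => //; apply: bigsetU_measurable => j _.
    by have [] := S j (ltn_ord j).
  rewrite -bigcup_mkord; apply/seteqP; split => om.
    by move=> [r0 /= e]; split => // -[j _ [_ /=]]; rewrite e.
  move=> [r0 nS]; split => //=; case e : (record _ _ _ _ _) => [j|//].
  by exfalso; apply: nS; exists j => //=; exact: record_lt e.
split => //.
have [|_] := @partition_law (fun om => record t0 h (N om) g c) c.+1 (recorded l0)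
    (fun om j => @record_lt g c om j) mN.
  by move=> j jc; have [] := S j jc.
rewrite P0 (eq_bigr (fun j : 'I_c.+1 =>
  (birth_rate g * labw c j * \prod_(x <- l0) value_weight x)%:E)); last first.
  by move=> j _; have [] := S j (ltn_ord j).
rewrite sumEFin -mulr_suml -mulr_sumr sum_labw mulr1.
move: (P _) => [x|//|//]; rewrite -EFinD => -[] e; congr EFin.
by rewrite /value_weight /= mulrBl mul1r [X in _ = X - _]e addrK.
Qed.

Definition records (gs : seq (cyc d)) (om : Omega) (c : nat) : layer (cyc d) :=
  fun g => if g \in gs then record t0 h (N om) g c else None.

(** Mirrors [history_expect], which leaves all cells from [n] on empty. A predicate of the truncated
    records sees finitely many columns with finitely many values, so it is an event whatever the
    predicate. *)
Definition truncate (n : nat) (s : nat -> layer (cyc d)) : nat -> layer (cyc d) :=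
  fun c => if (c < n)%N then s c else fun=> None.

Section Link.
Variable gs : seq (cyc d).
Hypothesis ugs : uniq gs.

Let law_at (l : seq column_value) (X : set Omega) (e : R) : Prop :=
  measurable (recorded l `&` X) /\
  P (recorded l `&` X) = ((\prod_(x <- l) value_weight x) * e)%:E.

(** Reveals the columns of cell [n] one cycle at a time; [l] collects the columns already revealed,
    in this cell and in older ones. *)
Let link_layer n :
  (forall l Q, uniq (map fst l) -> all value_valid l ->
    (forall x, x \in l -> (n <= x.1.2)%N) ->
    law_at l [set om | Q (truncate n (records gs om))]
      (history_expect gs q birth_rate n (fun s => (`[< Q s >])%:R))) ->
  forall gs' T l, uniq gs' -> uniq (map fst l) -> all value_valid l ->
    (forall x, x \in l -> (n <= x.1.2)%N /\ (x.1.2 = n -> x.1.1 \notin gs')) ->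
    law_at l [set om | T (records gs' om n) (truncate n (records gs om))]
      (pexpect gs' (fun g => birth q (birth_rate g) n) None
        (fun D => history_expect gs q birth_rate n (fun s => (`[< T D s >])%:R))).
Proof.
move=> IHn; elim => [|g gs' IH] T l /=.
  move=> _ ul vl cl; apply: (IHn l (T (fun=> None))) => // x /cl[].
  by [].
move=> /andP[ggs' ugs'] ul vl cl.
set X := [set om | _].
pose E o := pexpect gs' (fun g => birth q (birth_rate g) n) None
  (fun D => history_expect gs q birth_rate n (fun s => (`[< T (upd D g o) s >])%:R)).
have piece o : value_valid (g, n, o) ->
    measurable ((recorded l `&` X) `&` [set om | record t0 h (N om) g n = o]) /\
    P ((recorded l `&` X) `&` [set om | record t0 h (N om) g n = o]) =
      (value_weight (g, n, o) * (\prod_(x <- l) value_weight x) * E o)%:E.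
  move=> vo; have [|||m e] := IH (fun D => T (upd D g o)) ((g, n, o) :: l) ugs'.
  - rewrite /= ul andbT; apply/mapP => -[x xl e].
    by have [_] := cl x xl; rewrite -e /= => /(_ erefl); rewrite mem_head.
  - by rewrite /= vo.
  - move=> x; rewrite inE => /predU1P[->//|xl].
    have [nx xg] := cl x xl; split => // /xg.
    by rewrite inE negb_or => /andP[].
  - have eX : (recorded l `&` X) `&` [set om | record t0 h (N om) g n = o] =
       recorded ((g, n, o) :: l) `&`
       [set om | T (upd (records gs' om n) g o) (truncate n (records gs om))].
      have eu om : record t0 h (N om) g n = o ->
          upd (records gs' om n) g o = records (g :: gs') om n.
        move=> ro; apply/funext => g'; rewrite /upd /records inE.
        by case: eqP => [->|].
      rewrite recorded_cons /=; apply/seteqP; split => om.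
        by move=> [[rl X1] /= ro]; split => //=; rewrite eu.
      by move=> [[rl /= ro]]; rewrite eu.
    by rewrite eX; split => //; rewrite e big_cons.
have [||m e] := @partition_law (fun om => record t0 h (N om) g n) n.+1 (recorded l `&` X)
    (fun om j => @record_lt g n om j).
- by have [] := piece None isT.
- by move=> j jn; have [] := piece (Some j) jn.
split => //; rewrite e (proj2 (piece None isT)).
rewrite (eq_bigr (fun j : 'I_n.+1 => (value_weight (g, n, Some (j : nat)) *
   (\prod_(x <- l) value_weight x) * E (Some (j : nat)))%:E)); last first.
  by move=> j _; have [] := piece (Some (j : nat)) (ltn_ord j).
rewrite sumEFin -EFinD; congr EFin.
rewrite expect_mix expect_dirac expect_map expect_lab /value_weight /= mulrDr !mulr_sumr.
congr (_ + _); first by rewrite mulrCA mulrA.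
by apply: eq_bigr => j _; rewrite /= -/(E _); ring.
Qed.

Lemma records_law n l Q : uniq (map fst l) -> all value_valid l ->
  (forall x, x \in l -> (n <= x.1.2)%N) ->
  measurable (recorded l `&` [set om | Q (truncate n (records gs om))]) /\
  P (recorded l `&` [set om | Q (truncate n (records gs om))]) =
    ((\prod_(x <- l) value_weight x) *
     history_expect gs q birth_rate n (fun s => (`[< Q s >])%:R))%:E.
Proof.
elim: n l Q => [|n IH] l Q ul vl cl.
  have [m e] := record_law ul vl.
  have -> : [set om | Q (truncate 0 (records gs om))] = [set om | Q (fun=> fun=> None)].
    by [].
  rewrite /=; case: asboolP => q'.
    by rewrite (_ : [set om | _] = setT) ?setIT ?mulr1//; apply/seteqP; split.
  rewrite (_ : [set om | _] = set0); last by apply/seteqP; split.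
  by rewrite setI0 measure0 mulr0.
have [|] := link_layer IH (fun x s => Q (upd s n x)) ugs ul vl.
  by move=> x /cl nx; split; [exact: ltnW|lia].
have -> : [set om | Q (upd (truncate n (records gs om)) n (records gs om n))] =
    [set om | Q (truncate n.+1 (records gs om))]; last by [].
have e om : upd (truncate n (records gs om)) n (records gs om n) =
    truncate n.+1 (records gs om).
  apply/funext => c; rewrite /upd /truncate.
  case: (eqVneq c n) => [->|cn]; first by rewrite ltnSn.
  by rewrite [in RHS]ltnS [in RHS]leq_eqVlt (negbTE cn).
by apply/seteqP; split => om /=; rewrite e.
Qed.

(** The discretization is exact in law: the finite computation [adv_prob] is the probability of an
    event of the Poisson process itself. *)
Lemma adv_prob_records L n sigma A :
  measurable [set om | outcome (@incompat d) L n (records gs om) sigma A] /\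
  P [set om | outcome (@incompat d) L n (records gs om) sigma A] =
    (adv_prob (@incompat d) gs L q birth_rate A n sigma)%:E.
Proof.
have [//|//|//|] := @records_law n [::] (fun s => outcome (@incompat d) L n s sigma A).
have -> : recorded [::] `&` [set om | outcome (@incompat d) L n
    (truncate n (records gs om)) sigma A] =
    [set om | outcome (@incompat d) L n (records gs om) sigma A].
  apply/seteqP; split => om.
    by move=> [_]; apply: outcome_ext => c cn; rewrite /truncate cn.
  move=> o; split => //; apply: outcome_ext o => c cn; by rewrite /truncate cn.
by rewrite big_nil mul1r.
Qed.

End Link.
End RecordLaw.

(** * The exit event *)

Section CountableTypes.
Variables (d : nat).

Definition first_cycles (m : nat) : seq (cyc d) := undup (pmap unpickle (iota 0 m)).

Lemma mem_first_cycles m (g : cyc d) : (pickle g < m)%N -> g \in first_cycles m.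
Proof.
move=> gm; rewrite mem_undup mem_pmap; apply/mapP; exists (pickle g).
  by rewrite mem_iota.
by rewrite pickleK.
Qed.

Lemma first_cycles_le m m' : (m <= m')%N ->
  {subset first_cycles m <= first_cycles m'}.
Proof.
move=> mm' g; rewrite !mem_undup !mem_pmap => /mapP[i]; rewrite mem_iota => /= im e.
by apply/mapP; exists i => //; rewrite mem_iota /=; exact: leq_trans mm'.
Qed.

Lemma first_cycles_uniq m : uniq (first_cycles m).
Proof. exact: undup_uniq. Qed.

Lemma first_cycles_seq (s : seq (cyc d)) : exists m, {subset s <= first_cycles m}.
Proof.
elim: s => [|g s [m IH]]; first by exists 0%N.
exists (maxn m (pickle g).+1) => g'; rewrite inE => /predU1P[->|/IH].
  by apply: mem_first_cycles; rewrite leq_maxr.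
by apply: first_cycles_le; rewrite leq_maxl.
Qed.

End CountableTypes.

(** * Continuity from above and the union bound *)

Section DecreasingEvents.
Variables (R : realType) (dO : measure_display) (Omega : measurableType dO).
Variable P : probability Omega R.

Lemma decreasing_null (X : nat -> set Omega) :
  (forall m, measurable (X m)) -> (forall m, X m.+1 `<=` X m) ->
  P.-negligible (\bigcap_m X m) ->
  forall e : R, 0 < e -> exists m0, forall m, (m0 <= m)%N -> (P (X m) <= e%:E)%E.
Proof.
move=> mX dX nX e e0.
have mcap : measurable (\bigcap_m X m) by exact: bigcap_measurable.
have ni : nonincreasing_seq X.
  apply/nonincreasing_seqP => m; apply/subsetPset; exact: dX.
have := nonincreasing_cvg_mu (mu := P) _ mX mcap ni.
rewrite (measure_negligible mcap nX).
have -> : (P (X 0%N) < +oo)%E by rewrite (le_lt_trans (probability_le1 _ _)) ?ltry.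
move=> /(_ isT) cv.
have cvf : (fine \o (P \o X)) m @[m --> \oo] --> (0 : R) by apply: fine_cvg.
have /cvgr0Pnorm_le/(_ e e0)[m0 _ H] := cvf.
exists m0 => m mm0; have := H m mm0; rewrite /= ger0_norm ?fine_ge0//.
by rewrite -lee_fin fineK// fin_num_measure.
Qed.

Lemma P_bigsetU_le (I : eqType) (s : seq I) (F : I -> set Omega) (b : I -> R) :
  (forall i, i \in s -> measurable (F i)) ->
  (forall i, i \in s -> (P (F i) <= (b i)%:E)%E) ->
  measurable (\big[setU/set0]_(i <- s) F i) /\
  (P (\big[setU/set0]_(i <- s) F i) <= (\sum_(i <- s) b i)%:E)%E.
Proof.
elim: s => [|i s IH] mF bF; first by rewrite !big_nil measure0.
have [||m le] := IH; [by move=> j js; apply: mF; rewrite inE js orbT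
  |by move=> j js; apply: bF; rewrite inE js orbT|].
have mi := mF i (mem_head _ _); have bi := bF i (mem_head _ _).
rewrite !big_cons; split; first exact: measurableU.
apply: le_trans (measureU2 _ _ _) _ => //; by rewrite EFinD leeD.
Qed.

End DecreasingEvents.

Section ExitEvent.
Variables (R : realType) (d : nat) (alpha : R) (V : site d -> \bar R).
Variables (dO : measure_display) (Omega : measurableType dO) (P : probability Omega R).
Variable N : Omega -> set (pt R d).
Hypothesis ppp : is_PPP alpha V P N.
Variables (t0 : R) (S : seq (cyc d)).

Definition alive : set (R * R) := [set p | p.1 <= t0 < p.1 + p.2].

Lemma aliveE : alive = \bigcup_c reg t0 1 c 0.
Proof.
apply/seteqP; split => p.
  move=> /andP[pt tp]; have [c cp] := cell_exists (@ltr01 R) pt.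
  by exists c.
move=> [c _ [/(cell_le0 ltr01) pt tp]]; by apply/andP; split.
Qed.

Lemma measurable_alive : measurable alive.
Proof. by rewrite aliveE; apply: bigcup_measurable => c _; exact: measurable_reg. Qed.

(** The points born in the unit cell [c] and alive at [t0] have mass
    [(1 - expR (- 1)) * expR (- c)], a geometric series with sum 1. *)
Lemma finite_mass_alive : finite_mass alive.
Proof.
split; first exact: measurable_alive.
rewrite /mass aliveE setI_bigcupl ge0_integral_bigcup//=; last 3 first.
- by move=> c; apply: measurableI; [exact: measurable_reg|exact: measurable_half_plane].
- by apply: measurable_funTS; exact: measurable_expRN_snd.
- move=> i j _ _ [p [[[ci _] _] [[cj _] _]]]; exact: (cell_inj ltr01 ci cj).
pose b c : R := (1 - expR (- 1 : R)) * labw (1 : R) c 0.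
rewrite (eq_eseriesr (g := fun c => (b c)%:E)); last first.
  by move=> c _; exact: (mass_reg t0 ltr01 (leq0n c)).
have b0 c : 0 <= b c.
  by rewrite mulr_ge0 ?exprn_ge0// subr_ge0 ?gerBl ?expR_ge0// -expR0 ler_expR oppr_le0.
apply: (@le_lt_trans _ _ 1%E); last exact: ltry.
apply: lime_le; first by apply: is_cvg_ereal_nneg_natsum => c _; rewrite lee_fin.
apply: nearW => n; rewrite sumEFin lee_fin.
suff -> : \sum_(0 <= c < n) b c = 1 - (expR (- 1 : R)) ^+ n.
  by rewrite gerBl exprn_ge0 ?expR_ge0.
elim: n => [|n IH]; first by rewrite big_geq// expr0 subrr.
by rewrite big_nat_recr//= IH /b /labw subKr exprS; ring.
Qed.

Definition reach_hit (n : nat) (g : cyc d) (B : set (R * R)) : set Omega :=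
  [set om | exists p, B p /\ reachn t0 (N om) S n (g, p.1, p.2)].

Lemma reach_hit0 g B :
  reach_hit 0 g B = if g \in S then hit N g (B `&` alive) else set0.
Proof.
apply/seteqP; split => om.
  by move=> [p [Bp [Np /= -> al]]]; exists p.
case: ifPn => // gS [p [Np [Bp al]]]; exists p; split => //; by split.
Qed.

(* Rationals separate the strict inequalities linking a point to an ancestor, which
   decouples the two points and leaves a countable union. *)
Lemma reach_hitS n g B : reach_hit n.+1 g B =
  \bigcup_g' \bigcup_(xy : rat * rat)
    (if `[< incompat g g' >] then
       hit N g (B `&` [set p | p.1 < ratr xy.1] `&` [set p | ratr xy.2 < p.1 + p.2]) `&`
       reach_hit n g' [set p | ratr xy.1 < p.1 < ratr xy.2]
     else set0).
Proof.
apply/seteqP; split => om.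
  move=> [p [Bp [[[g' t'] s'] r [Np [/= ig /andP[lt1 lt2]]]]]].
  have [x /itvP xi] := rat_in_itvoo lt1; have [y /itvP yi] := rat_in_itvoo lt2.
  exists g' => //; exists (x, y) => //=; case: asboolP => // _; split.
    by exists p; split => //; split; [split => //=; rewrite xi|rewrite /= yi].
  by exists (t', s'); split => //=; rewrite xi yi.
move=> [g' _ [[x y] _]] /=; case: asboolP => // ig.
move=> [[p [Np [[Bp /= px] /= py]]] [p' [/andP[xp' p'y] r]]].
exists p; split => //; exists (g', p'.1, p'.2) => //; split => //; split => //=.
by rewrite (lt_trans px xp') (lt_trans p'y py).
Qed.

Lemma measurable_lt_fst (x : R) : measurable [set p : R * R | p.1 < x].
Proof.
rewrite (_ : [set p | _] = [set p | `]-oo, x[%classic p.1]).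
  by apply: measurable_birth; exact: measurable_itv.
by apply/seteqP; split => p /=; rewrite in_itv.
Qed.

Lemma measurable_reach_hit n g B : measurable B -> measurable (reach_hit n g B).
Proof.
elim: n g B => [|n IH] g B mB.
  rewrite reach_hit0; case: ifP => // _; apply: (measurable_hit ppp).
  by apply: measurableI => //; exact: measurable_alive.
rewrite reach_hitS; apply: countable_bigcupT_measurable; first exact: countableP.
move=> g'; apply: countable_bigcupT_measurable; first exact: countableP.
move=> [x y] /=; case: ifP => // _; apply: measurableI.
  apply: (measurable_hit ppp); apply: measurableI; last exact: measurable_death_gt.
  by apply: measurableI => //; exact: measurable_lt_fst.
apply: IH; rewrite (_ : [set p | _] = [set p | `]ratr x, ratr y[%classic p.1]).
  by apply: measurable_birth; exact: measurable_itv.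
by apply/seteqP; split => p /=; rewrite in_itv.
Qed.

(** One parameter bounds both the cycles and the time window, so that these events decrease with
    [m]. *)
Definition exits (m : nat) : set Omega :=
  [set om | exists phi, reach t0 (N om) S phi /\
     (phi.1.1 \in first_cycles d m -> phi.1.2 <= t0 - m%:R)].

Lemma exitsE m : exits m = \bigcup_n \bigcup_g
  reach_hit n g [set p | g \in first_cycles d m -> p.1 <= t0 - m%:R].
Proof.
apply/seteqP; split => om.
  by move=> [[[g t] s] [[n _ r] e]]; exists n => //; exists g => //; exists (t, s).
by move=> [n _ [g _ [p [e r]]]]; exists (g, p.1, p.2); split => //; exists n.
Qed.

Lemma measurable_exits m : measurable (exits m).
Proof.
rewrite exitsE; apply: bigcup_measurable => n _.
apply: countable_bigcupT_measurable; first exact: countableP.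
move=> g; apply: measurable_reach_hit; case: (g \in first_cycles d m).
  rewrite (_ : [set p | _] = [set p | `]-oo, t0 - m%:R]%classic p.1]).
    by apply: measurable_birth; exact: measurable_itv.
  by apply/seteqP; split => p /=; rewrite in_itv //=; exact.
by rewrite (_ : [set p | _] = setT)//; apply/seteqP; split.
Qed.

Lemma exitsS m : exits m.+1 `<=` exits m.
Proof.
move=> om [phi [r e]]; exists phi; split => // /(first_cycles_le (leqnSn m)) /e.
by move=> h; apply: le_trans h _; rewrite lerD2l lerN2 ler_nat.
Qed.

Lemma reach_clan om : reach t0 (N om) S `<=` reachn t0 (N om) S 0 `|`
  \bigcup_(phi in reachn t0 (N om) S 0) clan (N om) phi.
Proof.
have cl phi psi chi : clan (N om) phi psi -> anc1 (N om) psi chi -> clan (N om) phi chi.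
  by move=> [n _ c] a; exists n.+1 => //; exists psi.
move=> phi [n _]; elim: n phi => [|n IH] phi; first by left.
move=> [psi /IH [r0|[chi r0 c]] a]; right.
  by exists psi => //; exact: clan1.
by exists chi => //; exact: cl c a.
Qed.

Hypothesis fin_clan : {ae P, forall om, forall phi, N om phi -> finite_set (clan (N om) phi)}.

(** Almost surely finitely many points of [S] are alive at [t0], each with a finite clan. The
    relevant points are then finitely many and fit into some window. *)
Lemma exits_null : P.-negligible (\bigcap_m exits m).
Proof.
pose Y g := [set om | ~ finite_set (fiber (N om) g alive)].
apply: (negligibleS (A := ~` [set om | forall phi, N om phi -> finite_set (clan (N om) phi)]
    `|` \big[setU/set0]_(g <- S) Y g)); last first.
  apply: negligibleU; first exact: fin_clan.
  elim: S => [|g s IH]; first by rewrite big_nil; exact: negligible_set0.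
  rewrite big_cons; apply: negligibleU => //.
  by apply: (finite_fiber_ae ppp); exact: finite_mass_alive.
move=> om ex; apply: contrapT => /not_orP[/contrapT fc nY].
have fr g : g \in S -> finite_set (fiber (N om) g alive).
  move=> gS; apply: contrapT => nf; apply: nY.
  by rewrite -bigcup_seq; exists g.
have fr0 : finite_set (reachn t0 (N om) S 0).
  apply: (@sub_finite_set _ _ (\bigcup_(g in [set` S])
      ((fun p : R * R => (g, p.1, p.2)) @` fiber (N om) g alive))).
    by move=> [[g t] s] [Np gS al]; exists g => //; exists (t, s).
  apply: bigcup_finite => [|g gS]; first exact: finite_seq.
  by apply: finite_image; exact: fr.
have /finite_seqP[s es] : finite_set (reach t0 (N om) S).
  apply: sub_finite_set (@reach_clan om) _; rewrite finite_setU; split => //.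
  by apply: bigcup_finite => // phi [Np _ _]; exact: fc.
have [m hm] : exists m, forall phi, phi \in s ->
    phi.1.1 \in first_cycles d m /\ t0 - m%:R < phi.1.2.
  elim: s {es} => [|[[g t] l] s [m IH]]; first by exists 0%N.
  exists (maxn m (maxn (pickle g).+1 (Num.truncn `|t0 - t|).+1)) => phi.
  rewrite inE => /predU1P[->|/IH[h1 h2]] /=; split.
  - by apply: mem_first_cycles; rewrite leq_max leq_max leqnn orbT.
  - rewrite ltrBlDl -ltrBlDr; apply: le_lt_trans (ler_norm _) _.
    apply: lt_le_trans (truncnS_gt _) _; rewrite ler_nat.
    by rewrite leq_max leq_max leqnn !orbT.
  - by apply: first_cycles_le h1; rewrite leq_maxl.
  - by apply: le_lt_trans h2; rewrite lerD2l lerN2 ler_nat leq_maxl.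
have [phi [r e]] := ex m I.
have /hm[h1 h2] : phi \in s by move: r; rewrite es.
by have := lt_le_trans h2 (e h1); rewrite ltxx.
Qed.

Lemma exits_small (e : R) : 0 < e ->
  exists m0, forall m, (m0 <= m)%N -> (P (exits m) <= e%:E)%E.
Proof.
apply: decreasing_null; [exact: measurable_exits|exact: exitsS|exact: exits_null].
Qed.

End ExitEvent.

(** * The collision event *)

Section CollisionEvent.
Variables (R : realType) (d : nat) (alpha : R) (V : site d -> \bar R).
Variables (dO : measure_display) (Omega : measurableType dO) (P : probability Omega R).
Variable N : Omega -> set (pt R d).
Hypothesis ppp : is_PPP alpha V P N.
Variables (t0 h : R) (L : seq (cyc d)) (n0 : nat).
Hypothesis h0 : 0 < h.

Local Notation w := (weight alpha V).
Let q : R := 1 - expR (- h).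

Definition short_lived (c : nat) : set (R * R) :=
  [set p | cell t0 h c p.1 /\ p.1 + p.2 <= t0 - c%:R * h].

Let qh : q <= h.
Proof. by rewrite /q lerBlDr addrC -lerBlDr; have := expR_ge1Dx (- h); lra. Qed.

Let q0 : 0 <= q. Proof. by case/andP: (q01 h0). Qed.

(** From [1 + h <= expR h] and [(1 + h) * (1 - h + h ^+ 2) = 1 + h ^+ 3]. *)
Lemma expRN_le : expR (- h) <= 1 - h + h ^+ 2.
Proof.
have h1 : 0 < 1 + h by rewrite addr_gt0.
rewrite -(ler_pM2l h1); apply: (@le_trans _ _ (expR h * expR (- h))).
  by rewrite ler_wpM2r ?expR_ge0// expR_ge1Dx.
rewrite -expRD subrr expR0 -subr_ge0 (_ : _ - 1 = h ^+ 3); last by ring.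
by rewrite exprn_ge0// ltW.
Qed.

Lemma finite_mass_short c : finite_mass (short_lived c).
Proof.
apply: (finite_massS (finite_massC t0 h c)); last by move=> p [].
apply: measurableI; first by apply: measurable_birth; exact: measurable_itv.
have -> : (fun p : R * R => is_true (p.1 + p.2 <= t0 - c%:R * h)) =
    ~` [set p : R * R | t0 - c%:R * h < p.1 + p.2].
  by apply/seteqP; split => p /=; rewrite leNgt => /negP.
by apply: measurableC; exact: measurable_death_gt.
Qed.

(** The column has mass [h] and its points outliving the cell have mass [q]; the difference is at
    most [h ^+ 2]. *)
Lemma mean_short_le g c : mean alpha V g (short_lived c) <= w g * h ^+ 2.
Proof.
rewrite ler_wpM2l ?(weight_ge0 alpha V)//.
pose T := [set p : R * R | cell t0 h c p.1 /\ t0 - c%:R * h < p.1 + p.2].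
have mT : measurable T.
  apply: measurableI; last exact: measurable_death_gt.
  by apply: measurable_birth; exact: measurable_itv.
have massT : mass T = q%:E.
  rewrite [LHS](mass_tail (a := t0 - c.+1%:R * h) (b := t0 - c%:R * h))//.
    congr EFin; rewrite subrr expR0 /q; congr (_ - expR _).
    by rewrite -natr1; ring.
  by rewrite ltrD2l ltrN2 ltr_pM2r// ltr_nat.
have : mass (bcol t0 h c) = (mass (short_lived c) + mass T)%E.
  rewrite -mass_setU//.
  - congr mass; apply/seteqP; split => p.
      by move=> cp; case: (leP (p.1 + p.2) (t0 - c%:R * h)); [left|right].
    by move=> [[]|[]].
  - by case: (finite_mass_short c).
  - by rewrite -subset0 => p [[_ h1] [_ h2]]; move: h1; rewrite leNgt h2.
rewrite mass_colE// massT.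
have /finite_mass_fin/fineK <- := finite_mass_short c.
rewrite -EFinD /= => -[] e; have := expRN_le.
move: (fine _) e => x; rewrite /q; lra.
Qed.

Definition bad_column (gc : cyc d * nat) : set Omega :=
  multi N gc.1 (bcol t0 h gc.2) `|` hit N gc.1 (short_lived gc.2).

Definition bad_births (x : cyc d * cyc d * nat) : set Omega :=
  if x.1.1 == x.1.2 then set0
  else hit N x.1.1 (bcol t0 h x.2) `&` hit N x.1.2 (bcol t0 h x.2).

(** A birth in cell [x.2.1] together with the death, in that same cell, of a point born earlier, in
    cell [x.2.2]. *)
Definition bad_death (x : cyc d * cyc d * (nat * nat)) : set Omega :=
  if (x.2.1 < x.2.2)%N then
    hit N x.1.1 (bcol t0 h x.2.1) `&` hit N x.1.2 (reg t0 h x.2.2 x.2.1.+1)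
  else set0.

Let cells := iota 0 n0.

Definition collision : set Omega :=
  \big[setU/set0]_(gc <- allpairs pair L cells) bad_column gc `|`
  (\big[setU/set0]_(x <- allpairs pair (allpairs pair L L) cells) bad_births x `|`
   \big[setU/set0]_(x <- allpairs pair (allpairs pair L L) (allpairs pair cells cells))
      bad_death x).

Let W : R := \sum_(g <- L) w g.

Let sum_pairs (I J : eqType) (s : seq I) (t : seq J) (f : I -> R) (e : J -> R) :
  \sum_(x <- allpairs pair s t) (f x.1 * e x.2) = (\sum_(i <- s) f i) * (\sum_(j <- t) e j).
Proof.
rewrite big_allpairs_dep mulr_suml; apply: eq_bigr => i _.
by rewrite mulr_sumr.
Qed.

Let sum_cells (x : R) : \sum_(c <- cells) x = n0%:R * x.
Proof. by rewrite big_const_seq count_predT iter_addr_0 size_iota mulr_natl. Qed.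

Let w0 g : 0 <= w g. Proof. exact: weight_ge0. Qed.

(** Faulty columns and double births cost [h ^+ 2] for each of [n0] cells, a birth with a death
    costs [h ^+ 3] for each of [n0 ^ 2] pairs of cells. With the window [n0 * h] fixed, the total is
    of order [h]. *)
Lemma collision_small : measurable collision /\
  (P collision <= (h * ((n0%:R * h) * (\sum_(g <- L) (w g ^+ 2 + w g) + W ^+ 2)
                        + W ^+ 2 * (n0%:R * h) ^+ 2))%:E)%E.
Proof.
have fcol c := finite_massC t0 h c.
have fshort := finite_mass_short.
have freg c j := finite_mass_reg t0 h c j.
have h2 : 0 <= h ^+ 2 by rewrite exprn_ge0// ltW.
have mcol g c : mean alpha V g (bcol t0 h c) = w g * h by exact: mean_col.
have [||mA PA] := @P_bigsetU_le R _ Omega P _ (allpairs pair L cells) bad_column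
  (fun x => (w x.1 ^+ 2 + w x.1) * h ^+ 2).
- move=> x _; apply: measurableU; first exact: (measurable_multi ppp).
  exact: (measurable_hit_fin ppp).
- move=> x _; apply: le_trans (measureU2 _ _ _) _.
  + exact: (measurable_multi ppp).
  + exact: (measurable_hit_fin ppp).
  rewrite mulrDl EFinD; apply: leeD.
    by apply: le_trans (P_multi_le ppp _ (fcol _)) _; rewrite mcol exprMn.
  apply: le_trans (P_hit_le ppp _ (fshort _)) _.
  by rewrite lee_fin; exact: mean_short_le.
have [||mB PB] := @P_bigsetU_le R _ Omega P _ (allpairs pair (allpairs pair L L) cells)
  bad_births (fun x => (w x.1.1 * w x.1.2) * h ^+ 2).
- move=> x _; rewrite /bad_births; case: eqP => // _.
  by apply: measurableI; exact: (measurable_hit_fin ppp).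
- move=> x _; rewrite /bad_births; case: eqP => [_|/eqP ne].
    rewrite measure0 lee_fin; apply: mulr_ge0 => //; exact: mulr_ge0.
  apply: le_trans (P_hit2_le ppp (fcol _) (fcol _) (or_introl ne)) _.
  by rewrite !mcol lee_fin expr2 mulrACA.
have [||mC PC] := @P_bigsetU_le R _ Omega P _
  (allpairs pair (allpairs pair L L) (allpairs pair cells cells))
  bad_death (fun x => (w x.1.1 * w x.1.2) * (h ^+ 3)).
- move=> x _; rewrite /bad_death; case: ifP => // _.
  by apply: measurableI; exact: (measurable_hit_fin ppp).
- move=> [[g g'] [c c']] _; rewrite /bad_death /=; case: ifPn => [cc'|_]; last first.
    rewrite measure0 lee_fin; apply: mulr_ge0; first exact: mulr_ge0.
    by rewrite exprn_ge0// ltW.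
  have dis : bcol t0 h c `&` reg t0 h c' c.+1 = set0.
    rewrite -subset0 => p [cp [cp' _]]; move: cc'.
    by rewrite (cell_inj h0 cp cp') ltnn.
  apply: le_trans (P_hit2_le ppp (fcol _) (freg _ _) (or_intror dis)) _.
  rewrite mcol mean_reg// lee_fin /labw -/q.
  have p1 : (1 - q) ^+ (c' - c.+1) <= 1.
    by apply: exprn_ile1; rewrite ?gerBl// subr_ge0; case/andP: (q01 h0).
  have p0 : 0 <= (1 - q) ^+ (c' - c.+1).
    by apply: exprn_ge0; rewrite subr_ge0; case/andP: (q01 h0).
  have : q * (q * (1 - q) ^+ (c' - c.+1)) <= h * h.
    apply: ler_pM => //; first by rewrite mulr_ge0.
    by rewrite -[leRHS]mulr1 ler_pM.
  move=> hh; rewrite (_ : _ * _ = w g * w g' * h * (q * (q * (1 - q) ^+ (c' - c.+1)))); last by ring.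
  rewrite (_ : w g * w g' * h ^+ 3 = w g * w g' * h * (h * h)); last by ring.
  by rewrite ler_wpM2l// !mulr_ge0// ltW.
split; first by apply: measurableU => //; exact: measurableU.
have := leeD PA (leeD PB PC); rewrite -!EFinD.
rewrite (sum_pairs L cells (fun g => w g ^+ 2 + w g) (fun=> h ^+ 2)).
rewrite (sum_pairs (allpairs pair L L) cells (fun x => w x.1 * w x.2) (fun=> h ^+ 2)).
rewrite (sum_pairs (allpairs pair L L) (allpairs pair cells cells)
  (fun x => w x.1 * w x.2) (fun=> h ^+ 3)).
rewrite (sum_pairs L L w w) -/W.
have -> : \sum_(j <- allpairs pair cells cells) h ^+ 3 = n0%:R ^+ 2 * h ^+ 3.
  have := sum_pairs cells cells (fun=> 1) (fun=> h ^+ 3).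
  rewrite !sum_cells mulr1 => e; rewrite expr2 -mulrA -e.
  by apply: eq_bigr => x _; rewrite mul1r.
rewrite !sum_cells => le; apply: le_trans (le_trans _ le) _.
  apply: le_trans (measureU2 _ mA (measurableU _ _ mB mC)) _.
  by apply: leeD => //; exact: measureU2.
rewrite lee_fin le_eqVlt; apply/orP; left; apply/eqP; ring.
Qed.

End CollisionEvent.

(** * Agreement of the two constructions *)

Section NoCollision.
Variables (R : realType) (d : nat) (dO : measure_display).
Variables (Omega : measurableType dO) (N : Omega -> set (pt R d)).
Variables (t0 h : R) (L : seq (cyc d)) (n0 : nat) (om : Omega).
Hypothesis h0 : 0 < h.
Hypothesis nc : ~ collision N t0 h L n0 om.

Lemma bigsetUP (I : choiceType) (s : seq I) (F : I -> set Omega) i :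
  i \in s -> F i om -> (\big[setU/set0]_(i <- s) F i) om.
Proof. by move=> si Fi; rewrite -(bigcup_seq s F); exists i. Qed.

Lemma no_collision_single g c p : g \in L -> (c < n0)%N ->
  N om (g, p.1, p.2) -> cell t0 h c p.1 ->
  exists j, (j <= c)%N /\ single t0 h (N om) g c j.
Proof.
move=> gL cn Np cp.
have nb : ~ bad_column N t0 h (g, c) om.
  move=> b; apply: nc; left; apply: bigsetUP b; apply/allpairsP.
  by exists (g, c); rewrite mem_iota.
have [nm nh] : ~ multi N g (bcol t0 h c) om /\ ~ hit N g (short_lived t0 h c) om.
  by split=> b; apply: nb; [left|right].
have /contrapT [/has_card0 e|c1] := nm.
  by have : fiber (N om) g (bcol t0 h c) p by []; rewrite e.
have late : t0 - c%:R * h < p.1 + p.2.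
  by rewrite ltNge; apply/negP => le; apply: nh; exists p.
have [j jc rp] : exists2 j, (j <= c)%N & reg t0 h c j p.
  have [tp|pt] := ltP t0 (p.1 + p.2); first by exists 0%N.
  have [j cj] := cell_exists h0 pt; exists j.+1 => //.
  exact: (cell_lt_bound h0 cj late).
exists j; split => //; split.
  have /has_card1[x ex] := c1; apply/has_card1; exists p.
  have px : p = x.
    by have : fiber (N om) g (bcol t0 h c) p by []; rewrite [X in X p -> _]ex.
  apply/seteqP; split => [y [Ny [cy _]]|_ -> //].
  have : fiber (N om) g (bcol t0 h c) y by [].
  by rewrite [X in X y -> _]ex px.
apply/has_card0; rewrite -subset0 => y [Ny [cy nry]]; apply: nry.
have /has_card1[x ex] := c1.
have px : p = x.
  by have : fiber (N om) g (bcol t0 h c) p by []; rewrite [X in X p -> _]ex.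
have : fiber (N om) g (bcol t0 h c) y by [].
by rewrite [X in X y -> _]ex => /= ->; rewrite -px.
Qed.

Lemma no_collision_birth g g' c p p' : g \in L -> g' \in L -> (c < n0)%N ->
  g != g' -> N om (g, p.1, p.2) -> N om (g', p'.1, p'.2) ->
  cell t0 h c p.1 -> cell t0 h c p'.1 -> False.
Proof.
move=> gL gL' cn gg Np Np' cp cp'; apply: nc; right; left.
apply: (@bigsetUP _ _ _ (g, g', c)).
  apply/allpairsP; exists ((g, g'), c); rewrite mem_iota /=; split => //.
  by apply/allpairsP; exists (g, g').
rewrite /bad_births /= (negbTE gg); split; [by exists p|by exists p'].
Qed.

Lemma no_collision_death g g' c c' p p' : g \in L -> g' \in L ->
  (c < c')%N -> (c' < n0)%N -> N om (g, p.1, p.2) -> N om (g', p'.1, p'.2) ->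
  cell t0 h c p.1 -> reg t0 h c' c.+1 p' -> False.
Proof.
move=> gL gL' cc' cn' Np Np' cp rp'; apply: nc; right; right.
apply: (@bigsetUP _ _ _ ((g, g'), (c, c'))).
  apply/allpairsP; exists ((g, g'), (c, c')); split => //=.
    by apply/allpairsP; exists (g, g').
  apply/allpairsP; exists (c, c'); rewrite !mem_iota /= cn' (ltn_trans cc')//.
rewrite /bad_death /= cc'; split; [by exists p|by exists p'].
Qed.

End NoCollision.

(** * Sets measurable up to a null set *)

Section MeasurableVersion.
Variables (R : realType) (dO : measure_display) (Omega : measurableType dO).
Variable P : probability Omega R.

Lemma small_null (X : set Omega) :
  (forall e : R, 0 < e -> (P X <= e%:E)%E) -> P X = 0%E.
Proof.
move=> h; apply/eqP; rewrite eq_le measure_ge0 andbT.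
by apply/lee_addgt0Pr => e e0; rewrite add0e; exact: h.
Qed.

(** Take the approximations [B_k] with error sets [C_k] of probability at most [1 / (k + 1)], and
    let [B] be the union of the [B_k] minus [C_k]. Outside [Z], [B] lies in [E], and a point of [E]
    missed by [B] lies in every [C_k]. *)
Lemma measurable_version (E Z : set Omega) : P.-negligible Z ->
  (forall e : R, 0 < e -> exists B C, [/\ measurable B, measurable C,
     (P C <= e%:E)%E & (E `\` B) `|` (B `\` E) `<=` C `|` Z]) ->
  exists B, measurable B /\ P.-negligible ((E `\` B) `|` (B `\` E)).
Proof.
move=> nZ H.
have H' k : exists BC : set Omega * set Omega, [/\ measurable BC.1, measurable BC.2,
     (P BC.2 <= (k.+1%:R^-1)%:E)%E & (E `\` BC.1) `|` (BC.1 `\` E) `<=` BC.2 `|` Z].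
  have [|B [C [h1 h2 h3 h4]]] := H k.+1%:R^-1; first by rewrite invr_gt0.
  by exists (B, C).
have [F FP] := choice H'.
pose B := \bigcup_k ((F k).1 `\` (F k).2).
have mB : measurable B.
  by apply: bigcup_measurable => k _; have [? ? _ _] := FP k; exact: measurableD.
have mC : measurable (\bigcap_k (F k).2).
  by apply: bigcap_measurable => // k _; have [] := FP k.
exists B; split => //.
apply: (negligibleS (A := (\bigcap_k (F k).2) `|` Z)); last first.
  apply: negligibleU => //; apply/negligibleP => //; apply: small_null => e e0.
  pose k := Num.truncn e^-1.
  have [_ mk le _] := FP k.
  apply: (@le_trans _ _ (P (F k).2)).
    by apply: le_measure; rewrite ?inE// => om; exact.
  apply: le_trans le _; rewrite lee_fin -[leRHS]invrK lef_pV2 ?posrE ?invr_gt0//.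
  exact/ltW/truncnS_gt.
move=> om [[Eom nB]|[[k _ [B1 nC]] nE]].
  have [Zom|nZom] := pselect (Z om); [by right|left => k _].
  apply: contrapT => nC; have [_ _ _ sub] := FP k.
  have [B1|nB1] := pselect ((F k).1 om); first by apply: nB; exists k.
  by have [] : ((F k).2 `|` Z) om by apply: sub; left.
have [_ _ _ sub] := FP k.
by have [//|Zom] : ((F k).2 `|` Z) om; [by apply: sub; right|right].
Qed.

End MeasurableVersion.

Section Agreement.
Variables (R : realType) (d : nat) (alpha : R) (V : site d -> \bar R).
Variables (dO : measure_display) (Omega : measurableType dO) (P : probability Omega R).
Variable N : Omega -> set (pt R d).
Hypothesis ppp : is_PPP alpha V P N.
Hypothesis fin_clan : {ae P, forall om, forall phi, N om phi -> finite_set (clan (N om) phi)}.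
Variable t0 : R.

Definition infinite_clan : set Omega :=
  ~` [set om | forall phi, N om phi -> finite_set (clan (N om) phi)].

Lemma outcome_agrees (S gs : seq (cyc d)) (m M n : nat) om sigma
    (A : (cyc d -> bool) -> Prop) :
  (0 < m)%N -> (0 < M)%N -> (m * M <= n)%N ->
  {subset S <= first_cycles d m} -> {subset first_cycles d m <= gs} ->
  ~ exits N t0 S m om ->
  ~ collision N t0 (M%:R^-1) (first_cycles d m) (m * M) om ->
  ~ infinite_clan om ->
  (forall eta eta', (forall g, g \in S -> eta g = eta' g) -> A eta -> A eta') ->
  (forall g j, sigma g = Some j -> forall g', g' \in first_cycles d m ->
     incompat g g' -> (m * M <= j)%N) ->
  outcome (@incompat d) (first_cycles d m) n (records N t0 M%:R^-1 gs om) sigma A ->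
  A (eta_at (N om) t0).
Proof.
move=> m0 M0 mn SL Lgs nex nco /contrapT fc Aloc st.
have h0 : 0 < M%:R^-1 :> R by rewrite invr_gt0 ltr0n.
apply: (outcome_eta_at h0 SL Lgs _ mn) => //.
- by rewrite muln_gt0 m0.
- move=> phi r; have nphi := reach_sub r; split; last exact: fc.
    by apply: contrapT => /negP nL; apply: nex; exists phi; split => // /idPn.
  (* The [m * M] cells of length [1 / M] cover exactly the time window [m] of [exits]. *)
  rewrite natrM mulfK ?pnatr_eq0 -?lt0n// ltNge; apply/negP => le.
  by apply: nex; exists phi.
- by move=> g c p; exact: no_collision_single.
- by move=> g g' c p p'; exact: no_collision_birth.
- by move=> g g' c c' p p'; exact: no_collision_death.
Qed.

Lemma collision_vanishes (m : nat) (e : R) : 0 < e -> exists M0, forall M,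
  (M0 < M)%N -> measurable (collision N t0 (M%:R^-1) (first_cycles d m) (m * M)) /\
  (P (collision N t0 (M%:R^-1) (first_cycles d m) (m * M)) <= e%:E)%E.
Proof.
move=> e0; pose L := first_cycles d m; pose w := weight alpha V.
pose K : R := m%:R * (\sum_(g <- L) (w g ^+ 2 + w g) + (\sum_(g <- L) w g) ^+ 2)
   + (\sum_(g <- L) w g) ^+ 2 * m%:R ^+ 2.
exists (Num.truncn (`|K| / e)) => M MM.
have M0 : 0 < M%:R :> R by rewrite ltr0n (leq_trans _ MM).
have h0 : 0 < M%:R^-1 :> R by rewrite invr_gt0.
have [mC le] := collision_small ppp t0 L (m * M) h0; split => //.
apply: le_trans le _; rewrite lee_fin natrM mulfK ?gt_eqF// -/K.
apply: (@le_trans _ _ (M%:R^-1 * `|K|)).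
  by rewrite ler_wpM2l ?ler_norm// ltW.
rewrite mulrC ler_pdivrMr// mulrC -ler_pdivrMr//.
apply: ltW; apply: lt_le_trans (truncnS_gt _) _; by rewrite ler_nat.
Qed.

(** The window [m] is chosen before the mesh, because the collision bound grows with [m]. *)
Lemma good_scale (S : seq (cyc d)) (e : R) : 0 < e -> exists m, [/\ (0 < m)%N,
  {subset S <= first_cycles d m} & exists M0, forall M, (M0 < M)%N ->
    let C := exits N t0 S m `|` collision N t0 (M%:R^-1) (first_cycles d m) (m * M) in
    measurable C /\ (P C <= e%:E)%E].
Proof.
move=> e0; have e2 : 0 < e / 2 by rewrite divr_gt0.
have [m1 h1] := exits_small ppp t0 S fin_clan e2.
have [m2 h2] := first_cycles_seq S.
pose m := maxn 1 (maxn m1 m2); exists m; split.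
- by rewrite leq_max.
- move=> g /h2; apply: first_cycles_le; by rewrite !leq_max leqnn !orbT.
have [M0 hM] := collision_vanishes m e2; exists M0 => M /hM[mC PC] /=.
have mE : measurable (exits N t0 S m) by exact: (measurable_exits ppp).
split; first exact: measurableU.
apply: le_trans (measureU2 _ mE mC) _.
rewrite (splitr e) EFinD leeD// h1// /m !leq_max leqnn !orbT//.
Qed.

(** Approximate the event by discrete outcomes started from the empty configuration, which are
    measurable. *)
Lemma eta_version g : exists B, measurable B /\ P.-negligible
  (([set om | eta_at (N om) t0 g] `\` B) `|` (B `\` [set om | eta_at (N om) t0 g])).
Proof.
apply: (@measurable_version _ _ _ P _ infinite_clan); first exact: fin_clan.
move=> e e0; have [m [m0 Sm [M0 hM]]] := good_scale [:: g] e0.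
have [mC PC] := hM M0.+1 (leqnn _).
set L := first_cycles d m in Sm mC PC *.
set h : R := M0.+1%:R^-1 in mC PC *.
have h0 : 0 < h by rewrite invr_gt0 ltr0n.
pose A (eta : cyc d -> bool) := eta g : Prop.
have [mB _] := adv_prob_records ppp t0 h0 (first_cycles_uniq d m) L (m * M0.+1) (fun=> None) A.
set B := [set om | _] in mB.
set C := _ `|` _ in mC PC.
exists B, C; split => // om.
have [|nC] := pselect (C om); first by move=> Com _; left.
have [|nZ] := pselect (infinite_clan om); first by move=> Z _; right.
have [nex nco] : ~ exits N t0 [:: g] m om /\ ~ collision N t0 h L (m * M0.+1) om.
  by split => b; apply: nC; [left|right].
have ok A' := @outcome_agrees [:: g] L m M0.+1 (m * M0.+1) om (fun=> None) A'
  m0 isT (leqnn _) Sm (fun g' h' => h') nex nco nZ.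
move=> [[/= Eom nB]|[Bom nE]].
  (* If [A] is out of reach, some run ends in its complement, and agreement applies to that
     event. *)
  have [//|oc] := outcome_total (@incompat d) L (m * M0.+1)
    (records N t0 h L om) (fun=> None) A.
  exfalso; have : ~ A (eta_at (N om) t0); last by [].
  by apply: (ok (fun eta => ~ A eta)) oc => // eta eta' /(_ g (mem_head _ _)); rewrite /A => ->.
exfalso; apply: nE; apply: (ok A) Bom => // eta eta' /(_ g (mem_head _ _)).
by rewrite /A => ->.
Qed.

End Agreement.

(** * Local events and blocked cycles *)

Section Configurations.
Variable d : nat.
Implicit Types (eta : cyc_conf d) (S L : seq (cyc d)).

Definition depends_on (T : Type) S (f : cyc_conf d -> T) : Prop :=
  forall eta eta', (forall g, g \in S -> eta g = eta' g) -> f eta = f eta'.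

Lemma measurable_coord (g : cyc d) (b : bool) :
  measurable [set eta : config d | eta g = b].
Proof. by apply: sub_sigma_algebra; exists g, b. Qed.

(** Splitting on the coordinates in [S] one at a time leaves finitely many values of [f], so [Y] may
    be arbitrary. *)
Lemma measurable_preimage (T : Type) S (f : cyc_conf d -> T) (Y : set T) :
  depends_on S f -> measurable [set eta : config d | Y (f eta)].
Proof.
elim: S f => [|g S IH] f fS.
  have fc eta : f eta = f (fun=> false) by exact: fS.
  have [y|ny] := pselect (Y (f (fun=> false))).
    rewrite (_ : [set eta | _] = setT)//; apply/seteqP; split => // eta _ /=.
    by rewrite fc.
  rewrite (_ : [set eta | _] = set0)//; apply/seteqP; split => // eta /=.
  by rewrite fc.
pose f_ b eta := f (upd eta g b).
have fb b : depends_on S (f_ b).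
  move=> eta eta' e; apply: fS => g'; rewrite inE /upd.
  by case: eqP => //= _ /e.
have fE eta : f eta = f_ (eta g) eta.
  by apply: fS => g' _; rewrite /upd; case: eqP => [->|].
rewrite (_ : [set eta | _] =
   ([set eta : config d | eta g = true] `&` [set eta : config d | Y (f_ true eta)]) `|`
   ([set eta : config d | eta g = false] `&` [set eta : config d | Y (f_ false eta)])).
  by apply: measurableU; apply: measurableI; (try exact: measurable_coord); exact: IH.
apply/seteqP; split => eta /=.
  by rewrite fE; case e : (eta g); [left|right].
by move=> [[e]|[e]]; rewrite fE e.
Qed.

Lemma measurable_compat (g : cyc d) :
  measurable [set eta : config d | compat_conf g eta].
Proof.
rewrite (_ : [set eta | _] = ~` \bigcup_g' (if `[< incompat g g' >]
    then [set eta : config d | eta g' = true] else set0)).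
  apply: measurableC; apply: countable_bigcupT_measurable; first exact: countableP.
  by move=> g'; case: ifP => // _; exact: measurable_coord.
apply/seteqP; split => eta.
  by move=> /asboolP h [g' _]; case: asboolP => // ig /h.
by move=> h; apply/asboolP => g' eg ig; apply: h; exists g' => //; case: asboolP.
Qed.

Lemma measurable_finite_cycle_confs : measurable (finite_cycle_confs d).
Proof.
rewrite (_ : finite_cycle_confs d = ~` \bigcup_g \bigcup_g'
   (if `[< g != g' /\ incompat g g' >] then
    [set eta : config d | eta g = true] `&` [set eta : config d | eta g' = true]
    else set0)).
  apply: measurableC; apply: countable_bigcupT_measurable; first exact: countableP.
  move=> g; apply: countable_bigcupT_measurable; first exact: countableP.
  move=> g'; case: ifP => // _; apply: measurableI; exact: measurable_coord.
apply/seteqP; split => eta.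
  move=> h [g _ [g' _]]; case: asboolP => // -[gg ig] [e e']; exact: h ig.
move=> h g g' e e' gg ig; apply: h; exists g => //; exists g' => //.
by case: asboolP => // -[]; split.
Qed.

Definition sites_of L : seq (site d) := flatten [seq val g | g <- L].

Lemma sites_ofP L x : reflect (exists2 g, g \in L & x \in val g) (x \in sites_of L).
Proof. exact: flatten_mapP. Qed.

Definition near_list L (g : cyc d) : bool := `[< exists2 g', g' \in L & incompat g g' >].

Lemma near_site L g : near_list L g -> exists x, x \in val g /\ x \in sites_of L.
Proof.
by move=> /asboolP[g' gL [x [xg xg']]]; exists x; split => //; apply/sites_ofP; exists g'.
Qed.

(** Choose for each such cycle a site shared with [L]; disjointness makes the choice injective. The
    bound does not involve [gs]. *)
Lemma near_count gs L eta : uniq gs -> finite_cycle_confs d eta ->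
  (count (fun g => eta g && near_list L g) gs <= size (sites_of L))%N.
Proof.
move=> ugs feta; rewrite -size_filter; set l := (X in (size X <= _)%N).
have ns g : exists x, g \in l -> x \in val g /\ x \in sites_of L.
  case: (boolP (g \in l)) => [|_]; last by exists 0.
  by rewrite mem_filter => /andP[/andP[_ /near_site[x hx]] _]; exists x.
have [f fP] := choice ns.
rewrite -(size_map f); apply: uniq_leq_size.
  rewrite map_inj_in_uniq ?filter_uniq// => g g' gl gl' e.
  apply: contrapT => /eqP gg.
  have eg : eta g by move: gl; rewrite mem_filter => /andP[/andP[]].
  have eg' : eta g' by move: gl'; rewrite mem_filter => /andP[/andP[]].
  apply: (feta g g' eg eg' gg); exists (f g); split.
    by have [] := fP g gl.
  by rewrite e; have [] := fP g' gl'.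
by move=> x /mapP[g gl ->]; have [] := fP g gl.
Qed.

Definition blocked_outside L m : set (config d) :=
  [set eta | exists g, g \notin first_cycles d m /\ near_list L g /\ eta g].

Lemma measurable_blocked_outside L m : measurable (blocked_outside L m).
Proof.
rewrite (_ : blocked_outside L m = \bigcup_g
    (if (g \notin first_cycles d m) && near_list L g
     then [set eta : config d | eta g = true] else set0)).
  apply: countable_bigcupT_measurable; first exact: countableP.
  by move=> g; case: ifP => // _; exact: measurable_coord.
apply/seteqP; split => eta.
  by move=> [g [h1 [h2 h3]]]; exists g => //; rewrite h1 h2.
by move=> [g _]; case: ifP => // /andP[h1 h2] h3; exists g.
Qed.

Lemma blocked_outsideS L m : blocked_outside L m.+1 `<=` blocked_outside L m.
Proof.
move=> eta [g [h1 h2]]; exists g; split => //.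
by apply: contraNN h1; exact: first_cycles_le.
Qed.

(** Each of the finitely many sites of [L] lies in at most one present cycle, so one [m] captures
    all present cycles near [L]. *)
Lemma blocked_outside_cap L :
  \bigcap_m blocked_outside L m `&` finite_cycle_confs d = set0.
Proof.
rewrite -subset0 => eta [bo fe].
have [m hm] : exists m, forall g, eta g -> (exists x, x \in val g /\ x \in sites_of L) ->
    g \in first_cycles d m.
  elim: (sites_of L) => [|x s [m IH]]; first by exists 0%N => g _ [x []].
  have [[g [eg xg]]|ng] := pselect (exists g, eta g /\ x \in val g).
    exists (maxn m (pickle g).+1) => g' eg' [y [yg']].
    rewrite inE => /predU1P[e|ys].
      rewrite e in yg'; have [->|gg] := eqVneq g' g.
        by apply: mem_first_cycles; rewrite leq_maxr.
      by exfalso; apply: (fe g' g eg' eg gg); exists x.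
    by apply: (first_cycles_le (leq_maxl _ _)); apply: IH => //; exists y.
  exists m => g eg [y [yg]]; rewrite inE => /predU1P[e|ys].
    by exfalso; apply: ng; exists g; rewrite -e.
  by apply: IH => //; exists y.
have [g [gm [/near_site ns eg]]] := bo m I.
by move/negP: gm; apply; exact: hm.
Qed.

End Configurations.

(** * The invariant measure *)

Section InvariantMeasure.
Variables (R : realType) (d : nat) (alpha : R) (V : site d -> \bar R).
Variable nu : probability (config d) R.
Hypothesis inv : L_invariant alpha V nu.

Local Notation w := (weight alpha V).

Lemma measurable_depends_on (S : seq (cyc d)) (f : config d -> R) :
  depends_on S f -> measurable_fun setT f.
Proof. by move=> fS _ Y mY; rewrite setTI; exact: measurable_preimage fS. Qed.

Lemma bounded_integrable (f : config d -> R) (M : R) :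
  measurable_fun setT f -> (forall eta, `|f eta| <= M) ->
  nu.-integrable setT (EFin \o f).
Proof.
move=> mf fM; apply: measurable_bounded_integrable => //.
  apply: le_lt_trans (probability_le1 nu measurableT) _; exact: ltry.
exists M; split; first exact: num_real.
by move=> x Mx eta _; apply: le_trans (fM eta) _; exact: ltW.
Qed.

Lemma indic_asbool (T : Type) (X : set T) x : \1_X x = (`[< X x >])%:R :> R.
Proof. by rewrite indicE; congr (_%:R); apply/idP/asboolP; rewrite in_setE. Qed.

Lemma Rintegral_asbool (X : set (config d)) : measurable X ->
  \int[nu]_eta (`[< X eta >])%:R = fine (nu X).
Proof.
move=> mX; rewrite /Rintegral.
under eq_integral do rewrite -indic_asbool.
by rewrite integral_indic// setIT.
Qed.

(** Jumps at cycles outside [gs] do not change [f], so the sum over all cycles is finite. *)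
Lemma loss_generatorE (gs : seq (cyc d)) (f : cyc_conf d -> R) eta :
  uniq gs -> depends_on gs f -> loss_generator alpha V f eta =
  \sum_(g <- gs) (w g * (compat_conf g eta)%:R * (f (upd eta g true) - f eta)
                 + (eta g)%:R * (f (upd eta g false) - f eta)).
Proof.
move=> ugs fgs; rewrite /loss_generator.
rewrite (_ : [set: cyc d] = [set` predT]); last by apply/seteqP; split.
rewrite -(bigfs _ ugs)// => g _ ggs.
have e b : f (upd eta g b) = f eta.
  apply: fgs => g' gs'; rewrite /upd; case: eqP => // e.
  by rewrite -e gs' in ggs.
by rewrite [conf_add _ _](_ : _ = upd eta g true)// [conf_rem _ _](_ : _ = upd eta g false)//
  !e subrr !mulr0 addr0.
Qed.

Variables (h : R) (m : nat) (L : seq (cyc d)) (A : (cyc d -> bool) -> Prop).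
Hypotheses (h0 : 0 < h) (uL : uniq L).
Let gs := first_cycles d m.
Hypothesis Lgs : {subset L <= gs}.
Let q : R := 1 - expR (- h).
Let a := birth_rate alpha V h.
Let k : R := (size gs)%:R.
Let W : R := \sum_(g <- gs) w g.
Let WL : R := \sum_(g <- L) w g.
Hypothesis small : (k + W) * h <= 1.

Let u n := adv_fun (@incompat d) gs L q a A n : cyc_conf d -> R.

Let w0 g : 0 <= w g. Proof. exact: weight_ge0. Qed.
Let q0 : 0 <= q. Proof. by case/andP: (q01 h0). Qed.
Let qh : q <= h.
Proof. by have := expR_ge1Dx (- h); rewrite /q; lra. Qed.

Let a0 g : 0 <= a g.
Proof. by rewrite /a /birth_rate !mulr_ge0// expR_ge0. Qed.

Let aq g : a g <= q * w g.
Proof.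
rewrite /a /birth_rate ler_piMr ?mulr_ge0// -expR0 ler_expR oppr_le0.
by rewrite mulr_ge0// ltW.
Qed.

Let a1 g : a g <= 1.
Proof.
apply: (@le_trans _ _ (expR (w g * h) * expR (- (w g * h)))).
  rewrite /a /birth_rate ler_wpM2r ?expR_ge0//.
  apply: (@le_trans _ _ (w g * h)); first by rewrite mulrC ler_wpM2l.
  by have := expR_ge1Dx (w g * h); lra.
by rewrite -expRD subrr expR0.
Qed.

Lemma birth_rate01 g : 0 <= birth_rate alpha V h g <= 1.
Proof. by rewrite a0 a1. Qed.

Let a01 := birth_rate01.

Let drift g : q * w g - a g <= w g ^+ 2 * h ^+ 2.
Proof.
rewrite /a /birth_rate -/q -{1}[q * w g]mulr1 -mulrBr.
have e : 1 - expR (- (w g * h)) <= w g * h by have := expR_ge1Dx (- (w g * h)); lra.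
have e0 : 0 <= 1 - expR (- (w g * h)).
  by rewrite subr_ge0 -expR0 ler_expR oppr_le0 mulr_ge0// ltW.
apply: (@le_trans _ _ (h * w g * (w g * h))).
  by apply: ler_pM => //; [exact: mulr_ge0|exact: ler_wpM2r].
by rewrite le_eqVlt; apply/orP; left; apply/eqP; ring.
Qed.

Let W0 : 0 <= W. Proof. exact: sumr_ge0. Qed.
Let k0 : 0 <= k. Proof. by []. Qed.

Let sum_a : \sum_(g <- gs) a g <= W * h.
Proof.
rewrite mulr_suml; apply: ler_sum => g _; apply: le_trans (aq g) _.
by rewrite mulrC ler_wpM2l.
Qed.

Let u01 n eta : 0 <= u n eta <= 1.
Proof. by apply: adv_fun01; [exact: (q01 h0)|exact: a01]. Qed.

Let u_dep n : depends_on gs (u n).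
Proof. by move=> eta eta' e; exact: adv_fun_ext. Qed.

Let bd (eta : config d) : bool := `[< blocked_outside L m eta >].

Let step n (eta : config d) : u n eta + q * loss_generator alpha V (u n) eta <=
  u n.+1 eta + h ^+ 2 * (\sum_(g <- gs) w g ^+ 2 + (k + W) ^+ 2)
  + h * WL * (bd eta)%:R.
Proof.
rewrite (loss_generatorE _ (first_cycles_uniq d m) (u_dep n)).
have kq1 : k * q <= 1.
  apply: le_trans small; apply: (@le_trans _ _ (k * h)); first by rewrite ler_wpM2l.
  by apply: ler_wpM2r; [exact: ltW|rewrite lerDl].
have al1 : \sum_(g <- gs) a g <= 1.
  apply: le_trans sum_a (le_trans _ small).
  by apply: ler_wpM2r; [exact: ltW|rewrite lerDr].
have := @adv_fun_step R (cyc d) (@incompat d) gs L q a w A n eta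
  (fun g => compat_conf g eta) (bd eta) (first_cycles_uniq d m) (q01 h0) a0 aq
  (@incompat_refl d) _ _ kq1 al1 a01.
rewrite -/gs => H; apply: le_trans (H _ _) _.
- by move=> g /asboolP cp g' /cp.
- move=> g gL /asboolP nc /asboolP nb.
  have /existsNP[g' /not_implyP[eg' /contrapT ig]] := nc.
  exists g'; split => //; apply: contrapT => /negP ng'; apply: nb.
  exists g'; split => //; split => //; apply/asboolP; exists g => //.
  exact: incompat_sym.
rewrite -!addrA lerD2l [h ^+ 2 * _]mulrDr !addrA; apply: lerD; first apply: lerD.
- rewrite mulr_sumr; apply: ler_sum => g _; rewrite [leRHS]mulrC; exact: drift.
- rewrite -exprMn; apply: lerXn2r.
  + by rewrite nnegrE addr_ge0 ?sumr_ge0// mulr_ge0.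
  + by rewrite nnegrE mulr_ge0 ?addr_ge0// ltW.
  rewrite [leRHS]mulrC mulrDl; apply: lerD; last exact: sum_a.
  exact: ler_wpM2l.
- rewrite [leLHS]mulrC; apply: ler_wpM2r => //; apply: ler_pM => //.
    exact: sumr_ge0.
  rewrite -big_filter le_eqVlt; apply/orP; left; apply/eqP/perm_big.
  apply: uniq_perm => //; first by rewrite filter_uniq// first_cycles_uniq.
  by move=> g; rewrite mem_filter; case: (boolP (g \in L)) => // /Lgs ->.
Qed.

Let u_int n : nu.-integrable setT (EFin \o u n).
Proof.
apply: (@bounded_integrable _ 1); first exact: measurable_depends_on (u_dep n).
by move=> eta; have /andP[u0 u1] := u01 n eta; rewrite ger0_norm.
Qed.

Let upd_dep n g b : depends_on gs (fun eta => u n (upd eta g b)).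
Proof.
by move=> eta eta' e; apply: u_dep => g' gg'; rewrite /upd; case: eqP => // _; exact: e.
Qed.

Let measurable_bool_indic (X : set (config d)) : measurable X ->
  measurable_fun setT (fun eta => (`[< X eta >])%:R : R).
Proof.
move=> mX; rewrite (_ : (fun eta => _) = \1_X); first exact: measurable_indic.
by apply/funext => eta; rewrite indic_asbool.
Qed.

Let gen_int n : nu.-integrable setT (EFin \o loss_generator alpha V (u n)).
Proof.
have e eta := loss_generatorE eta (first_cycles_uniq d m) (u_dep n).
apply: (@bounded_integrable _ (\sum_(g <- gs) (w g + 1))).
  rewrite (_ : loss_generator _ _ _ = fun eta => \sum_(g <- gs)
    (w g * (compat_conf g eta)%:R * (u n (upd eta g true) - u n eta)
      + (eta g)%:R * (u n (upd eta g false) - u n eta))); last exact/funext.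
  apply: measurable_sum => g; apply: measurable_funD; apply: measurable_funM.
  - apply: measurable_funM => //.
    rewrite (_ : (fun eta => _) = (fun eta : config d => (`[< [set eta : config d | compat_conf g eta] eta >])%:R)).
      exact: measurable_bool_indic (measurable_compat g).
    by apply/funext => eta; rewrite asboolb.
  - by apply: measurable_funB; apply: measurable_depends_on; [exact: upd_dep|exact: u_dep].
  - apply: (@measurable_depends_on [:: g]) => eta eta' ee.
    by rewrite ee// mem_head.
  - by apply: measurable_funB; apply: measurable_depends_on; [exact: upd_dep|exact: u_dep].
move=> eta; rewrite e; apply: le_trans (ler_norm_sum _ _ _) _.
have du eta' eta'' : `|u n eta' - u n eta''| <= 1.
  have /andP[x0 x1] := u01 n eta'; have /andP[y0 y1] := u01 n eta''.
  by rewrite ler_norml; apply/andP; split; lra.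
apply: ler_sum => g _; apply: le_trans (ler_normD _ _) _; apply: lerD.
  rewrite !normrM (ger0_norm (w0 g)) -mulrA ler_piMr//.
  by apply: mulr_ile1 => //; rewrite ger0_norm// lern1 leq_b1.
rewrite normrM; apply: mulr_ile1 => //.
by rewrite ger0_norm// lern1 leq_b1.
Qed.

(** Here invariance enters: [u n] is local, so its generator integrates to 0. *)
Lemma adv_integral_step n :
  \int[nu]_eta u n eta <= \int[nu]_eta u n.+1 eta
    + h ^+ 2 * (\sum_(g <- gs) w g ^+ 2 + (k + W) ^+ 2)
    + h * WL * fine (nu (blocked_outside L m)).
Proof.
have gen0 : \int[nu]_eta loss_generator alpha V (u n) eta = 0.
  by rewrite /Rintegral inv//; exists gs; exact: u_dep.
have bd_int : nu.-integrable setT (EFin \o (fun eta => (bd eta)%:R : R)).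
  apply: (@bounded_integrable _ 1).
    exact: measurable_bool_indic (measurable_blocked_outside L m).
  by move=> eta; rewrite ger0_norm// lern1 leq_b1.
have cst_int c : nu.-integrable setT (EFin \o (fun=> c : R)).
  by apply: (@bounded_integrable _ `|c|).
have scale_int c f : nu.-integrable setT (EFin \o f) ->
    nu.-integrable setT (EFin \o (fun eta => c * f eta : R)).
  by move=> fi; exact: (integrableZl measurableT c fi).
have add_int f1 f2 : nu.-integrable setT (EFin \o f1) ->
    nu.-integrable setT (EFin \o f2) ->
    nu.-integrable setT (EFin \o (fun eta => f1 eta + f2 eta : R)).
  by move=> i1 i2; exact: (integrableD measurableT i1 i2).
have := @le_Rintegral _ _ R nu setT _ _ measurableT
  (add_int _ _ (u_int n) (scale_int q _ (gen_int n)))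
  (add_int _ _ (add_int _ _ (u_int n.+1) (cst_int _)) (scale_int (h * WL) _ bd_int))
  (fun eta _ => step n eta).
rewrite RintegralD//; last exact: scale_int.
rewrite RintegralZl// gen0 mulr0 addr0.
rewrite RintegralD//; [|exact: add_int|exact: scale_int].
rewrite RintegralD// Rintegral_cst// [fine (nu setT)](_ : _ = 1); last first.
  by rewrite probability_setT.
rewrite RintegralZl// mulr1 Rintegral_asbool//.
exact: measurable_blocked_outside.
Qed.

End InvariantMeasure.

(** * Bounds on the adversarial probability *)

Section AdversarialBounds.
Variables (R : realType) (d : nat) (gs L S : seq (cyc d)) (q : R) (a : cyc d -> R).
Variable A : (cyc d -> bool) -> Prop.
Hypotheses (ugs : uniq gs) (q01 : 0 <= q <= 1) (a01 : forall g, 0 <= a g <= 1).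

Lemma adv_fun_zero eta : {subset S <= gs} -> depends_on S A ->
  adv_fun (@incompat d) gs L q a A 0 eta = (`[< A eta >])%:R.
Proof.
move=> Sgs AS; have dl (g : cyc d) : is_dist (lab q 0) by exact: is_dist_lab.
have zero (D : cyc d -> nat) : (forall g, g \in gs -> D g == 0%N) ->
    adv_prob (@incompat d) gs L q a A 0 (start gs eta D) = (`[< A eta >])%:R.
  move=> D0; rewrite /adv_prob /=.
  rewrite (AS (fun g => start gs eta D g == Some 0%N) eta)// => g /Sgs gS.
  by rewrite /start gS; case: (eta g) => //=; rewrite (eqP (D0 g gS)).
rewrite -[RHS](pexpect_cst 0%N dl gs).
apply/eqP; rewrite eq_le; apply/andP; split;
  by apply: (@pexpect_le _ _ _ _ _ dl _ (fun _ j => j == 0%N)) => // D /zero ->.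
Qed.

(** Union bound over the initial cycles near [L] that survive into the last [n0] cells; [near_count]
    bounds their number and [lab_lt] the probability for each. *)
Lemma adv_fun_le n n0 p (eta : cyc_conf d) : (n0 <= n)%N -> 0 <= p ->
  finite_cycle_confs d eta ->
  (forall D, (forall g, g \in gs -> eta g -> near_list L g -> (n0 <= D g)%N) ->
     adv_prob (@incompat d) gs L q a A n (start gs eta D) <= p) ->
  adv_fun (@incompat d) gs L q a A n eta <=
    (size (sites_of L))%:R * (1 - q) ^+ (n - n0) + p.
Proof.
move=> n0n p0 feta H; have dl (g : cyc d) : is_dist (lab q n) by exact: is_dist_lab.
pose ind g : R := (eta g && near_list L g)%:R.
have r0 : 0 <= 1 - q by rewrite subr_ge0; case/andP: q01.
apply: (@le_trans _ _ (pexpect gs (fun=> lab q n) 0%N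
    (fun D => (\sum_(g <- gs) ind g * (D g < n0)%:R) + p))).
  apply: pexpect_mono => // D; have sum0 : 0 <= \sum_(g <- gs) ind g * (D g < n0)%:R.
    by apply: sumr_ge0 => g _; rewrite mulr_ge0 /ind.
  have [ok|] := pselect (forall g, g \in gs -> eta g -> near_list L g -> (n0 <= D g)%N).
    by apply: le_trans (H D ok) _; rewrite lerDr.
  move=> /existsNP[g /not_implyP[ggs /not_implyP[eg /not_implyP[ng /negP Dg]]]].
  rewrite -ltnNge in Dg.
  apply: (@le_trans _ _ 1).
    by case/andP: (adv_prob01 (@incompat d) gs L q01 a01 A n (start gs eta D)).
  apply: (@le_trans _ _ (\sum_(g <- gs) ind g * (D g < n0)%:R)); last by rewrite lerDl.
  rewrite (big_rem g)//= {1}/ind eg ng Dg mulr1 lerDl.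
  by apply: sumr_ge0 => g' _; rewrite mulr_ge0 /ind.
rewrite (pexpectD 0%N (fun=> lab q n) gs _ (fun=> p)) (pexpect_cst 0%N dl) lerD2r.
rewrite (pexpect_sum 0%N dl gs gs (fun g D => ind g * (D g < n0)%:R)).
apply: (@le_trans _ _ (\sum_(g <- gs) ind g * (1 - q) ^+ (n - n0))).
  rewrite big_seq [leRHS]big_seq; apply: ler_sum => g ggs.
  rewrite pexpectZ ler_wpM2l /ind//.
  rewrite (pexpect_marginal 0%N dl (fun j => (j < n0)%:R) ugs ggs); exact: lab_lt.
rewrite -mulr_suml ler_wpM2r ?exprn_ge0//.
apply: (@le_trans _ _ ((count (fun g => eta g && near_list L g) gs)%:R)).
  by rewrite -sum1_count natr_sum [leRHS]big_mkcond; apply: ler_sum => g _; rewrite /ind; case: ifP.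
by rewrite ler_nat; exact: near_count.
Qed.

End AdversarialBounds.

(** * From one-sided bounds on local events to equality of laws *)

Section Uniqueness.
Variables (R : realType) (d : nat).
Variables (dO : measure_display) (Omega : measurableType dO) (P : probability Omega R).
Variable nu : probability (config d) R.
Variable X : Omega -> config d.

Definition local_events : set (set (config d)) :=
  [set A | exists S : seq (cyc d), depends_on S (A : cyc_conf d -> Prop)].

Lemma measurable_local (A : set (config d)) : local_events A -> measurable A.
Proof. by move=> [S AS]; exact: (@measurable_preimage d Prop S A [set Q | Q] AS). Qed.

Lemma local_eventsC (A : set (config d)) : local_events A -> local_events (~` A).
Proof. by move=> [S AS]; exists S => eta eta' e; rewrite /setC /= (AS _ _ e). Qed.

Lemma local_eventsI : setI_closed local_events.
Proof.
move=> A B [S AS] [T BT]; exists (S ++ T) => eta eta' e.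
rewrite /setI /= (AS eta eta') ?(BT eta eta')// => g gS; apply: e;
  by rewrite mem_cat gS ?orbT.
Qed.

Lemma local_events_gen : @measurable _ (config d) = <<s local_events >>.
Proof.
apply/seteqP; split; last first.
  apply: smallest_sub; first exact: sigma_algebra_measurable.
  by move=> A; exact: measurable_local.
apply: sub_sigma_algebra2 => _ [g [b ->]]; exists [:: g] => eta eta' e /=.
by rewrite e// mem_head.
Qed.

Hypothesis mX : measurable_fun setT X.

(** Local events are closed under complement, so the one-sided bound is an equality on them. They
    form a generating class closed under intersection, and Dynkin induction extends it. *)
Lemma law_unique :
  (forall A, local_events A -> (nu A <= P (X @^-1` A))%E) ->
  forall A, measurable A -> nu A = P (X @^-1` A).
Proof.
move=> H A; have mpre B : measurable B -> measurable (X @^-1` B).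
  by move=> mB; rewrite -[X in measurable X]setTI; exact: mX.
rewrite local_events_gen; apply: (dynkin_induction (P := fun B => nu B = P (X @^-1` B))).
- exact: local_events_gen.
- exact: local_eventsI.
- by rewrite preimage_setT !probability_setT.
- move=> B lB; apply/eqP; rewrite eq_le H//=.
  have mB := measurable_local lB; have := H _ (local_eventsC lB).
  rewrite preimage_setC !probability_setC//; last exact: mpre.
  rewrite -(fineK (fin_num_measure nu B mB)) -(fineK (fin_num_measure P _ (mpre _ mB))).
  by rewrite -!EFinB !lee_fin; lra.
- move=> B mB e; rewrite preimage_setC !probability_setC//; last exact: mpre.
  by rewrite [in LHS]e.
- move=> F mF tF e; rewrite preimage_bigcup !measure_bigcup//.
  + by apply: eq_eseriesr => k _; exact: e.
  + by move=> k _; exact: mpre.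
  + by move=> i j _ _ [om [h1 h2]]; apply: (tF i j) => //; exists (X om).
Qed.

End Uniqueness.

(** * Comparison with the stationary law *)

(** The four errors: [z] for surviving initial cycles, [t] for the discretization, [t'] for blocked
    births, [c] for exits and collisions. *)
Lemma le_quarters (R : realFieldType) (x y c p z t t' e : R) :
  x <= y + (t + t') -> y <= z + (c + p) -> z <= e / 4 -> t <= e / 4 ->
  t' <= e / 4 -> c <= e / 4 -> x <= p + e.
Proof. lra. Qed.

Section LawBound.
Variables (R : realType) (d : nat) (alpha : R) (V : site d -> \bar R).
Variables (dO : measure_display) (Omega : measurableType dO) (P : probability Omega R).
Variable N : Omega -> set (pt R d).
Hypothesis ppp : is_PPP alpha V P N.
Hypothesis fin_clan : {ae P, forall om, forall phi, N om phi -> finite_set (clan (N om) phi)}.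
Variable nu : probability (config d) R.
Hypothesis inv : L_invariant alpha V nu.
Hypothesis nu_finite : nu (finite_cycle_confs d) = 1%E.
Variable t0 : R.

Local Notation w := (weight alpha V).

Lemma nu_infinite : nu (~` finite_cycle_confs d) = 0%E.
Proof.
rewrite probability_setC; last exact: measurable_finite_cycle_confs.
by rewrite nu_finite subee.
Qed.

Lemma blocked_small L (e : R) : 0 < e ->
  exists m0, forall m, (m0 <= m)%N -> (nu (blocked_outside L m) <= e%:E)%E.
Proof.
apply: decreasing_null.
- by move=> m; exact: measurable_blocked_outside.
- by move=> m; exact: blocked_outsideS.
exists (~` finite_cycle_confs d); split.
- by apply: measurableC; exact: measurable_finite_cycle_confs.
- exact: nu_infinite.
- move=> eta be fe; have : set0 eta by rewrite -(blocked_outside_cap L).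
  by [].
Qed.

(** Outside [C] and a null set, an outcome in [A] forces the true configuration at [t0] into [A],
    hence [om] into [E]. *)
Lemma adv_prob_le (S gs : seq (cyc d)) (m M n : nat) (sigma : layer (cyc d))
    (A : (cyc d -> bool) -> Prop) (C E Z : set Omega) :
  (0 < m)%N -> (0 < M)%N -> (m * M <= n)%N -> uniq gs ->
  {subset S <= first_cycles d m} -> {subset first_cycles d m <= gs} ->
  depends_on S A ->
  C = exits N t0 S m `|` collision N t0 (M%:R^-1) (first_cycles d m) (m * M) ->
  measurable C -> measurable E -> P.-negligible Z ->
  (forall om, ~ Z om -> A (eta_at (N om) t0) -> E om) ->
  (forall g j, sigma g = Some j -> forall g', g' \in first_cycles d m ->
     incompat g g' -> (m * M <= j)%N) ->
  adv_prob (@incompat d) gs (first_cycles d m) (1 - expR (- M%:R^-1))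
    (birth_rate alpha V M%:R^-1) A n sigma <= fine (P C) + fine (P E).
Proof.
move=> m0 M0 mn ugs SL Lgs AS eC mC mE nZ AE st.
have h0 : 0 < M%:R^-1 :> R by rewrite invr_gt0 ltr0n.
have [mO PO] := adv_prob_records ppp t0 h0 ugs (first_cycles d m) n sigma A.
have [Y [mY Y0 ZY]] := negligibleU fin_clan nZ.
rewrite -lee_fin -PO EFinD !fineK ?fin_num_measure//.
apply: (@le_trans _ _ (P (C `|` E `|` Y))).
  apply: le_measure; rewrite ?inE//; first by do 2?apply: measurableU.
  move=> om O; have [Yom|nY] := pselect (Y om); [by right|left].
  have [Com|nC] := pselect (C om); [by left|right].
  have [nex nco] : ~ exits N t0 S m om /\
      ~ collision N t0 M%:R^-1 (first_cycles d m) (m * M) om.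
    by split=> b; apply: nC; rewrite eC; [left|right].
  apply: AE; first by move=> Zom; apply: nY; apply: ZY; right.
  apply: (outcome_agrees m0 M0 mn SL Lgs nex nco _ _ st O).
    by move=> ic; apply: nY; apply: ZY; left.
  by move=> eta eta' /AS ->.
apply: le_trans (measureU2 _ (measurableU _ _ mC mE) mY) _.
by rewrite [X in (_ + X)%E]Y0 adde0; exact: measureU2.
Qed.

Lemma law_bound (S : seq (cyc d)) (A : (cyc d -> bool) -> Prop) (E Z : set Omega) (e : R) :
  depends_on S A -> measurable E -> P.-negligible Z ->
  (forall om, ~ Z om -> A (eta_at (N om) t0) -> E om) -> 0 < e ->
  (nu [set eta : config d | A eta] <= P E + e%:E)%E.
Proof.
move=> AS mE nZ AE e0; have e4 : 0 < e / 4 by rewrite divr_gt0.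
have [m [m0 SL [M0 hM]]] := good_scale ppp fin_clan t0 S e4.
set L := first_cycles d m in SL hM.
pose kappa : R := (size (sites_of L))%:R.
(* Since [expR K >= K], waiting for time [K] brings [kappa * expR (- K)] below [e / 4]. *)
pose K := (Num.truncn (kappa / (e / 4))).+1.
pose T : R := (m + K)%:R.
pose WL : R := \sum_(g <- L) w g.
have w0 g : 0 <= w g by exact: weight_ge0.
have WL0 : 0 <= WL by exact: sumr_ge0.
have TW0 : 0 < T * WL + 1 by rewrite ltr_wpDl// mulr_ge0.
(* The added 1 keeps the divisor positive even if [WL] vanishes. *)
have [m1 hm1] := blocked_small L (divr_gt0 e4 TW0).
pose m' := maxn m m1; pose gs := first_cycles d m'.
have Lgs : {subset L <= gs} by apply: first_cycles_le; exact: leq_maxl.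
pose k : R := (size gs)%:R; pose W : R := \sum_(g <- gs) w g.
have W0 : 0 <= W by exact: sumr_ge0.
pose C1 : R := \sum_(g <- gs) w g ^+ 2 + (k + W) ^+ 2.
have C10 : 0 <= C1 by rewrite addr_ge0 ?sumr_ge0// => *; exact: sqr_ge0.
(* One summand per requirement: a small collision event, [T * C1 * h <= e / 4], and
   [(k + W) * h <= 1]. *)
pose M := (M0 + Num.truncn (T * C1 / (e / 4)) + Num.truncn (k + W)).+1.
have M_gt0 : (0 < M)%N by [].
have Mr : 0 < M%:R :> R by rewrite ltr0n.
have M0M : (M0 < M)%N by rewrite ltnS -addnA leq_addr.
have [mC PC] := hM M M0M.
set C := _ `|` _ in mC PC.
pose h : R := M%:R^-1.
have h0 : 0 < h by rewrite invr_gt0.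
pose n := ((m + K) * M)%N.
have nh : n%:R * h = T by rewrite /n natrM /h mulfK// gt_eqF.
have TC : T * C1 * h <= e / 4.
  rewrite /h ler_pdivrMr// [leRHS]mulrC -ler_pdivrMr//.
  apply: ltW; apply: lt_le_trans (truncnS_gt _) _; rewrite ler_nat ltnS.
  by rewrite -addnA addnCA leq_addr.
have small : (k + W) * h <= 1.
  rewrite /h ler_pdivrMr// mul1r.
  by apply: ltW; apply: lt_le_trans (truncnS_gt _) _; rewrite ler_nat ltnS leq_addl.
pose q : R := 1 - expR (- h).
pose u j := adv_fun (@incompat d) gs L q (birth_rate alpha V h) A j : config d -> R.
have uL := first_cycles_uniq d m.
have ugs := first_cycles_uniq d m'.
have q01h : 0 <= q <= 1 by exact: q01.
have a01 g : 0 <= birth_rate alpha V h g <= 1 by exact: birth_rate01.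
pose b := fine (nu (blocked_outside L m')).
have bWL : T * WL * b <= e / 4.
  have hb : b <= e / 4 / (T * WL + 1).
    rewrite -lee_fin fineK ?fin_num_measure//; last exact: measurable_blocked_outside.
    by apply: hm1; rewrite leq_maxr.
  apply: (@le_trans _ _ ((T * WL + 1) * b)).
    by rewrite ler_wpM2r ?fine_ge0// lerDl.
  by rewrite mulrC -ler_pdivlMr.
have sumstep j : \int[nu]_eta u 0%N eta <= \int[nu]_eta u j eta +
    j%:R * (h ^+ 2 * C1 + h * WL * b).
  elim: j => [|j IH]; first by rewrite mul0r addr0.
  apply: le_trans IH _.
  have := adv_integral_step inv A h0 uL Lgs small j.
  rewrite -/u -/C1 -/WL -/b -natr1; lra.
have E0 : \int[nu]_eta u 0%N eta = fine (nu [set eta : config d | A eta]).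
  rewrite -Rintegral_asbool; last exact: (@measurable_preimage d Prop S A [set Q | Q] AS).
  congr fine; apply: eq_integral => eta _; congr EFin.
  by apply: adv_fun_zero AS => // g /SL /Lgs.
have u_dep j : depends_on gs (u j) by move=> eta eta' ee; exact: adv_fun_ext.
pose p := fine (P C) + fine (P E).
have p0 : 0 <= p by rewrite addr_ge0 ?fine_ge0.
have mn : (m * M <= n)%N by rewrite leq_mul2r leq_addr orbT.
pose X := ~` finite_cycle_confs d.
have mX : measurable X by apply: measurableC; exact: measurable_finite_cycle_confs.
(* On configurations with overlapping cycles only the bound 1 is available; they form the [nu]-null
   set [X]. *)
have un_le eta : u n eta <= (kappa * (1 - q) ^+ (n - m * M) + p) + (`[< X eta >])%:R.
  case: asboolP => [Xeta|/contrapT feta].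
    have /andP[_ u1] := adv_fun01 (@incompat d) gs L q01h a01 A n eta.
    apply: le_trans u1 _; rewrite lerDr addr_ge0// mulr_ge0// exprn_ge0//.
    by rewrite subr_ge0; case/andP: q01h.
  rewrite addr0; apply: adv_fun_le => // D HD.
  apply: (adv_prob_le m0 M_gt0 mn ugs SL Lgs AS erefl mC mE nZ AE) => g j.
  rewrite /start; case: ifP => // /andP[ggs eg] [<-] g' g'L ig.
  by apply: HD => //; apply/asboolP; exists g'.
have kK : kappa * (1 - q) ^+ (n - m * M) <= e / 4.
  (* The remaining [K * M] cells of length [1 / M] last for time [K]. *)
  have -> : (1 - q) ^+ (n - m * M) = expR (- K%:R).
    rewrite /q subKr -mulnBl addKn -expRM_natl natrM mulrN -mulrA.
    by rewrite /h mulfV ?mulr1// gt_eqF.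
  rewrite -ler_pdivlMr ?expR_gt0// -expRN opprK.
  apply: (@le_trans _ _ (e / 4 * K%:R)).
    by rewrite mulrC -ler_pdivrMr//; exact/ltW/truncnS_gt.
  apply: ler_wpM2l; first exact: ltW.
  apply: le_trans (_ : _ <= 1 + K%:R) (expR_ge1Dx _).
  by rewrite lerDr.
have int_le : \int[nu]_eta u n eta <= kappa * (1 - q) ^+ (n - m * M) + p.
  have iu : nu.-integrable setT (EFin \o u n).
    apply: (@bounded_integrable _ _ _ _ 1); first exact: measurable_depends_on (u_dep n).
    move=> eta; have /andP[u0 u1] := adv_fun01 (@incompat d) gs L q01h a01 A n eta.
    by rewrite ger0_norm.
  have iX : nu.-integrable setT (EFin \o (fun eta => (`[< X eta >])%:R : R)).
    apply: (@bounded_integrable _ _ _ _ 1).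
      rewrite (_ : (fun eta => _) = \1_X); first exact: measurable_indic.
      by apply/funext => eta; rewrite indic_asbool.
    by move=> eta; rewrite ger0_norm// lern1 leq_b1.
  pose c := kappa * (1 - q) ^+ (n - m * M) + p.
  have ic : nu.-integrable setT (EFin \o (fun=> c : R)).
    by apply: (@bounded_integrable _ _ _ _ `|c|).
  have icX : nu.-integrable setT (EFin \o (fun eta => c + (`[< X eta >])%:R : R)).
    exact: (integrableD measurableT ic iX).
  have := le_Rintegral measurableT iu icX (fun eta _ => un_le eta).
  rewrite RintegralD// Rintegral_cst// Rintegral_asbool// nu_infinite addr0.
  by rewrite [fine (nu setT)](_ : _ = 1) ?mulr1// probability_setT.
have := sumstep n; rewrite E0 => hn.
have hn2 : n%:R * (h ^+ 2 * C1 + h * WL * b) = T * C1 * h + T * WL * b.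
  by rewrite -nh; ring.
have mA : measurable [set eta : config d | A eta].
  exact: (@measurable_preimage d Prop S A [set Q | Q] AS).
have PC' : fine (P C) <= e / 4 by rewrite -lee_fin fineK ?fin_num_measure.
rewrite -(fineK (fin_num_measure nu _ mA)) -(fineK (fin_num_measure P _ mE)) -EFinD lee_fin.
rewrite hn2 in hn; exact: le_quarters hn int_le kK TC bWL PC'.
Qed.

End LawBound.

Theorem theorem3p4 (R : realType) (d : nat) (alpha : R) (V : site d -> \bar R)
  (dO : measure_display) (Omega : measurableType dO) (P : probability Omega R)
  (N : Omega -> set (pt R d)) :
  0 < alpha ->
  (forall x, (0 <= V x)%E) -> V 0 = 0%E -> strictly_convex_pot V ->
  is_PPP alpha V P N ->
  {ae P, forall om, forall phi, N om phi -> finite_set (clan (N om) phi)} ->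
  forall nu : probability (config d) R,
    L_invariant alpha V nu ->
    nu (finite_cycle_confs d) = 1%E ->
    forall (t : R) (A : set (config d)), measurable A ->
      exists B : set Omega,
        [/\ measurable B,
            P.-negligible (((fun om => eta_at (N om) t) @^-1` A `\` B)
                           `|` (B `\` (fun om => eta_at (N om) t) @^-1` A))
          & nu A = P B].
Proof.
move=> _ _ _ _ ppp fin_clan nu inv nu_finite t A mA.
have [F FP] := choice (eta_version ppp fin_clan t).
(* A measurable modification of [eta_at], built coordinate by coordinate. *)
pose X (om : Omega) : config d := fun g => `[< F g om >].
pose D g := ([set om | eta_at (N om) t g] `\` F g) `|` (F g `\` [set om | eta_at (N om) t g]).
have mX : measurable_fun setT X.
  apply: (@measurability _ _ _ _ setT X (coord_events d)) => //.
  move=> _ [_ [g [b ->]] <-]; rewrite setTI.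
  have [mF _] := FP g; case: b.
    rewrite (_ : X @^-1` _ = F g)//; apply/seteqP; split => om /=.
      by move=> /asboolP.
    by move=> ?; apply/asboolP.
  rewrite (_ : X @^-1` _ = ~` F g); first exact: measurableC.
  apply/seteqP; split => om /=; first by move=> /negbT/asboolPn.
  by move=> ?; apply/negbTE/asboolPn.
(* There are countably many cycles, so the exceptional sets add up to a null set; integers coding no
   cycle contribute the empty set. *)
pose Z := \bigcup_n oapp D set0 (unpickle n).
have nZ : P.-negligible Z.
  apply: negligible_bigcup => n; case: (unpickle n) => [g|] /=; last exact: negligible_set0.
  by have [] := FP g.
have XE om : ~ Z om -> X om = eta_at (N om) t.
  move=> nZom; apply/funext => g.
  have nD : ~ D g om by move=> Dg; apply: nZom; exists (pickle g) => //=; rewrite pickleK.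
  apply/idP/idP.
    by move=> /asboolP Fg; apply: contrapT => nE; apply: nD; right.
  by move=> Eg; apply/asboolP; apply: contrapT => nF; apply: nD; left.
have mpre B : measurable B -> measurable (X @^-1` B).
  by move=> mB; rewrite -[X in measurable X]setTI; exact: mX.
exists (X @^-1` A); split; first exact: mpre.
  apply: negligibleS nZ => om diff; apply: contrapT => /XE e.
  by case: diff => -[] /=; rewrite e.
apply: law_unique mX _ A mA => B lB; have [S BS] := lB.
apply/lee_addgt0Pr => e e0.
apply: (law_bound ppp fin_clan inv nu_finite (t0 := t) BS _ nZ _ e0).
  exact: mpre (measurable_local lB).
by move=> om /XE e'; rewrite /preimage /= e'.
Qed.
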